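(* Let $n\ge 3$ and let $B_1\subset\mathbb{R}^n$ be the open unit ball. There exists a unique $\lambda^*>0$ such that the problem $$ -\Delta u=\lambda \exp(e^u)\ \text{ in } B_1\setminus\{0\},\qquad u=0\ \text{ on }\partial B_1, $$ with $\lambda=\lambda^*$, has a singular solution $u^*$ such that, as $|x|\to 0$, $$ u^*\Big(\frac{x}{\sqrt{\lambda^*}} \Big)=\ln\left[2\ln \frac{1}{|x|}+\ln\frac{n-2}{\ln\frac{1}{|x|}}+\ln\left(1+\frac{\ln \ln\frac{1}{|x|}}{2\ln\frac{1}{|x|}}\right) \right]+O\Big(\ln^{-2}\frac{1}{|x|}\Big) $$ and $$ \frac{1}{\sqrt{\lambda^*}}\,\big|\nabla u^*\big|\Big(\frac{x}{\sqrt{\lambda^*}}\Big)= \frac{1}{|x|\ln\frac{1}{|x|}}+\frac{\ln \Big(\ln\frac{1}{|x|}\Big)}{2|x| \ln^2 \frac{1}{|x|}}+O\Big( \frac{1}{|x|\ln^2\frac{1}{|x|}}\Big). $$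
   Context: Here $\exp(e^u)=e^{e^u}$, $\ln^{k} s=(\ln s)^k$, and $|\nabla u^*|(y)$ denotes $|\nabla u^*(y)|$. Solutions are classical in $B_1\setminus\{0\}$ and continuous up to $\partial B_1$; a solution is singular if it is unbounded near the origin. The notation $f=O(g)$ as $|x|\to 0$ means that $|f/g|$ is bounded for $x$ near $0$. *)

(* Defs.v *)
From HB Require Import structures.
From mathcomp Require Import all_boot all_order all_algebra.
From mathcomp Require Import all_classical all_reals all_analysis.
Import Order.TTheory GRing.Theory Num.Theory.
Import numFieldNormedType.Exports.

Set Implicit Arguments.
Unset Strict Implicit.
Unset Printing Implicit Defensive.

Local Open Scope classical_set_scope.
Local Open Scope ring_scope.

Section euclidean.
Context {R : realType} {n : nat}.
Implicit Types (x : 'rV[R]_n) (u : 'rV[R]_n -> R).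

(* The library norm `|x| on 'rV[R]_n is the sup norm; it induces the same
   topology as enorm. *)
Definition enorm x : R := Num.sqrt (\sum_(i < n) x 0 i ^+ 2).

Definition partial (i : 'I_n) u : 'rV[R]_n -> R :=
  fun x => 'D_(delta_mx 0 i) u x.

Definition gradient u x : 'rV[R]_n := \row_i partial i u x.

Definition laplacian u x : R := \sum_(i < n) partial i (partial i u) x.

Definition C1_on (A : set 'rV[R]_n) u : Prop :=
  forall x, A x ->
    [/\ {for x, continuous u},
        forall i : 'I_n, derivable u x (delta_mx 0 i)
      & forall i : 'I_n, {for x, continuous (partial i u)}].

Definition C2_on (A : set 'rV[R]_n) u : Prop :=
  C1_on A u /\ forall i : 'I_n, C1_on A (partial i u).

Definition punctured_ball : set 'rV[R]_n :=
  [set x | enorm x < 1 /\ x <> 0].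

Definition punctured_closed_ball : set 'rV[R]_n :=
  [set x | enorm x <= 1 /\ x <> 0].

(* u is a total function; its values at 0 and outside the closed unit ball
   play no role in the conditions below. *)
Definition is_solution (lambda : R) u : Prop :=
  [/\ C2_on punctured_ball u,
      {within punctured_closed_ball, continuous u},
      forall x, punctured_ball x ->
        - laplacian u x = lambda * expR (expR (u x))
    & forall x, enorm x = 1 -> u x = 0].

Definition singular u : Prop := ~ bounded_near u (0 : 'rV[R]_n)^'.

Definition log_inv x : R := ln (1 / enorm x).

End euclidean.

(* Main.v *)
(* With t = ln(1/|x|), scaled so that lambda drops out, a radial solution y(t)
   satisfies y'' = N y' - exp(e^y - 2t), N = n - 2, on a half-line, and lambda is
   read off from the zero t1 of y: lambda = exp(-2 t1).

   Existence.  The explicit profile solves this equation up to O(t^-2).  Solving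
   backwards from the profile at t = k, the linearisation
   e'' = N e' - kap e, kap ~ 2N, contracts in backward time, so a Lyapunov function
   keeps the solutions O(t^-2)-close to the profile uniformly in k and makes them
   a Cauchy sequence.  Their limit y is increasing, and as long as y >= 0 the
   nonlinearity bounds y' from below to the left, so y reaches 0.

   Uniqueness.  A solution with the prescribed asymptotics blows up at 0 but is
   not assumed radial.  Moving planes, applied to min(u, M) so that the
   singularity becomes a plateau, show that it is.  Two radial solutions with the
   same asymptotics differ by O(t^-2), while the Lyapunov function of their
   difference is nondecreasing in t, so it vanishes for large t; hence the
   solutions coincide, and so do their zeros. *)

Require Import Defs.
From HB Require Import structures.
From mathcomp Require Import all_boot all_order all_algebra.
From mathcomp Require Import all_classical all_reals all_analysis.
From mathcomp Require Import ring lra.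
Import Order.TTheory GRing.Theory Num.Theory.
Import numFieldNormedType.Exports.

Local Open Scope classical_set_scope.
Local Open Scope ring_scope.

(** The limiting coefficient [2 N] is the product of [exp y], about [2 t], and of the nonlinearity
    along the profile, about [N / t]. The roots of z^2 - N z + 2 N have positive real part, so every
    perturbation of the profile grows forward in [t]: data on the left cannot be aimed at the
    asymptotics, while terminal data far to the right are forgotten on the way back. The same
    instability leaves no free parameter, which is why the asymptotics single out one solution.

    For a plane at height [mu > 0] the singularity is harmless: points beyond the plane have |x| >
    mu, where [u] stays below some [M], and a reflected value that drops below the value beyond the
    plane is below [M] too. The equation is thus used only where truncation at [M] changes nothing,
    and mu -> 0 comes last.

    Comparing a function with its reflection calls for a Laplacian computed in a reflected frame.
    Iterated partial derivatives do not transform directly, hence the second derivatives along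
    lines. *)

Section one_variable_calculus.
Context {R : realType}.
Implicit Types (f g df : R -> R) (x a b d : R).

(** * Differentiation rules, mean value arguments and limits of derivatives *)

Lemma is_der_cst x a : is_derive x 1 (fun _ : R => a) 0.
Proof. exact: is_derive_cst. Qed.

Lemma is_der_id x : is_derive x 1 (fun z : R => z) 1.
Proof. exact: is_derive_id. Qed.

Lemma is_der_add f g x a b : is_derive x 1 f a -> is_derive x 1 g b ->
  is_derive x 1 (fun z => f z + g z) (a + b).
Proof. exact: is_deriveD. Qed.

Lemma is_der_opp f x a : is_derive x 1 f a -> is_derive x 1 (fun z => - f z) (- a).
Proof. exact: is_deriveN. Qed.

Lemma is_der_mul f g x a b : is_derive x 1 f a -> is_derive x 1 g b ->
  is_derive x 1 (fun z => f z * g z) (a * g x + f x * b).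
Proof.
move=> fa gb; have H := @is_deriveM _ _ f g x 1 a b fa gb.
by apply: (is_derive_eq H); rewrite addrC /GRing.scale /= mulrC.
Qed.

Lemma is_der_comp f g x a b : is_derive x 1 f a -> is_derive (f x) 1 g b ->
  is_derive x 1 (fun z => g (f z)) (b * a).
Proof. by move=> fa gb; apply: is_derive1_comp. Qed.

Lemma is_der_exp f x a : is_derive x 1 f a ->
  is_derive x 1 (fun z => expR (f z)) (expR (f x) * a).
Proof. by move=> fa; apply: is_der_comp fa _; exact: is_derive_expR. Qed.

Lemma is_der_ln f x a : 0 < f x -> is_derive x 1 f a ->
  is_derive x 1 (fun z => ln (f z)) ((f x)^-1 * a).
Proof. by move=> fx fa; apply: is_der_comp fa _; exact: is_derive1_ln. Qed.

Lemma is_der_inv f x a : f x != 0 -> is_derive x 1 f a ->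
  is_derive x 1 (fun z => (f z)^-1) (- (f x)^-2 * a).
Proof. exact: is_deriveV. Qed.

Lemma is_der_expr f x a n : is_derive x 1 f a ->
  is_derive x 1 (fun z => f z ^+ n) (n%:R * f x ^+ n.-1 * a).
Proof.
move=> fa; have H := @is_deriveX _ _ f n x 1 a fa.
have -> : (fun z => f z ^+ n) = f ^+ n by apply/funext => z; rewrite exprfctE.
exact: (is_derive_eq H).
Qed.

Lemma is_der_continuous f x d : is_derive x 1 f d -> {for x, continuous f}.
Proof.
by move=> [df _]; apply: differentiable_continuous; exact/derivable1_diffP.
Qed.

Lemma is_der_continuous_within f df a b :
  (forall x, a <= x <= b -> is_derive x 1 f (df x)) ->
  {within `[a, b], continuous f}.
Proof.
move=> fdf; apply: continuous_in_subspaceT => x; rewrite inE /= in_itv /= => xab.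
exact: is_der_continuous (fdf _ xab).
Qed.

Lemma mvt f df a b : a <= b ->
  (forall x, a <= x <= b -> is_derive x 1 f (df x)) ->
  exists2 c, a <= c <= b & f b - f a = df c * (b - a).
Proof.
move=> ab fdf; have [||c] := @MVT_segment R f df a b ab.
- by move=> x; rewrite in_itv /= => /andP[/ltW ax /ltW xb]; apply: fdf; rewrite ax.
- exact: is_der_continuous_within fdf.
- by rewrite in_itv /= => cab ->; exists c.
Qed.

Lemma is_der_ge0_le f df a b : a <= b ->
  (forall x, a <= x <= b -> is_derive x 1 f (df x)) ->
  (forall x, a <= x <= b -> 0 <= df x) -> f a <= f b.
Proof.
move=> ab fdf df0; have [c cab] := mvt _ _ _ _ ab fdf.
by rewrite -subr_ge0 => ->; rewrite mulr_ge0 ?df0// subr_ge0.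
Qed.

Lemma is_der_gt0_lt f df a b : a < b ->
  (forall x, a <= x <= b -> is_derive x 1 f (df x)) ->
  (forall x, a <= x <= b -> 0 < df x) -> f a < f b.
Proof.
move=> ab fdf df0; have [c cab] := mvt _ _ _ _ (ltW ab) fdf.
by rewrite -subr_gt0 => ->; rewrite mulr_gt0 ?df0// subr_gt0.
Qed.

(** Division-free, so that it combines with uniform estimates and with [h = 0] included. *)
Lemma is_der_epsP f x d : is_derive x 1 f d <->
  forall e, 0 < e -> exists2 r, 0 < r &
    forall h, `|h| < r -> `|f (x + h) - f x - h * d| <= e * `|h|.
Proof.
split=> [fd e e0|H].
- have [fd1 fd2] := fd.
  have /derivable_nbhsP := fd1; rewrite fd2 => /eqaddoP /(_ e e0).
  move=> /nbhs_ballP[r /= r0 rP]; exists r => // h hr.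
  have bh : ball 0 r h by rewrite /ball /= sub0r normrN.
  have H : `|f (h * 1 + x) - (f x + h * d)| <= e * `|h| := rP h bh.
  by rewrite mulr1 [h + x]addrC opprD addrA in H.
- suff H1 : (fun h => h^-1 *: ((f \o shift x) (h *: (1 : R)) - f x)) @ 0^' --> d.
    have dv : derivable f x 1 by apply/cvg_ex; exists d.
  apply: (@DeriveDef _ _ _ x 1 f d dv); exact: cvg_lim.
  apply/cvgrPdist_le => e e0; have [r r0 rP] := H _ e0.
  near=> h.
  have h0 : h != 0 by near: h; exact: nbhs_dnbhs_neq.
  rewrite /GRing.scale /= mulr1 /shift /= [h + x]addrC.
  have -> : d - h^-1 * (f (x + h) - f x) = - (h^-1 * (f (x + h) - f x - h * d)).
    by field.
  rewrite normrN normrM normfV ler_pdivrMl ?normr_gt0// [leRHS]mulrC.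
  apply: rP; near: h; apply: dnbhs0_lt => //.
Unshelve. all: by end_near. Qed.

Lemma continuous_epsP f x : {for x, continuous f} <->
  forall e, 0 < e -> exists2 r, 0 < r &
    forall h, `|h| < r -> `|f (x + h) - f x| <= e.
Proof.
split=> [fc e e0|H].
- have /cvgrPdist_le /(_ _ e0) /nbhs_ballP[r /= r0 rP] := fc.
  exists r => // h hr; rewrite distrC; apply: rP.
  by rewrite /ball /= opprD addrA subrr sub0r normrN.
- apply/cvgrPdist_le => e e0; have [r r0 rP] := H _ e0.
  apply/nbhs_ballP; exists r => // z; rewrite /ball /= distrC => zr.
  by have := rP _ zr; rewrite [x + _]addrC subrK distrC.
Qed.

(** The limit is the supremum of the lower bounds [u k - e k], each of which lies below every
    [u m + e m]; the error at each index stays explicit. *)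
Lemma cauchy_limit (u e : nat -> R) :
  (forall k m, (k <= m)%N -> `|u k - u m| <= e k) ->
  exists l, forall k, `|l - u k| <= e k.
Proof.
move=> H; have e0 k : 0 <= e k by apply: le_trans (H k k (leqnn _)).
have lohi k m : u k - e k <= u m + e m.
  have := H _ _ (leq_maxl k m); have := H _ _ (leq_maxr k m).
  rewrite !ler_norml => /andP[A B] /andP[C D]; lra.
pose A := range (fun k => u k - e k).
have A0 : A !=set0 by exists (u 0%N - e 0%N); exists 0%N.
exists (sup A) => k; rewrite ler_norml; apply/andP; split.
- rewrite lerBrDr addrC; apply: sup_upper_bound; last by exists k.
  by split => //; exists (u k + e k) => _ [m _ <-]; exact: lohi.
- by rewrite lerBlDr addrC; apply: ge_sup => // _ [m _ <-]; exact: lohi.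
Qed.

(** The increment of [F - f k] is at most [2 * e k * |h|]: the mean value theorem gives this for
    [f p - f k] with [p] far out, and [F] is uniformly close to [f p]. *)
Lemma is_der_limit (f df : nat -> R -> R) (F D : R -> R) (e : nat -> R) x0 r :
  0 < r -> (forall d, 0 < d -> exists k, e k < d) ->
  (forall k x, `|x - x0| < r -> is_derive x 1 (f k) (df k x)) ->
  (forall k x, `|x - x0| < r -> `|F x - f k x| <= e k) ->
  (forall k x, `|x - x0| < r -> `|D x - df k x| <= e k) ->
  is_derive x0 1 F (D x0).
Proof.
move=> r0 e0 fdf Ff Ddf.
have x0r : `|x0 - x0| < r by rewrite subrr normr0.
have key k h : `|h| < r ->
    `|(F (x0 + h) - f k (x0 + h)) - (F x0 - f k x0)| <= 2 * e k * `|h|.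
  move=> hr; have x0hr : `|x0 + h - x0| < r by rewrite addrC addKr.
  apply/ler_addgt0Pr => d d0.
  (* [e] may fail to be monotone. The first bound controls the derivative of [f p - f k] by
     [2 * e k]; the second makes replacing [F] by [f p] at two points cost less than [d]. *)
  have [p [ep1 ep2]] : exists p, e p <= e k /\ e p < d / 4.
    have [l el] := e0 (d / 4) (divr_gt0 d0 (ltr0n _ 4)).
    have [ekd|ekd] := ltP (e k) (d / 4); first by exists k.
    by exists l; split => //; rewrite (le_trans (ltW el)).
  have step : `|(f p (x0 + h) - f k (x0 + h)) - (f p x0 - f k x0)| <= 2 * e k * `|h|.
    pose G z := f p z - f k z.
    have dG z : `|z - x0| < r -> is_derive z 1 G (df p z - df k z).
      by move=> zr; apply: is_der_add; [exact: fdf|apply: is_der_opp; exact: fdf].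
    have bG z : `|z - x0| < r -> `|df p z - df k z| <= 2 * e k.
      move=> zr; have := Ddf p _ zr; have := Ddf k _ zr.
      rewrite !ler_norml => /andP[? ?] /andP[? ?]; apply/andP; split; lra.
    rewrite -/(G _) -/(G x0); have [h0|h0] := leP 0 h.
    - have [|z|c cP ->] := @mvt G (fun z => df p z - df k z) x0 (x0 + h).
      + by rewrite lerDl.
      + move=> /andP[z1 z2]; apply: dG; rewrite ger0_norm ?subr_ge0//.
        by rewrite ger0_norm// in hr; lra.
      + rewrite [x0 + h - x0]addrC addKr normrM ler_wpM2r// bG//.
        case/andP: cP => c1 c2; rewrite ger0_norm ?subr_ge0//.
        by rewrite ger0_norm// in hr; lra.
    - have [|z|c cP] := @mvt G (fun z => df p z - df k z) (x0 + h) x0.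
      + by rewrite gerDl ltW.
      + move=> /andP[z1 z2]; apply: dG; rewrite distrC ger0_norm ?subr_ge0//.
        by rewrite ltr0_norm// in hr; lra.
      + rewrite distrC => ->; rewrite opprD addrA subrr sub0r normrM normrN.
        rewrite ler_wpM2r// bG//.
        case/andP: cP => c1 c2; rewrite distrC ger0_norm ?subr_ge0//.
        by rewrite ltr0_norm// in hr; lra.
  move: step (Ff p _ x0r) (Ff p _ x0hr); rewrite !ler_norml.
  set X := 2 * e k * _ => /andP[? ?] /andP[? ?] /andP[? ?].
  apply/andP; split; lra.
apply/is_der_epsP => d d0.
have [k ek] := e0 (d / 4) (divr_gt0 d0 (ltr0n _ 4)).
have /is_der_epsP /(_ (d / 4) (divr_gt0 d0 (ltr0n _ 4))) [q q0 qP] := fdf k _ x0r.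
exists (Num.min r q); first by rewrite lt_min r0.
move=> h; rewrite lt_min => /andP[hr hq].
have h0 := normr_ge0 h.
have A1 : 2 * e k * `|h| <= d / 2 * `|h| by rewrite ler_wpM2r//; lra.
have A2 : `|h * (D x0 - df k x0)| <= d / 4 * `|h|.
  by rewrite normrM mulrC ler_wpM2r// (le_trans (Ddf k _ x0r))// ltW.
have -> : F (x0 + h) - F x0 - h * D x0 =
  ((F (x0 + h) - f k (x0 + h)) - (F x0 - f k x0)) +
  (f k (x0 + h) - f k x0 - h * df k x0) - h * (D x0 - df k x0) by ring.
rewrite (le_trans (ler_normB _ _))// (le_trans (lerD (ler_normD _ _) (lexx _)))//.
have := key k h hr; have := qP h hq; lra.
Qed.

End one_variable_calculus.

(* [is_derive] is a class: without [notypeclasses] its instances would fill in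
   the derivative in an uncontrolled form. *)
Ltac der := repeat first
  [ eassumption
  | notypeclasses refine (is_der_cst _ _)
  | notypeclasses refine (is_der_id _)
  | notypeclasses refine (is_der_add _ _ _ _ _ _ _)
  | notypeclasses refine (is_der_opp _ _ _ _)
  | notypeclasses refine (is_der_mul _ _ _ _ _ _ _)
  | notypeclasses refine (is_der_exp _ _ _ _)
  | notypeclasses refine (is_der_expr _ _ _ _ _)
  | notypeclasses refine (is_der_inv _ _ _ _ _)
  | notypeclasses refine (is_der_ln _ _ _ _ _) ].
Ltac der_eq := notypeclasses refine (is_derive_eq _ _); [der|rewrite /=].

(** * Antiderivatives and global Picard iteration *)

Section picard.
Context {R : realType}.
Implicit Types (f F G : R -> R) (x y z w c t : R).

Lemma antiderivative_on_ball f (S : R) : 0 < S -> continuous f ->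
  exists2 F : R -> R, F 0 = 0 & forall x, `|x| < S -> is_derive x 1 F (f x).
Proof.
move=> S0 cf.
pose F0 x : R := (\int[lebesgue_measure]_(t in [set` `[- S, x]]) (f t))%R.
have dF0 x : `|x| < S -> is_derive x 1 F0 (f x).
  rewrite ltr_norml => /andP[Sx xS].
  have [dF FE] : derivable F0 x 1 /\ derive1 F0 x = f x.
    apply: (@continuous_FTC1_closed R f (- S) x S) => //; last exact: cf.
    apply: continuous_compact_integrable; first exact: segment_compact.
    exact: continuous_subspaceT.
  by apply: (@DeriveDef _ _ _ x 1 F0 (f x) dF); rewrite -derive1E.
exists (fun x => F0 x + - F0 0); first by rewrite subrr.
by move=> x /dF0 ?; der_eq; rewrite addr0.
Qed.

Lemma der0_eq F G f (S : R) : F 0 = G 0 ->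
  (forall x, `|x| < S -> is_derive x 1 F (f x)) ->
  (forall x, `|x| < S -> is_derive x 1 G (f x)) ->
  forall x, `|x| < S -> F x = G x.
Proof.
move=> FG0 dF dG x xS; apply/eqP; rewrite -subr_eq0; apply/eqP.
pose H z := F z + - G z.
have dH z : `|z| < S -> is_derive z 1 H 0.
  by move=> zS; have := dF _ zS; have := dG _ zS => ? ?; der_eq; rewrite subrr.
have H0 : H 0 = 0 by rewrite /H FG0 subrr.
rewrite -/(H x); have [x0|x0] := leP 0 x.
- have [|z|c _] := @mvt R H (fun _ => 0) 0 x; first by [].
    by move=> /andP[z0 zx]; apply: dH; rewrite ger0_norm// (le_lt_trans zx)// -(ger0_norm x0).
  by rewrite mul0r H0 subr0.
- have [|z|c _] := @mvt R H (fun _ => 0) x 0; first exact: ltW.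
    move=> /andP[z0 zx]; apply: dH; rewrite ler0_norm//.
    by rewrite ltr0_norm// in xS; rewrite (le_lt_trans _ xS)// lerN2.
  by rewrite mul0r H0 sub0r => /eqP; rewrite oppr_eq0 => /eqP.
Qed.

(** Antiderivatives on balls around 0 that vanish at 0 agree where both are defined. They are glued
    by evaluating at [x] the one belonging to radius [|x| + 1]. *)
Lemma antiderivative f : continuous f ->
  exists2 F : R -> R, F 0 = 0 & forall x, is_derive x 1 F (f x).
Proof.
move=> cf.
have /choice[P PP] : forall S : R, exists F : R -> R, 0 < S -> F 0 = 0 /\
    forall x, `|x| < S -> is_derive x 1 F (f x).
  move=> S; have [S0|S0] := ltP 0 S; last by exists f.
  by have [F F0 dF] := antiderivative_on_ball _ _ S0 cf; exists F.
have n1 (x : R) : 0 < `|x| + 1 by rewrite ltr_wpDl.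
exists (fun x => P (`|x| + 1) x); first exact: (PP _ (n1 0)).1.
move=> x; have n2 : 0 < `|x| + 2 by rewrite ltr_wpDl.
have [_ /(_ x)] := PP _ n2.
have xx : `|x| < `|x| + 2 by rewrite ltrDl.
move=> /(_ xx); apply: near_eq_is_derive.
apply/nbhs_ballP; exists 1 => //= z; rewrite /ball /= => xz.
have zx : `|z| < `|x| + 1.
  rewrite -[z](subrK x) (le_lt_trans (ler_normD _ _))// addrC ltrD2l distrC//.
have [P1 P2] := PP _ (n1 z); have [P3 P4] := PP _ n2.
apply: (der0_eq _ _ f (`|z| + 1)); rewrite ?P1 ?P3//; last by rewrite ltrDl.
move=> w wz; apply: P4; rewrite (lt_le_trans wz)//.
by rewrite -[2]/(1 + 1) addrA lerD2r ltW.
Qed.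

Lemma antiderivative_at f (a c : R) : continuous f ->
  exists2 F : R -> R, F c = a & forall x, is_derive x 1 F (f x).
Proof.
move=> /antiderivative[F _ dF]; exists (fun x => F x + (a - F c)).
  by rewrite addrC subrK.
by move=> x; have := dF x => ?; der_eq; rewrite addr0.
Qed.

(** Integration gains a factor [1 / w] in the norm weighted by [exp (w |x - c|)]. For large [w] this
    makes the Picard map a contraction on the whole line at once. *)
Lemma exp_abs_bound f (df : R -> R) (C w c : R) : 0 < w -> 0 <= C -> f c = 0 ->
  (forall x, is_derive x 1 f (df x)) ->
  (forall x, `|df x| <= C * expR (w * `|x - c|)) ->
  forall x, `|f x| <= C / w * expR (w * `|x - c|).
Proof.
move=> w0 C0 fc dfP dfb.
have key (g dg : R -> R) : g 0 = 0 -> (forall x, is_derive x 1 g (dg x)) ->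
    (forall x, 0 <= x -> dg x <= C * expR (w * x)) ->
    forall x, 0 <= x -> g x <= C / w * expR (w * x).
  move=> g0 dgP dgb x x0.
  pose h z := C / w * expR (w * z) + - g z.
  have dh z : is_derive z 1 h (C * expR (w * z) - dg z).
    by have := dgP z => ?; der_eq; field; rewrite gt_eqF.
  have : h 0 <= h x.
    apply: (is_der_ge0_le _ (fun z => C * expR (w * z) - dg z) _ _ x0) => // z /andP[z0 _].
    by rewrite subr_ge0 dgb.
  rewrite /h g0 subr0 => H; rewrite -subr_ge0 (le_trans _ H)//.
  by rewrite mulr_ge0 ?expR_ge0// divr_ge0// ltW.
move=> x.
have dfy y : is_derive y 1 (fun z => f (c + z)) (df (c + y)).
  notypeclasses refine (is_derive_eq (is_der_comp _ _ _ _ _ _ (dfP _)) _); first by der.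
  by rewrite add0r mulr1.
have dfy' y : is_derive y 1 (fun z => f (c + - z)) (- df (c - y)).
  notypeclasses refine (is_derive_eq (is_der_comp _ _ _ _ _ _ (dfP _)) _); first by der.
  by rewrite add0r mulrN1.
have [xc|xc] := leP 0 (x - c).
- have E : c + (x - c) = x by rewrite addrC subrK.
  have b z : 0 <= z -> `|df (c + z)| <= C * expR (w * z).
    by move=> z0; rewrite (le_trans (dfb _))// [c + z]addrC addrK ger0_norm.
  rewrite (ger0_norm xc) ler_norml; apply/andP; split.
    rewrite lerNl.
    have := key (fun z => - f (c + z)) (fun z => - df (c + z)) _ _ _ (x - c) xc.
    rewrite E; apply.
    + by rewrite addr0 fc oppr0.
    + by move=> z /b; apply: le_trans; rewrite -normrN ler_norm.
  have := key (fun z => f (c + z)) (fun z => df (c + z)) _ _ _ (x - c) xc.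
  rewrite E; apply => //.
  + by rewrite addr0 fc.
  + by move=> z /b; apply: le_trans; rewrite ler_norm.
- have b z : 0 <= z -> `|df (c - z)| <= C * expR (w * z).
    by move=> z0; rewrite (le_trans (dfb _))// [c - z]addrC addrK normrN ger0_norm.
  have xc' : 0 <= c - x by rewrite -opprB oppr_ge0 ltW.
  have E : c - (c - x) = x by rewrite opprB addrC subrK.
  rewrite distrC (ger0_norm xc') ler_norml; apply/andP; split.
    rewrite lerNl.
    have := key (fun z => - f (c - z)) (fun z => - - df (c - z)) _ _ _ (c - x) xc'.
    rewrite E; apply.
    + by rewrite subr0 fc oppr0.
    + by move=> z /b; apply: le_trans; rewrite opprK ler_norm.
  have := key (fun z => f (c - z)) (fun z => - df (c - z)) _ _ _ (c - x) xc'.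
  rewrite E; apply => //.
  + by rewrite subr0 fc.
  + by move=> z /b; apply: le_trans; rewrite -normrN ler_norm.
Qed.

Lemma geometric_small (M d : R) : 0 < d -> exists k : nat, M / 2 ^+ k < d.
Proof.
move=> d0; pose k := Num.bound (`|M| / d); exists k.
have : `|M| / d < k%:R by apply: archi_boundP; rewrite divr_ge0// ltW.
rewrite ltr_pdivrMr// => H; rewrite ltr_pdivrMr ?exprn_gt0//.
rewrite (le_lt_trans (ler_norm M))// (lt_le_trans H)// mulrC ler_wpM2l ?ltW//.
by rewrite -natrX ltr_nat ltn_expl.
Qed.

(** The weighted norm replaces the usual short time interval, so there are no local solutions to
    continue: the iterates converge on all of R, uniformly on bounded sets. *)
Lemma picard (G : R -> R -> R) (N L B c a b : R) : 0 <= L ->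
  (forall Y : R -> R, continuous Y -> continuous (fun t => G t (Y t))) ->
  (forall t u v, `|G t u - G t v| <= L * `|u - v|) ->
  (forall t, `|G t a| <= B) ->
  exists y p : R -> R, [/\ y c = a, p c = b &
    forall t : R, is_derive t 1 y (p t) /\
                  is_derive t 1 p (N * p t - G t (y t))].
Proof.
move=> L0 cG LG BG.
(* [A] selects an antiderivative of [q.1] with value [q.2] at [c]. A discontinuous [q.1] gets a
   dummy value, so that the iteration is defined before its iterates are known to be continuous. *)
have /choice[A AP] : forall q : (R -> R) * R, exists F : R -> R,
    continuous q.1 -> F c = q.2 /\ forall x, is_derive x 1 F (q.1 x).
  move=> [f v] /=; have [cf|ncf] := pselect (continuous f); last by exists f.
  by have [F Fc dF] := antiderivative_at _ v c cf; exists F.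
pose rhs (z : (R -> R) * (R -> R)) t := N * z.2 t - G t (z.1 t).
pose step (z : (R -> R) * (R -> R)) := (A (z.2, a), A (rhs z, b)).
pose z0 : (R -> R) * (R -> R) := ((fun=> a), (fun=> b)).
pose z k := iter k step z0.
have crhs0 q : continuous q.1 -> continuous q.2 -> continuous (rhs q).
  move=> c1 c2 t; apply: cvgB; last exact: cG c1 t.
  by apply: cvgM; [exact: cvg_cst|exact: c2].
have cz k : continuous (z k).1 /\ continuous (z k).2.
  elim: k => [|k [c1 c2]]; first by split; exact: cst_continuous.
  have c3 := crhs0 _ c1 c2.
  split=> t; rewrite /z iterS.
    exact: is_der_continuous ((AP ((z k).2, a) c2).2 t).
  exact: is_der_continuous ((AP (rhs (z k), b) c3).2 t).
have crhs k := crhs0 _ (cz k).1 (cz k).2.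
have zc k : (z k).1 c = a /\ (z k).2 c = b.
  case: k => [//|k]; rewrite /z iterS; split.
    by have [] := AP ((z k).2, a) (cz k).2.
  by have [] := AP (rhs (z k), b) (crhs k).
have dz k t : is_derive t 1 (z k.+1).1 ((z k).2 t) /\
              is_derive t 1 (z k.+1).2 (rhs (z k) t).
  rewrite {1 3}/z iterS; split.
    by have [_] := AP ((z k).2, a) (cz k).2; apply.
  by have [_] := AP (rhs (z k), b) (crhs k); apply.
(* Makes both [1 / w] and [(|N| + L) / w] at most 1/2, the contraction factor of the two
   components. *)
pose w := 2 * (1 + `|N| + L).
have w2 : 2 <= w by rewrite /w ler_peMr// -addrA lerDl addr_ge0.
have w0 : 0 < w by rewrite (lt_le_trans _ w2).
pose E t := expR (w * `|t - c|).
have E1 t : 1 <= E t by rewrite -expR0 ler_expR mulr_ge0// ltW.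
have B0 : 0 <= B by rewrite (le_trans _ (BG c)).
pose C := (`|b| + `|N| * `|b| + B) / w.
have C0 : 0 <= C by rewrite divr_ge0 ?(ltW w0)// !addr_ge0// mulr_ge0.
have diff k t : `|(z k.+1).1 t - (z k).1 t| <= C / 2 ^+ k * E t /\
                `|(z k.+1).2 t - (z k).2 t| <= C / 2 ^+ k * E t.
  elim: k t => [|k IH] t.
    have C1 : 0 <= `|b| + `|N| * `|b| + B by rewrite !addr_ge0// mulr_ge0.
    rewrite expr0 divr1; split.
      apply: (exp_abs_bound (fun t => (z 1%N).1 t + - a) (fun=> b)) => //.
      - by rewrite (zc 1%N).1 subrr.
      - by move=> x; have [? _] := dz 0%N x; der_eq; rewrite addr0.
      - move=> x; apply: (@le_trans _ _ (`|b| + `|N| * `|b| + B));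
          last by apply: ler_peMr => //; exact: E1.
        by rewrite -addrA lerDl addr_ge0// mulr_ge0.
    apply: (exp_abs_bound (fun t => (z 1%N).2 t + - b) (rhs z0)) => //.
    - by rewrite (zc 1%N).2 subrr.
    - by move=> x; have [_ ?] := dz 0%N x; der_eq; rewrite addr0.
    - move=> x; apply: (@le_trans _ _ (`|b| + `|N| * `|b| + B));
          last by apply: ler_peMr => //; exact: E1.
        rewrite /rhs /z0 /= (le_trans (ler_normB _ _))// normrM -addrA.
        by rewrite ler_wpDl// lerD2l.
  have Ck : 0 <= C / 2 ^+ k by rewrite divr_ge0// exprn_ge0.
  have CkS : C / 2 ^+ k.+1 = C / 2 ^+ k / 2 by rewrite exprSr invfM mulrA.
  have [K1 K2] : 1 / w <= 2^-1 /\ (`|N| + L) / w <= 2^-1.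
    split; rewrite ler_pdivrMr// ler_pdivlMl ?mulr1//.
    by rewrite /w ler_wpM2l// -addrA lerDr.
  split.
    apply: (le_trans (exp_abs_bound (fun t => (z k.+2).1 t + - (z k.+1).1 t)
      (fun t => (z k.+1).2 t - (z k).2 t) (C / 2 ^+ k) w c w0 Ck _ _ _ t)).
    - by rewrite (zc k.+2).1 (zc k.+1).1 subrr.
    - by move=> x; have [? _] := dz k.+1 x; have [? _] := dz k x; der.
    - by move=> x; exact: (IH x).2.
    rewrite CkS ler_wpM2r ?expR_ge0// ler_wpM2l//.
    by rewrite -[w^-1]mul1r.
  have Ck' : 0 <= C / 2 ^+ k * (`|N| + L) by rewrite mulr_ge0// addr_ge0.
  apply: (le_trans (exp_abs_bound (fun t => (z k.+2).2 t + - (z k.+1).2 t)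
      (fun t => rhs (z k.+1) t - rhs (z k) t) (C / 2 ^+ k * (`|N| + L)) w c w0 Ck' _ _ _ t)).
  - by rewrite (zc k.+2).2 (zc k.+1).2 subrr.
  - by move=> x; have [_ ?] := dz k.+1 x; have [_ ?] := dz k x; der.
  - move=> x; rewrite /rhs.
    have -> : N * (z k.+1).2 x - G x ((z k.+1).1 x) - (N * (z k).2 x - G x ((z k).1 x))
      = N * ((z k.+1).2 x - (z k).2 x) - (G x ((z k.+1).1 x) - G x ((z k).1 x)) by ring.
    rewrite (le_trans (ler_normB _ _))// normrM -/(E x).
    have H1 := ler_wpM2l (normr_ge0 N) (IH x).2.
    have H2 := le_trans (LG x _ _) (ler_wpM2l L0 (IH x).1).
    have -> : C / 2 ^+ k * (`|N| + L) * E x =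
      `|N| * (C / 2 ^+ k * E x) + L * (C / 2 ^+ k * E x) by ring.
    exact: lerD.
  by rewrite CkS ler_wpM2r ?expR_ge0// -[leLHS]mulrA ler_wpM2l.
have tele (u : nat -> R) (e : R) : 0 <= e ->
    (forall k, `|u k.+1 - u k| <= C / 2 ^+ k * e) ->
    forall k m, (k <= m)%N -> `|u k - u m| <= 2 * C / 2 ^+ k * e.
  move=> e0 H k m /subnK <-.
  (* The exact geometric partial sum, instead of its bound, is what carries the induction on the
     gap. *)
  have : `|u k - u ((m - k) + k)%N| <=
      2 * C * ((2 ^+ k)^-1 - (2 ^+ ((m - k) + k))^-1) * e.
    elim: (m - k)%N => [|d IH]; first by rewrite add0n !subrr normr0 mulr0 mul0r.
    have := H (d + k)%N; rewrite distrC => Hd.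
    have := ler_distD (u (d + k)%N) (u k) (u (d.+1 + k)%N).
    rewrite addSn exprS invfM; lra.
  move=> /le_trans; apply; rewrite ler_wpM2r// ler_wpM2l//; first exact: mulr_ge0.
  by rewrite gerBl invr_ge0 exprn_ge0.
have lim (u : nat -> R -> R) : (forall k t, `|u k.+1 t - u k t| <= C / 2 ^+ k * E t) ->
    exists l : R -> R, forall t k, `|l t - u k t| <= 2 * C / 2 ^+ k * E t.
  move=> H.
  have Q t : exists l : R, forall k, `|l - u k t| <= 2 * C / 2 ^+ k * E t.
    apply: (cauchy_limit (fun k => u k t) (fun k => 2 * C / 2 ^+ k * E t)).
    apply: (tele (fun k => u k t)); first exact: expR_ge0.
    by move=> k; exact: H.
  by have [l lP] := choice Q; exists l.
have [y yP] := lim (fun k => (z k).1) (fun k t => (diff k t).1).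
have [p pP] := lim (fun k => (z k).2) (fun k t => (diff k t).2).
have Ec : E c = 1 by rewrite /E subrr normr0 mulr0 expR0.
have at_c (v l : R) : (forall k, `|l - v| <= 2 * C / 2 ^+ k * E c) -> l = v.
  move=> H; apply/eqP; rewrite -subr_eq0 -normr_le0; apply/ler_addgt0Pr => d d0.
  have [k kd] := geometric_small (2 * C) d d0; rewrite add0r.
  by have := H k; rewrite Ec mulr1 => /le_trans; apply; exact: ltW.
exists y, p; split.
- by apply: at_c => k; have := yP c k; rewrite (zc k).1.
- by apply: at_c => k; have := pP c k; rewrite (zc k).2.
move=> t0.
pose K := expR (w * (`|t0 - c| + 1)).
have EK t : `|t - t0| < 1 -> E t <= K.
  move=> tt; rewrite ler_expR ler_wpM2l ?(ltW w0)//.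
  by rewrite (le_trans (ler_distD t0 _ _))// addrC lerD2l ltW.
(* The factor [1 + |N| + L] lets one error serve for [y], for [p] and for the right-hand side of the
   equation for [p]. *)
pose e k := 2 * C * K * (1 + `|N| + L) / 2 ^+ k.
have eP k : e k = 2 * C / 2 ^+ k * K * (1 + `|N| + L) by rewrite /e; ring.
have NL : 1 <= 1 + `|N| + L by rewrite -addrA lerDl addr_ge0.
have Ck k : 0 <= 2 * C / 2 ^+ k by rewrite divr_ge0 ?exprn_ge0// mulr_ge0.
have CK k : 0 <= 2 * C / 2 ^+ k * K by rewrite mulr_ge0// expR_ge0.
have e_le k t : `|t - t0| < 1 -> 2 * C / 2 ^+ k * E t <= 2 * C / 2 ^+ k * K.
  by move=> tt; rewrite ler_wpM2l// EK.
have e_le1 k : 2 * C / 2 ^+ k * K <= e k by rewrite eP ler_peMr.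
have C2 : 0 <= 2 * C by rewrite mulr_ge0.
have half k : 2 * C / 2 ^+ k.+1 * K <= 2 * C / 2 ^+ k * K.
  rewrite ler_wpM2r ?expR_ge0// ler_wpM2l// lef_pV2 ?posrE ?exprn_gt0//.
  by rewrite exprS ler_peMl ?exprn_ge0// ler1n.
split.
(* The derivative of iterate [k.+1] is expressed by iterate [k], hence the shift. *)
- apply: (is_der_limit (fun k => (z k.+1).1) (fun k => (z k).2) y p e t0 1) => //.
  + exact: geometric_small.
  + by move=> k x _; have [] := dz k x.
  + move=> k x xt; rewrite (le_trans (yP x k.+1))// (le_trans (e_le _ _ xt))//.
    exact: le_trans (half k) (e_le1 k).
  + by move=> k x xt; rewrite (le_trans (pP x k))// (le_trans (e_le _ _ xt)).
- apply: (is_der_limit (fun k => (z k.+1).2) (fun k => rhs (z k)) p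
    (fun t => N * p t - G t (y t)) e t0 1) => //.
  + exact: geometric_small.
  + by move=> k x _; have [] := dz k x.
  + move=> k x xt; rewrite (le_trans (pP x k.+1))// (le_trans (e_le _ _ xt))//.
    exact: le_trans (half k) (e_le1 k).
  + move=> k x xt; rewrite /rhs.
    have -> : N * p x - G x (y x) - (N * (z k).2 x - G x ((z k).1 x))
      = N * (p x - (z k).2 x) - (G x (y x) - G x ((z k).1 x)) by ring.
    have H1 := le_trans (pP x k) (e_le k x xt).
    have H2 := le_trans (yP x k) (e_le k x xt).
    rewrite (le_trans (ler_normB _ _))// normrM eP.
    have H3 : `|N| * `|p x - (z k).2 x| <= `|N| * (2 * C / 2 ^+ k * K) by rewrite ler_wpM2l.
    have H4 := le_trans (LG x (y x) ((z k).1 x)) (ler_wpM2l L0 H2).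
    rewrite (le_trans (lerD H3 H4))// -mulrDl mulrC ler_wpM2l//.
    by rewrite -addrA lerDr.
Qed.

End picard.

(** The weight [exp (- 2 t)] is the factor r^2 that appears when the radial equation is written in t
    = - ln r. At [t = 0] this is the original nonlinearity exp(e^v), and it is used in that form for
    the equation on the ball. *)
Definition nonlin {R : realType} (t v : R) : R := expR (expR v - 2 * t).

Definition ode_at {R : realType} (N : R) (y p : R -> R) (t : R) : Prop :=
  is_derive t 1 y (p t) /\ is_derive t 1 p (N * p t - nonlin t (y t)).

(** * The equation in logarithmic time: signs, backward solvability, stability *)

Section emden_fowler.
Context {R : realType}.
Implicit Types (t s u v k M N : R) (y p : R -> R).

Lemma nonlin_gt0 t v : 0 < nonlin t v.
Proof. exact: expR_gt0. Qed.

Lemma nonlin_derive t v : is_derive v 1 (nonlin t) (expR v * nonlin t v).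
Proof. by rewrite /nonlin; der_eq; ring. Qed.

Lemma nonlin_mvt t u v : exists2 w, Num.min u v <= w <= Num.max u v &
  nonlin t u - nonlin t v = expR w * nonlin t w * (u - v).
Proof.
have [uv|/ltW vu] := leP u v.
- have [|w w12 E] := @mvt R (nonlin t) (fun w => expR w * nonlin t w) u v uv.
    by move=> x _; exact: nonlin_derive.
  by exists w => //; rewrite -opprB E -mulrN opprB.
- have [|w w12 E] := @mvt R (nonlin t) (fun w => expR w * nonlin t w) v u vu.
    by move=> x _; exact: nonlin_derive.
  by exists w.
Qed.

Lemma nonlin_le t0 t u M : t0 <= t -> u <= M -> nonlin t u <= nonlin t0 M.
Proof.
by move=> tt uM; rewrite ler_expR lerB// ?ler_expR// ler_pM2l.
Qed.

Lemma nonlin_lipschitz t0 t M u v : t0 <= t -> u <= M -> v <= M ->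
  `|nonlin t u - nonlin t v| <= expR M * nonlin t0 M * `|u - v|.
Proof.
move=> tt uM vM; have [w /andP[_ wM] ->] := nonlin_mvt t u v.
have wM' : w <= M by rewrite (le_trans wM)// ge_max uM.
rewrite normrM ler_wpM2r// ger0_norm ?mulr_ge0 ?expR_ge0//.
by apply: ler_pM; [exact: expR_ge0|exact: expR_ge0|rewrite ler_expR|exact: nonlin_le].
Qed.

(** With the integrating factor [exp (- N t)] the derivative of the slope has a sign. Positivity of
    [p] therefore passes to the left, and a lower bound on the nonlinearity becomes one on [p]. *)
Lemma damped_derivative N y p t : ode_at N y p t ->
  is_derive t 1 (fun s => expR (- N * s) * p s)
    (- (expR (- N * t) * nonlin t (y t))).
Proof. by case=> _ ?; der_eq; ring. Qed.

Lemma ode_p_gt0 N y p a b : a <= b -> (forall t, a <= t <= b -> ode_at N y p t) ->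
  0 < p b -> 0 < p a.
Proof.
move=> ab H pb.
have /(_ (fun s => - (expR (- N * s) * p s)) (fun s => expR (- N * s) * nonlin s (y s))) :=
  @is_der_ge0_le R _ _ a b ab.
have H1 t : a <= t <= b -> is_derive t 1 (fun s => - (expR (- N * s) * p s))
     (expR (- N * t) * nonlin t (y t)).
  by move=> /H /damped_derivative ?; der_eq; rewrite opprK.
move=> /(_ H1) H2; rewrite -(pmulr_rgt0 _ (expR_gt0 (- N * a))).
have pb' : 0 < expR (- N * b) * p b by rewrite mulr_gt0 ?expR_gt0.
rewrite (lt_le_trans pb')// -lerN2; apply: H2 => t _.
by rewrite mulr_ge0 ?expR_ge0.
Qed.

(* The truncated nonlinearity is never felt: [p > 0] keeps [y] below its final value. *)
Lemma terminal_value_problem N t0 k a b : t0 <= k -> 0 < b ->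
  exists y p, [/\ y k = a, p k = b & forall t, t0 <= t <= k -> ode_at N y p t].
Proof.
move=> t0k b0.
(* Freezing time to the left of [t0] and values above [a] makes the nonlinearity globally Lipschitz
   in [v]. *)
pose G t v := nonlin (Num.max t t0) (Num.min v a).
have tm t : t0 <= Num.max t t0 by rewrite le_max lexx orbT.
have ma v : Num.min v a <= a by rewrite ge_min lexx orbT.
have [||||y [p [yk pk H]]] := @picard R G N (expR a * nonlin t0 a) (nonlin t0 a) k a b.
- by rewrite mulr_ge0 ?expR_ge0.
- move=> Y cY t; rewrite /G /nonlin.
  apply: (@continuous_comp _ _ _ (fun t => expR (Num.min (Y t) a) - 2 * Num.max t t0) expR);
    last exact: continuous_expR.
  apply: cvgB.
    apply: (@continuous_comp _ _ _ (fun t => Num.min (Y t) a) expR); last exact: continuous_expR.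
    by apply: continuous_min; [exact: cY|exact: cst_continuous].
  apply: cvgM; first exact: cvg_cst.
  by apply: continuous_max; [exact: cvg_id|exact: cst_continuous].
- move=> t u v; rewrite (le_trans (nonlin_lipschitz _ _ _ _ _ (tm t) (ma u) (ma v)))//.
  rewrite ler_wpM2l ?mulr_ge0 ?expR_ge0//.
  rewrite /Num.min; case: ltP => ua; case: ltP => va //; rewrite ?subrr ?normr0//.
  + rewrite !ler0_norm ?subr_le0 ?(ltW ua) ?(le_trans (ltW ua))//; lra.
  + by rewrite distrC [leRHS]distrC !ler0_norm ?subr_le0 ?(ltW va) ?(le_trans (ltW va))//; lra.
- by move=> t; rewrite ger0_norm ?expR_ge0// nonlin_le.
have pgt0 t : t <= k -> 0 < p t.
  move=> tk; rewrite -(pmulr_rgt0 _ (expR_gt0 (- N * t))).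
  have : - (expR (- N * t) * p t) <= - (expR (- N * k) * p k).
    apply: (is_der_ge0_le (fun s => - (expR (- N * s) * p s))
      (fun s => expR (- N * s) * G s (y s)) _ _ tk).
      by move=> s _; have [_ ?] := H s; der_eq; ring.
    by move=> s _; rewrite mulr_ge0 ?expR_ge0.
  by rewrite lerN2; apply: lt_le_trans; rewrite pk mulr_gt0 ?expR_gt0.
have yle t : t <= k -> y t <= a.
  move=> tk; rewrite -yk; apply: (is_der_ge0_le y p _ _ tk).
    by move=> x _; have [] := H x.
  by move=> x /andP[_ xk]; rewrite ltW// pgt0.
exists y, p; split => // t /andP[t0t tk]; have [H1 H2] := H t; split => //.
by move: H2; rewrite /G (max_idPl t0t) (min_idPl (yle _ tk)).
Qed.

(** Backward in time the term [N p] only helps: it adds 2 N (p1 - p2)^2 to the derivative of the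
    squared distance. So [N] does not enter the exponent, only the Lipschitz constant of the
    nonlinearity does. *)
Lemma gronwall N y1 p1 y2 p2 a b M : 0 <= N -> a <= b ->
  (forall t, a <= t <= b -> ode_at N y1 p1 t) ->
  (forall t, a <= t <= b -> ode_at N y2 p2 t) ->
  (forall t, a <= t <= b -> y1 t <= M) -> (forall t, a <= t <= b -> y2 t <= M) ->
  (y1 a - y2 a) ^+ 2 + (p1 a - p2 a) ^+ 2 <=
  ((y1 b - y2 b) ^+ 2 + (p1 b - p2 b) ^+ 2) *
    expR ((1 + expR M * nonlin a M) * (b - a)).
Proof.
move=> N0 ab H1 H2 M1 M2; set L := expR M * nonlin a M.
have L0 : 0 <= L by rewrite mulr_ge0 ?expR_ge0.
pose E t := (y1 t - y2 t) ^+ 2 + (p1 t - p2 t) ^+ 2.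
pose F t := E t * expR ((1 + L) * t).
pose D t := nonlin t (y1 t) - nonlin t (y2 t).
pose dE t := 2 * (y1 t - y2 t) * (p1 t - p2 t) +
  2 * (p1 t - p2 t) * (N * (p1 t - p2 t) - D t).
have : F a <= F b.
  apply: (is_der_ge0_le F (fun t => (dE t + (1 + L) * E t) * expR ((1 + L) * t)) _ _ ab).
    move=> t tab; have [? ?] := H1 t tab; have [? ?] := H2 t tab.
    by rewrite /F /E /dE /D; der_eq; ring.
  move=> t tab; rewrite mulr_ge0 ?expR_ge0//.
  have : `|D t| <= L * `|y1 t - y2 t|.
    by case/andP: (tab) => ta _; apply: nonlin_lipschitz => //; [exact: M1|exact: M2].
  rewrite /dE /E; move: (D t) (y1 t - y2 t) (p1 t - p2 t) => d z q dz.
  have H3 : - (L * (z ^+ 2 + q ^+ 2)) <= - (2 * (q * d)).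
    rewrite lerN2 (le_trans (ler_norm _))// !normrM normr_nat.
    have := ler_wpM2l (normr_ge0 q) dz.
    have : 0 <= L * (`|z| - `|q|) ^+ 2 by rewrite mulr_ge0// sqr_ge0.
    rewrite -(real_normK (num_real z)) -(real_normK (num_real q)); lra.
  have H4 : 0 <= N * q ^+ 2 by rewrite mulr_ge0// sqr_ge0.
  have := sqr_ge0 (z + q); lra.
rewrite /F -/(E a) -/(E b) => H; rewrite mulrBr expRB mulrA ler_pdivlMr ?expR_gt0//.
Qed.

End emden_fowler.

(** * The explicit profile, its residual and the linearisation around it *)

Section asymptotic_profile.
Context {R : realType}.
Variable N : R.
Hypothesis N1 : 1 <= N.
Implicit Types (t s u v k : R).

(** Balancing N y' = exp(e^y - 2 t) gives e^y = 2 t + ln (N y'). The guess y' = 1/t yields 2 t + ln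
    (N / t); its logarithm has derivative 1/t + ln t / (2 t^2) up to O(t^-2), and inserting this
    once more yields the formula. *)
Definition inner t := 2 * t + ln (N / t) + ln (1 + ln t / (2 * t)).
Definition dinner t : R := 2 - t^-1 + (1 - ln t) / (t * (2 * t + ln t)).
Definition ddinner t : R := (t^-1) ^+ 2 +
  (- (2 * t + ln t) - (1 - ln t) * (4 * t + ln t + 1)) / (t * (2 * t + ln t)) ^+ 2.
Definition profile t := ln (inner t).
Definition dprofile t := dinner t / inner t.
Definition ddprofile t := ddinner t / inner t - dprofile t ^+ 2.

Definition c0 : R := `|ln N| + 1.
(** The 16 gives [ln t <= t / 2] through [ln_sqr_le]; the [4 * c0] gives [|corr t| <= t / 4].
    Together they put [inner t] between [t] and [3 * t]. *)
Definition T0 : R := 16 + 4 * c0.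

Lemma ln_le_id t : 0 < t -> ln t <= t.
Proof.
move=> t0; have := @le_ln1Dx R (t - 1); rewrite [1 + _]addrC subrK.
by move=> H; have := H ltac:(lra); lra.
Qed.

(** From ln t = 2 ln (sqrt t) and ln s <= s. It turns (ln t)^2 / t^2 into an O(1/t) term. *)
Lemma ln_sqr_le t : 1 <= t -> ln t ^+ 2 <= 4 * t.
Proof.
move=> t1; have t0 : 0 < t by lra.
have s0 : 0 < Num.sqrt t by rewrite sqrtr_gt0.
have E : t = Num.sqrt t ^+ 2 by rewrite sqr_sqrtr// ltW.
have l0 : 0 <= ln t by exact: ln_ge0.
have ls : ln t <= 2 * Num.sqrt t.
  have := ln_le_id _ s0; have : ln t = ln (Num.sqrt t) *+ 2 by rewrite [in LHS]E lnXn.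
  by rewrite mulr2n; lra.
by have := ler_pM l0 l0 ls ls; lra.
Qed.

Lemma N_gt0 : 0 < N. Proof. exact: lt_le_trans N1. Qed.
Lemma c01 : 1 <= c0. Proof. by rewrite lerDr. Qed.

Lemma basic_bounds t : T0 <= t ->
  [/\ 20 <= t, 0 <= ln t, ln t ^+ 2 <= 4 * t & ln t <= t / 2].
Proof.
rewrite /T0 => Tt; have := c01 => c1; have t20 : 20 <= t by lra.
have l0 : 0 <= ln t by apply: ln_ge0; lra.
have l2 : ln t ^+ 2 <= 4 * t by apply: ln_sqr_le; lra.
split => //; rewrite -ler_sqr ?nnegrE//; last by lra.
rewrite (le_trans l2)//.
have : 0 <= t * (t - 16) by apply: mulr_ge0; lra.
lra.
Qed.

Definition corr t : R := ln N + ln (1 + ln t / (2 * t)).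

Lemma corr_bound t : T0 <= t -> `|corr t| <= c0.
Proof.
move=> /basic_bounds[t20 l0 _ lt]; rewrite (le_trans (ler_normD _ _))// lerD2l.
have x0 : 0 <= ln t / (2 * t) by rewrite divr_ge0//; lra.
have x1 : ln t / (2 * t) <= 1 by rewrite ler_pdivrMr; lra.
rewrite ger0_norm; last by rewrite ln_ge0// lerDl.
by rewrite (le_trans (le_ln1Dx _))//; lra.
Qed.

Lemma innerE t : 0 < t -> inner t = 2 * t - ln t + corr t.
Proof.
by move=> t0; rewrite /inner /corr lnM ?posrE ?N_gt0 ?invr_gt0// lnV ?posrE//; ring.
Qed.

Lemma inner_bounds t : T0 <= t -> t <= inner t <= 3 * t.
Proof.
move=> Tt; have [t20 l0 _ lt] := basic_bounds _ Tt.
have := corr_bound _ Tt; rewrite innerE; last by lra.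
move: Tt; rewrite /T0 ler_norml => Tt /andP[c1 c2]; apply/andP; split; lra.
Qed.

Lemma inner_gt0 t : T0 <= t -> 0 < inner t.
Proof.
move=> Tt; have [t20 _ _ _] := basic_bounds _ Tt.
have /andP[] := inner_bounds _ Tt; lra.
Qed.

(** This is 1/t + ln t / (2 t^2), the prescribed gradient expansion multiplied by |x|. *)
Definition slope t : R := (2 * t + ln t) / (2 * t ^+ 2).

Lemma exp_inner t : T0 <= t -> expR (inner t - 2 * t) = N * slope t.
Proof.
move=> Tt; have [t20 l0 _ lt] := basic_bounds _ Tt; have t0 : 0 < t by lra.
have x0 : 0 <= ln t / (2 * t) by rewrite divr_ge0//; lra.
have -> : inner t - 2 * t = ln (N / t) + ln (1 + ln t / (2 * t)) by rewrite /inner; ring.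
rewrite expRD !lnK ?posrE ?divr_gt0 ?N_gt0//; last by lra.
rewrite /slope; field; lra.
Qed.

Lemma inner_derive t : T0 <= t -> is_derive t 1 inner (dinner t).
Proof.
move=> Tt; have [t20 l0 _ lt] := basic_bounds _ Tt; have t0 : 0 < t by lra.
have x0 : 0 <= ln t / (2 * t) by rewrite divr_ge0//; lra.
have h1 : 0 < 1 + ln t / (2 * t) by lra.
have h2 : 0 < N / t by rewrite divr_gt0// N_gt0.
have h3 : 2 * t != 0 by rewrite gt_eqF//; lra.
have h4 : t != 0 by rewrite gt_eqF.
rewrite /inner; der_eq; rewrite /dinner.
have N0 := N_gt0.
have h5 : 0 < ln t + t * 2 by lra.
by field; rewrite !gt_eqF//; lra.
Qed.

Lemma dinner_derive t : T0 <= t -> is_derive t 1 dinner (ddinner t).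
Proof.
move=> Tt; have [t20 l0 _ lt] := basic_bounds _ Tt; have t0 : 0 < t by lra.
have h4 : t != 0 by rewrite gt_eqF.
have h5 : 0 < 2 * t + ln t by lra.
have h6 : t * (2 * t + ln t) != 0 by rewrite mulf_neq0// gt_eqF.
rewrite /dinner; der_eq; rewrite /ddinner.
by field; rewrite !gt_eqF//; lra.
Qed.

Lemma profile_derive t : T0 <= t -> is_derive t 1 profile (dprofile t).
Proof.
move=> Tt; have h := inner_gt0 _ Tt; have h' := inner_derive _ Tt.
by rewrite /profile /dprofile; der_eq; ring.
Qed.

Lemma dprofile_derive t : T0 <= t -> is_derive t 1 dprofile (ddprofile t).
Proof.
move=> Tt; have h := inner_gt0 _ Tt; have h' := inner_derive _ Tt.
have h'' := dinner_derive _ Tt; have h3 : inner t != 0 by rewrite gt_eqF.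
by rewrite /dprofile /ddprofile; der_eq; rewrite /dprofile; field.
Qed.

Lemma dinner_bounds t : T0 <= t -> 1 <= dinner t <= 3.
Proof.
move=> Tt; have [t20 l0 _ lt] := basic_bounds _ Tt; have t0 : 0 < t by lra.
have h5 : 0 < t * (2 * t + ln t) by rewrite mulr_gt0//; lra.
have h6 : `|(1 - ln t) / (t * (2 * t + ln t))| <= t^-1.
  rewrite normrM normfV (gtr0_norm h5) invfM mulrA mulrAC.
  have h : 0 < 2 * t + ln t by lra.
  rewrite -[leRHS]mul1r ler_pM2r ?invr_gt0// ler_pdivrMr// mul1r.
  by rewrite ler_norml; apply/andP; split; lra.
have h7 : t^-1 <= 20^-1 by rewrite lef_pV2 ?posrE.
have h8 : 0 < t^-1 by rewrite invr_gt0.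
by move: h6; rewrite /dinner ler_norml => /andP[? ?]; apply/andP; split; lra.
Qed.

Lemma dprofile_gt0 t : T0 <= t -> 0 < dprofile t.
Proof.
move=> Tt; have /andP[d1 _] := dinner_bounds _ Tt.
by rewrite divr_gt0 ?inner_gt0//; lra.
Qed.

(** The leading parts 2 t - ln t of [inner] and 2 t + ln t of [slope] multiply to a difference of
    squares. Cancelling the ln t / t terms is what the last logarithm in [inner] is there for. *)
Lemma slope_innerE t : T0 <= t -> inner t * slope t =
  2 - ln t ^+ 2 / (2 * t ^+ 2) + corr t * slope t.
Proof.
move=> Tt; have [t20 l0 _ lt] := basic_bounds _ Tt; have t0 : 0 < t by lra.
by rewrite innerE// /slope; field; lra.
Qed.

Lemma slope_bound t : T0 <= t -> 0 <= slope t <= 2 / t.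
Proof.
move=> Tt; have [t20 l0 _ lt] := basic_bounds _ Tt; have t0 : 0 < t by lra.
have tt : 0 < 2 * t ^+ 2 by rewrite mulr_gt0// exprn_gt0.
rewrite /slope; apply/andP; split; first by rewrite divr_ge0 ?(ltW tt)//; lra.
rewrite ler_pdivrMr//.
have -> : 2 / t * (2 * t ^+ 2) = 4 * t by field; lra.
by lra.
Qed.

Lemma ln_sqr_bound t : T0 <= t -> 0 <= ln t ^+ 2 / (2 * t ^+ 2) <= 2 / t.
Proof.
move=> Tt; have [t20 l0 l2 lt] := basic_bounds _ Tt; have t0 : 0 < t by lra.
have tt : 0 < 2 * t ^+ 2 by rewrite mulr_gt0// exprn_gt0.
apply/andP; split; first by rewrite divr_ge0 ?(ltW tt)// exprn_ge0.
rewrite ler_pdivrMr//.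
have -> : 2 / t * (2 * t ^+ 2) = 4 * t by field; lra.
by [].
Qed.

Lemma inner_slope t : T0 <= t -> `|inner t * slope t - 2| <= (2 + 2 * c0) / t.
Proof.
move=> Tt; rewrite slope_innerE//.
have /andP[l0 l1] := ln_sqr_bound _ Tt; have /andP[s0 s1] := slope_bound _ Tt.
have cb : `|corr t * slope t| <= c0 * (2 / t).
  by rewrite normrM ler_pM// ?corr_bound// ger0_norm.
have -> : (2 + 2 * c0) / t = 2 / t + c0 * (2 / t) by ring.
move: cb; rewrite !ler_norml => /andP[? ?]; apply/andP; split; lra.
Qed.

(** Both [dinner t] and [inner t * slope t] are 2 + O(1/t), and dividing by [inner t >= t] gains
    another power. This is the link between the profile and the prescribed gradient asymptotics. *)
Lemma dprofile_slope t : T0 <= t ->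
  `|dprofile t - slope t| <= (5 + 2 * c0) / t ^+ 2.
Proof.
move=> Tt; have [t20 l0 l2 lt] := basic_bounds _ Tt; have t0 : 0 < t by lra.
have i0 := inner_gt0 _ Tt; have /andP[i1 _] := inner_bounds _ Tt.
have -> : dprofile t - slope t = (dinner t - inner t * slope t) / inner t.
  by rewrite /dprofile; field; rewrite gt_eqF.
have h5 : 0 < t * (2 * t + ln t) by rewrite mulr_gt0//; lra.
have h6 : `|(1 - ln t) / (t * (2 * t + ln t))| <= t^-1.
  rewrite normrM normfV (gtr0_norm h5) invfM mulrA mulrAC.
  have h : 0 < 2 * t + ln t by lra.
  rewrite -[leRHS]mul1r ler_pM2r ?invr_gt0// ler_pdivrMr// mul1r.
  by rewrite ler_norml; apply/andP; split; lra.
have h7 : `|dinner t - inner t * slope t| <= (5 + 2 * c0) / t.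
  have -> : (5 + 2 * c0) / t = t^-1 + t^-1 + (2 + 2 * c0) / t + t^-1 by ring.
  have t' : 0 < t^-1 by rewrite invr_gt0.
  have := inner_slope _ Tt; move: h6; rewrite /dinner !ler_norml.
  by move=> /andP[? ?] /andP[? ?]; apply/andP; split; lra.
rewrite normrM normfV (gtr0_norm i0) ler_pdivrMr//.
rewrite (le_trans h7)// expr2 invfM mulrA -[leRHS]mulrA ler_peMr//.
  by rewrite divr_ge0 ?(ltW t0)//; have := c01; lra.
by rewrite mulrC ler_pdivlMr// mul1r.
Qed.

Lemma ddprofile_bound t : T0 <= t -> `|ddprofile t| <= 20 / t ^+ 2.
Proof.
move=> Tt; have [t20 l0 l2 lt] := basic_bounds _ Tt; have t0 : 0 < t by lra.
have i0 := inner_gt0 _ Tt; have /andP[i1 _] := inner_bounds _ Tt.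
have /andP[d1 d2] := dinner_bounds _ Tt.
have t' : 0 < t^-1 by rewrite invr_gt0.
have t2 : 0 < t ^+ 2 by rewrite exprn_gt0.
have iV : (inner t)^-1 <= t^-1 by rewrite lef_pV2 ?posrE.
have h1 : `|dprofile t ^+ 2| <= 9 / t ^+ 2.
  rewrite ger0_norm ?sqr_ge0// -exprVn -[9]/((3 * 3)%:R) natrM -expr2 -exprMn.
  have p0 := dprofile_gt0 _ Tt.
  have q0 : 0 <= 3 / t by rewrite divr_ge0// ltW.
  rewrite ler_sqr ?nnegrE ?(ltW p0)// /dprofile.
  by apply: ler_pM => //; [lra|rewrite invr_ge0 ltW].
have h2 : `|ddinner t| <= 11 * t^-1.
  rewrite /ddinner (le_trans (ler_normD _ _))//.
  have h : `|(t^-1) ^+ 2| <= t^-1.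
    rewrite ger0_norm ?sqr_ge0// expr2 ler_piMl ?(ltW t')// invf_le1//; lra.
  have -> : 11 * t^-1 = t^-1 + 10 * t^-1 by ring.
  apply: lerD => //.
  have h5 : 0 < (t * (2 * t + ln t)) ^+ 2 by rewrite exprn_gt0// mulr_gt0//; lra.
  rewrite normrM normfV (gtr0_norm h5) ler_pdivrMr//.
  apply: (@le_trans _ _ (10 * t^-1 * (t ^+ 3))); last first.
    rewrite ler_wpM2l ?mulr_ge0 ?(ltW t')//.
    rewrite exprMn exprSr ler_wpM2l ?(ltW t2)//.
    have : 0 <= (2 * t + ln t) ^+ 2 - t ^+ 2.
      by rewrite subr_sqr mulr_ge0//; lra.
    have : 0 <= t * (t - 1) by rewrite mulr_ge0//; lra.
    by lra.
  have -> : 10 * t^-1 * t ^+ 3 = 10 * t ^+ 2 by field; lra.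
  have b1 : 0 <= t * (t - 20) by rewrite mulr_ge0//; lra.
  have b2 : 0 <= ln t * (4 * t + ln t + 1) by rewrite mulr_ge0//; lra.
  have b3 : ln t * (4 * t + ln t + 1) <= t / 2 * (4 * t + t / 2 + 1).
    by rewrite ler_pM//; lra.
  by rewrite ler_norml; apply/andP; split; lra.
have h3 : `|ddinner t / inner t| <= 11 / t ^+ 2.
  rewrite normrM normfV (gtr0_norm i0) expr2 invfM mulrA.
  by apply: ler_pM => //; rewrite invr_ge0 ltW.
have -> : 20 / t ^+ 2 = 11 / t ^+ 2 + 9 / t ^+ 2 by field; lra.
by rewrite /ddprofile (le_trans (ler_normB _ _))// lerD.
Qed.

Definition defect t := ddprofile t - N * dprofile t + nonlin t (profile t).

Lemma expR_profile t : T0 <= t -> expR (profile t) = inner t.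
Proof. by move=> Tt; rewrite /profile lnK// posrE inner_gt0. Qed.

Lemma nonlin_profile t : T0 <= t -> nonlin t (profile t) = N * slope t.
Proof. by move=> Tt; rewrite /nonlin expR_profile// exp_inner. Qed.

(** The nonlinearity at the profile is exactly [N * slope t], so the residual is
    [ddprofile t - N * (dprofile t - slope t)], a sum of two O(t^-2) terms. *)
Lemma defect_bound t : T0 <= t ->
  `|defect t| <= (20 + N * (5 + 2 * c0)) / t ^+ 2.
Proof.
move=> Tt; rewrite /defect nonlin_profile//.
have -> : ddprofile t - N * dprofile t + N * slope t =
  ddprofile t - N * (dprofile t - slope t) by ring.
rewrite mulrDl (le_trans (ler_normB _ _))// lerD ?ddprofile_bound// normrM.
rewrite (gtr0_norm N_gt0) -mulrA ler_wpM2l ?(ltW N_gt0)//.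
exact: dprofile_slope.
Qed.

Lemma expR_dist1 s : `|s| <= 1 / 2 -> `|expR s - 1| <= 2 * `|s|.
Proof.
rewrite ler_norml => /andP[s1 s2].
have h1 := @expR_ge1Dx R s; have h2 := @expR_ge1Dx R (- s).
have e0 := expR_gt0 s.
have h3 : expR s * (1 - s) <= 1.
  by rewrite -ler_pdivlMl// mulr1 -expRN.
have [s0|s0] := leP 0 s.
- have h4 : 0 <= s * (1 - 2 * s) by rewrite mulr_ge0//; lra.
  have h5 : expR s <= 1 + 2 * s.
    rewrite -(@ler_pM2r _ (1 - s)); last by lra.
    by rewrite (le_trans h3)//; lra.
  by rewrite !ger0_norm//; lra.
- have h6 : expR s <= 1 by rewrite -expR0 ler_expR ltW.
  by rewrite (ltr0_norm s0) ler0_norm; lra.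
Qed.

(* Along the profile the linearised coefficient tends to [2 N]. *)
Lemma linearised_coefficient (B : R) : 0 <= B ->
  exists2 T, T0 <= T & forall t v, T <= t -> `|v - profile t| <= B / t ^+ 2 ->
    `|expR v * nonlin t v - 2 * N| <= 1 / 2.
Proof.
move=> B0; pose C := N * (2 + 2 * c0).
have C0 : 0 <= C by rewrite mulr_ge0 ?(ltW N_gt0)//; have := c01; lra.
pose D := 2 * C + 28 * N * B.
have NB : 0 <= N * B by rewrite mulr_ge0// ltW// N_gt0.
have D0 : 0 <= D by rewrite /D; lra.
(* [14 * B] forces [|s| <= 1 / 2] for the exponent [s] below; [2 * D] forces the total error [D / t]
   below 1/2. *)
exists (T0 + 14 * B + 2 * D); first by rewrite -addrA lerDl addr_ge0// mulr_ge0.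
move=> t v Tt vB.
have Tt0 : T0 <= t by lra.
have [t20 l0 l2 lt] := basic_bounds _ Tt0; have t0 : 0 < t by lra.
have t' : 0 < t^-1 by rewrite invr_gt0.
have t'1 : t^-1 <= 1 by rewrite invf_le1//; lra.
have i0 := inner_gt0 _ Tt0; have /andP[i1 i3] := inner_bounds _ Tt0.
set xi := v - profile t.
have Bt : 14 * (B / t) <= 1 by rewrite mulrA ler_pdivrMr//; move: Tt; have := c01; rewrite /T0; lra.
have xi1 : `|xi| <= B / t.
  by rewrite (le_trans vB)// ler_wpM2l// expr2 invfM ler_piMl// ltW.
have xi2 : `|xi| <= 1 / 2 by have : 0 <= B / t by [rewrite divr_ge0// ltW]; lra.
have e1 := expR_dist1 _ xi2.
have e2 : `|inner t * (expR xi - 1)| <= 6 * (B / t).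
  rewrite normrM (gtr0_norm i0).
  apply: (@le_trans _ _ (3 * t * (2 * (B / t ^+ 2)))).
    by apply: ler_pM => //; [exact: ltW|rewrite (le_trans e1)// ler_pM2l].
  by rewrite le_eqVlt; apply/orP; left; apply/eqP; field; lra.
(* Replacing the profile by [profile + xi] multiplies [exp v] by [exp xi] and shifts the outer
   exponent by [inner t * (exp xi - 1)]. The shift is of order t * t^-2, so a tube of width t^-2 is
   narrow enough. *)
pose s := xi + inner t * (expR xi - 1).
have s1 : `|s| <= 7 * (B / t).
  by rewrite (le_trans (ler_normD _ _))//; lra.
have s2 : `|s| <= 1 / 2 by lra.
have e3 := expR_dist1 _ s2.
have -> : expR v * nonlin t v = N * (inner t * slope t) * expR s.
  have ev : expR v = inner t * expR xi.
    by rewrite -(expR_profile _ Tt0) -expRD /xi addrC subrK.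
  rewrite /nonlin ev /s.
  have -> : inner t * expR xi - 2 * t = inner t * (expR xi - 1) + (inner t - 2 * t) by ring.
  move: (inner t * (expR xi - 1)) => e.
  by rewrite (expRD e) (expRD xi) exp_inner//; ring.
have e4 := inner_slope _ Tt0.
have -> : N * (inner t * slope t) * expR s - 2 * N =
  N * (inner t * slope t - 2) * expR s + 2 * N * (expR s - 1) by ring.
have es : expR s <= 2.
  by move: e3 s2; rewrite !ler_norml => /andP[? ?] /andP[? ?]; have := ler_norm s; lra.
have e5 : `|N * (inner t * slope t - 2) * expR s| <= 2 * C / t.
  rewrite normrM (gtr0_norm (expR_gt0 s)) normrM (gtr0_norm N_gt0).
  have -> : 2 * C / t = N * ((2 + 2 * c0) / t) * 2 by rewrite /C; ring.
  apply: ler_pM; rewrite ?expR_ge0// ?mulr_ge0 ?(ltW N_gt0)//.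
  by rewrite ler_wpM2l ?(ltW N_gt0).
have e6 : `|2 * N * (expR s - 1)| <= 28 * N * B / t.
  rewrite normrM gtr0_norm ?mulr_gt0 ?N_gt0//.
  have -> : 28 * N * B / t = 2 * N * (2 * (7 * (B / t))) by ring.
  rewrite ler_wpM2l ?mulr_ge0 ?(ltW N_gt0)// (le_trans e3)// ler_pM2l//.
rewrite (le_trans (ler_normD _ _))// (le_trans (lerD e5 e6))// -mulrDl -/D.
by rewrite ler_pdivrMr//; move: Tt; have := c01; rewrite /T0; lra.
Qed.

End asymptotic_profile.

(** At the last point where [W >= B], continuity gives [W = B], and the positive derivative pushes
    [W] above [B] just to the right, a contradiction. The bound thus travels from [k] to the
    left. *)
Lemma barrier {R : realType} (W dW : R -> R) (a k B : R) :
  (forall t, a <= t <= k -> is_derive t 1 W (dW t)) -> W k < B ->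
  (forall t, a <= t <= k -> W t = B -> 0 < dW t) ->
  forall t, a <= t <= k -> W t < B.
Proof.
move=> WdW Wk HB t /andP[at_ tk]; rewrite ltNge; apply/negP => Wt.
pose S := [set s | t <= s <= k /\ B <= W s].
have St : S t by split => //; rewrite lexx.
have bS s : S s -> s <= k by case=> /andP[].
have hS : has_sup S by split; [exists t|exists k].
pose s := sup S.
have ts : t <= s by apply: sup_upper_bound.
have sk : s <= k by apply: ge_sup; [exists t|].
have sak : a <= s <= k by rewrite sk (le_trans at_).
have Ds := WdW s sak.
have above h : s < h <= k -> W h < B.
  move=> /andP[sh hk]; rewrite ltNge; apply/negP => Wh.
  have : h <= s.
    by apply: sup_upper_bound => //; split => //; rewrite hk andbT (le_trans ts)// ltW.
  by rewrite leNgt sh.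
have cs := (continuous_epsP W s).1 (is_der_continuous _ _ _ Ds).
have WsB : B <= W s.
  apply/ler_addgt0Pr => e e0; have [r r0 rP] := cs e e0.
  have [h Sh hr] : exists2 h, S h & s - r < h by exact: sup_adherent.
  have hs : h <= s by exact: sup_upper_bound.
  have := rP (h - s); rewrite [s + (h - s)]addrC subrK ler0_norm ?subr_le0//.
  rewrite opprB => /(_ ltac:(lra)); rewrite ler_norml => /andP[_ H].
  by case: Sh => _ Wh; lra.
have sk' : s < k.
  by rewrite lt_neqAle sk andbT; apply/eqP => E; rewrite -E ltNge WsB in Wk.
have WsB' : W s <= B.
  apply/ler_addgt0Pr => e e0; have [r r0 rP] := cs e e0.
  pose h := Num.min (r / 2) (k - s).
  have h0 : 0 < h by rewrite lt_min divr_gt0//= subr_gt0.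
  have hr : `|h| < r.
    rewrite gtr0_norm// (@le_lt_trans _ _ (r / 2)) ?ge_min ?lexx//.
    by rewrite ltr_pdivrMr// ltr_pMr// ltr1n.
  have := above (s + h); rewrite ltrDl h0 /= -lerBrDl ge_min lexx orbT => /(_ isT).
  by have := rP h hr; rewrite ler_norml => /andP[? ?] ?; lra.
have E : W s = B by apply/eqP; rewrite eq_le WsB WsB'.
have d0 := HB s sak E.
have [r r0 rP] := (is_der_epsP W s (dW s)).1 Ds (dW s / 2) (divr_gt0 d0 (ltr0n _ 2)).
pose h := Num.min (r / 2) (k - s).
have h0 : 0 < h by rewrite lt_min divr_gt0//= subr_gt0.
have hr : `|h| < r.
  rewrite gtr0_norm// (@le_lt_trans _ _ (r / 2)) ?ge_min ?lexx//.
  by rewrite ltr_pdivrMr// ltr_pMr// ltr1n.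
have := above (s + h); rewrite ltrDl h0 /= -lerBrDl ge_min lexx orbT => /(_ isT).
have := rP h hr; rewrite (gtr0_norm h0) ler_norml => /andP[H _] Wh.
have : 0 < h * dW s by rewrite mulr_gt0.
lra.
Qed.

(** * The Lyapunov function and confinement to a tube around the profile *)

Section lyapunov.
Context {R : realType}.
Variable N : R.
Hypothesis N1 : 1 <= N.
Implicit Types (t s u v k e q r kap : R) (y p : R -> R).

(* For e'' = N e' - kap e with kap near 2 N the decay in backward time is
   governed by this quadratic form; the shift by N e / 2 makes its derivative
   coercive. *)
Definition lyap e q : R := (q - N / 2 * e) ^+ 2 / 2 + (N + N ^+ 2 / 8) * e ^+ 2.

Definition dlyap e q dq : R :=
  (q - N / 2 * e) * (dq - N / 2 * q) + 2 * (N + N ^+ 2 / 8) * e * q.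

Lemma lyap_derive (e q : R -> R) dq t : is_derive t 1 e (q t) ->
  is_derive t 1 q dq ->
  is_derive t 1 (fun s => lyap (e s) (q s)) (dlyap (e t) (q t) dq).
Proof. by move=> ? ?; rewrite /lyap; der_eq; rewrite /dlyap; field. Qed.

Lemma lyap_ge_e e q : e ^+ 2 <= lyap e q.
Proof.
have hN := N1.
have h1 := sqr_ge0 (q - N / 2 * e); have h2 := sqr_ge0 N.
have h3 : 0 <= (N - 1 + N ^+ 2 / 8) * e ^+ 2 by rewrite mulr_ge0 ?sqr_ge0//; lra.
rewrite /lyap; lra.
Qed.

Lemma lyap_ge_q e q : q ^+ 2 <= (4 + N ^+ 2) * lyap e q.
Proof.
have hN := N1.
have h1 := lyap_ge_e e q.
have h2 := sqr_ge0 (q - N * e).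
have h4 := sqr_ge0 (q - N / 2 * e).
have h5 : 0 <= N ^+ 2 * (lyap e q - e ^+ 2) by rewrite mulr_ge0 ?sqr_ge0// subr_ge0.
have h6 : 0 <= (N + N ^+ 2 / 8) * e ^+ 2.
  by rewrite mulr_ge0 ?sqr_ge0//; have := sqr_ge0 N; lra.
have h7 : 0 <= N ^+ 2 * e ^+ 2 by rewrite mulr_ge0 ?sqr_ge0.
have : (q - N / 2 * e) ^+ 2 <= 2 * lyap e q by rewrite /lyap; lra.
lra.
Qed.

Lemma lyap_le e q : lyap e q <= (1 + N) ^+ 2 * (e ^+ 2 + q ^+ 2).
Proof.
have hN := N1.
have h1 := sqr_ge0 (q + N / 2 * e).
have h2 : 0 <= N * e ^+ 2 by rewrite mulr_ge0 ?sqr_ge0//; lra.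
have h3 : 0 <= N ^+ 2 * e ^+ 2 by rewrite mulr_ge0 ?sqr_ge0.
have h4 : 0 <= N * q ^+ 2 by rewrite mulr_ge0 ?sqr_ge0//; lra.
have h5 : 0 <= N ^+ 2 * q ^+ 2 by rewrite mulr_ge0 ?sqr_ge0.
have h6 := sqr_ge0 e; rewrite /lyap; lra.
Qed.

(** The weight [N + N^2 / 8] in [lyap] is chosen so that the mixed term e q survives only with
    coefficient [2 * N - kap]. What remains is N/2 q^2 + N kap/2 e^2, coercive because [N >= 1]. *)
Lemma dlyap_ge e q kap r : `|kap - 2 * N| <= 1 / 2 ->
  (e ^+ 2 + q ^+ 2) / 4 - r * (q - N / 2 * e) <= dlyap e q (N * q - kap * e - r).
Proof.
have hN := N1; rewrite ler_norml => /andP[k1 k2].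
have h1 : 0 <= (N - 1) * q ^+ 2 by rewrite mulr_ge0 ?sqr_ge0//; lra.
have h2 : 0 <= (N * kap / 2 - 3 / 4) * e ^+ 2.
  rewrite mulr_ge0 ?sqr_ge0//.
  have : 0 <= (N - 1) * kap by rewrite mulr_ge0//; lra.
  lra.
have h3 : 0 <= (1 / 2 + (2 * N - kap)) * (e + q) ^+ 2 by rewrite mulr_ge0 ?sqr_ge0//; lra.
have h4 : 0 <= (1 / 2 - (2 * N - kap)) * (e - q) ^+ 2 by rewrite mulr_ge0 ?sqr_ge0//; lra.
have h5 := sqr_ge0 e; have h6 := sqr_ge0 q.
rewrite /dlyap; lra.
Qed.

(** With M = (1 + N)^2 and z = q - N e / 2 one has e^2 + q^2 >= V / M and z^2 <= 2 V. Young's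
    inequality r z <= 4 M r^2 + z^2 / (16 M) leaves V / (8 M) - 4 M C, positive exactly above the
    stated threshold. *)
Lemma dlyap_gt0 e q kap r (C : R) : `|kap - 2 * N| <= 1 / 2 -> r ^+ 2 <= C ->
  32 * (1 + N) ^+ 4 * C < lyap e q -> 0 < dlyap e q (N * q - kap * e - r).
Proof.
have hN := N1; move=> hk rC hV; apply: lt_le_trans (dlyap_ge e q kap r hk).
have := lyap_le e q.
have M0 : 0 < (1 + N) ^+ 2 by rewrite exprn_gt0//; lra.
set V := lyap e q in hV *; set M := (1 + N) ^+ 2 in M0 *.
have ME : (1 + N) ^+ 4 = M * M by rewrite /M -exprD.
rewrite ME in hV => V1; pose z := q - N / 2 * e.
have z2 : z ^+ 2 <= 2 * V.
  have : 0 <= (N + N ^+ 2 / 8) * e ^+ 2.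
    by rewrite mulr_ge0 ?sqr_ge0//; have := sqr_ge0 N; lra.
  by rewrite /V /lyap -/z; lra.
rewrite -/z.
have h1 : 0 <= (8 * M * r - z) ^+ 2 by exact: sqr_ge0.
have h2 : M * M * r ^+ 2 <= M * M * C by rewrite ler_wpM2l// mulr_ge0// ltW.
have M16 : 0 < 16 * M by lra.
rewrite -(pmulr_rgt0 _ M16); clearbody V M z; lra.
Qed.

(** The intermediate point of the mean value theorem lies between [u] and [v], hence in the same
    tube. *)
Lemma near_profile_kappa (B T : R) :
  (forall t v, T <= t -> `|v - profile N t| <= B / t ^+ 2 ->
    `|expR v * nonlin t v - 2 * N| <= 1 / 2) ->
  forall t u v, T <= t -> `|u - profile N t| <= B / t ^+ 2 ->
    `|v - profile N t| <= B / t ^+ 2 ->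
  exists2 kap, `|kap - 2 * N| <= 1 / 2 & nonlin t u - nonlin t v = kap * (u - v).
Proof.
move=> HT t u v Tt; rewrite !ler_norml => /andP[u1 u2] /andP[v1 v2].
have [w /andP[w1 w2] E] := nonlin_mvt t u v.
exists (expR w * nonlin t w) => //; apply: HT => //.
rewrite ler_norml; apply/andP; split.
  by rewrite lerBrDr (le_trans _ w1)// le_min; apply/andP; split; lra.
by rewrite lerBlDr (le_trans w2)// ge_max; apply/andP; split; lra.
Qed.

Lemma sqr_div_le (x B t : R) : 0 < t -> 1 <= B -> x ^+ 2 <= B / t ^+ 4 ->
  `|x| <= B / t ^+ 2.
Proof.
move=> t0 B1 xB; have B0 : 0 <= B by lra.
rewrite -(@ler_pXn2r _ 2) ?nnegrE ?divr_ge0 ?exprn_ge0 ?(ltW t0)//.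
rewrite real_normK ?num_real// (le_trans xB)// exprMn exprVn -exprM.
by rewrite ler_wpM2r ?invr_ge0 ?exprn_ge0 ?(ltW t0)// expr2 ler_peMr.
Qed.

(** [barrier] applied to [t^4 * lyap]. On the critical level the solution is still in the tube where
    the linearisation holds, and the Lyapunov function dominates the square of the defect, which is
    O(t^-4). No constant depends on [k]. *)
Lemma stay_near_profile : exists B T : R, [/\ 1 <= B, T0 N <= T &
  forall k y p, T <= k -> (forall t, T <= t <= k -> ode_at N y p t) ->
    y k = profile N k -> p k = dprofile N k ->
    forall t, T <= t <= k -> `|y t - profile N t| <= B / t ^+ 2 /\
                             `|p t - dprofile N t| <= B / t ^+ 2].
Proof.
pose C := 20 + N * (5 + 2 * c0 N).
(* The threshold of [dlyap_gt0] for the defect [C / t^2], plus 1 to make the inequality strict and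
   [B >= 1]. *)
pose B := 32 * (1 + N) ^+ 4 * C ^+ 2 + 1.
have N0 : 0 < N := N_gt0 N N1.
have B1 : 1 <= B.
  by rewrite lerDr mulr_ge0 ?sqr_ge0// mulr_ge0// exprn_ge0// addr_ge0// ltW.
have B0 : 0 <= B by lra.
have [T TT HT] := linearised_coefficient N N1 B B0.
have B4 : 1 <= 4 + N ^+ 2 by have := sqr_ge0 N; lra.
(* The factor [4 + N^2] is the price of reading the slope error off [lyap]. *)
exists ((4 + N ^+ 2) * B), T; split => //.
  by rewrite (le_trans B1)// ler_peMl.
move=> k y p Tk H yk pk.
have tpos t : T <= t -> 0 < t.
  move=> Tt; have [] := basic_bounds N t (le_trans TT Tt); lra.
pose e t := y t - profile N t; pose q t := p t - dprofile N t.
pose D t := nonlin t (y t) - nonlin t (profile N t).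
pose V t := lyap (e t) (q t).
pose dV t := dlyap (e t) (q t) (N * q t - D t - defect N t).
have DV t : T <= t <= k -> is_derive t 1 V (dV t).
  move=> Ttk; have [? ?] := H t Ttk; case/andP: Ttk => Tt _.
  have Tt0 := le_trans TT Tt.
  have h1 := profile_derive N N1 t Tt0; have h2 := dprofile_derive N N1 t Tt0.
  have De : is_derive t 1 e (q t) by rewrite /e /q; der.
  apply: (lyap_derive e q _ _ De).
  by rewrite /q /D /defect; der_eq; ring.
have key t : T <= t <= k -> t ^+ 4 * V t < B.
  move: t; apply: (barrier (fun t => t ^+ 4 * V t)
    (fun t => 4 * t ^+ 3 * V t + t ^+ 4 * dV t)).
  - by move=> t /DV ?; der_eq; ring.
  - by rewrite /V /e /q yk pk !subrr /lyap mulr0 subr0 expr0n /= mul0r mulr0 addr0 mulr0; lra.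
  move=> t /andP[Tt tk] WB; have t0 := tpos t Tt.
  have t4 : 0 < t ^+ 4 by rewrite exprn_gt0.
  have VE : V t = B / t ^+ 4 by rewrite -WB; field; rewrite gt_eqF.
  have V0 : 0 <= V t by rewrite (le_trans (sqr_ge0 (e t)))// lyap_ge_e.
  rewrite ltr_wpDl// ?mulr_ge0 ?exprn_ge0 ?(ltW t0)// mulr_gt0//.
  have B2 : 0 <= B / t ^+ 2 by rewrite divr_ge0// exprn_ge0// ltW.
  have [kap hk Dk] : exists2 kap, `|kap - 2 * N| <= 1 / 2 & D t = kap * e t.
    apply: (near_profile_kappa B T HT) => //; last by rewrite subrr normr0.
    by apply: sqr_div_le => //; rewrite -VE lyap_ge_e.
  rewrite /dV Dk; apply: (dlyap_gt0 _ _ _ _ (C ^+ 2 / t ^+ 4)) => //.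
    have := defect_bound N N1 t (le_trans TT Tt); rewrite -/C => dC.
    have C0 : 0 <= C / t ^+ 2 by rewrite (le_trans _ dC).
    rewrite -(real_normK (num_real (defect N t))).
    have -> : C ^+ 2 / t ^+ 4 = (C / t ^+ 2) ^+ 2 by field; rewrite gt_eqF.
    by rewrite ler_sqr ?nnegrE.
  rewrite -/(V t) VE mulrA ltr_pM2r ?invr_gt0// /B; lra.
move=> t Ttk; have := key t Ttk; case/andP: Ttk => Tt tk; have t0 := tpos t Tt.
have t4 : 0 < t ^+ 4 by rewrite exprn_gt0.
rewrite mulrC -ltr_pdivlMr// => /ltW VB.
have B5 : 0 <= 4 + N ^+ 2 by lra.
have B6 : 1 <= (4 + N ^+ 2) * B by rewrite (le_trans B1)// ler_peMl.
have VB' : (4 + N ^+ 2) * V t <= (4 + N ^+ 2) * B / t ^+ 4.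
  by rewrite -mulrA ler_wpM2l.
split; apply: sqr_div_le => //; apply: le_trans VB'.
  by rewrite (le_trans (lyap_ge_e (e t) (q t)))// ler_peMl// (le_trans (sqr_ge0 (e t)))// lyap_ge_e.
exact: lyap_ge_q.
Qed.

(** The difference of two exact solutions has no residual, so [dlyap_ge] applies with [r = 0]. *)
Lemma lyap_diff_mono (B T : R) :
  (forall t v, T <= t -> `|v - profile N t| <= B / t ^+ 2 ->
    `|expR v * nonlin t v - 2 * N| <= 1 / 2) ->
  forall y1 p1 y2 p2 a b, T <= a -> a <= b ->
  (forall t, a <= t <= b -> ode_at N y1 p1 t) ->
  (forall t, a <= t <= b -> ode_at N y2 p2 t) ->
  (forall t, a <= t <= b -> `|y1 t - profile N t| <= B / t ^+ 2) ->
  (forall t, a <= t <= b -> `|y2 t - profile N t| <= B / t ^+ 2) ->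
  lyap (y1 a - y2 a) (p1 a - p2 a) <= lyap (y1 b - y2 b) (p1 b - p2 b).
Proof.
move=> HT y1 p1 y2 p2 a b Ta ab H1 H2 P1 P2.
pose e t := y1 t - y2 t; pose q t := p1 t - p2 t.
pose D t := nonlin t (y1 t) - nonlin t (y2 t).
apply: (is_der_ge0_le (fun t => lyap (e t) (q t))
  (fun t => dlyap (e t) (q t) (N * q t - D t)) _ _ ab).
  move=> t tab; have [? ?] := H1 t tab; have [? ?] := H2 t tab.
  have De : is_derive t 1 e (q t) by rewrite /e /q; der.
  apply: (lyap_derive e q _ _ De).
  by rewrite /q /D; der_eq; ring.
move=> t tab; have Tt : T <= t by case/andP: tab => h _; exact: le_trans h.
have [kap hk Dk] := near_profile_kappa B T HT t _ _ Tt (P1 t tab) (P2 t tab).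
have := dlyap_ge (e t) (q t) kap 0 hk; rewrite mul0r !subr0 /D Dk.
by apply: le_trans; rewrite divr_ge0// addr_ge0// sqr_ge0.
Qed.

End lyapunov.

(** * The solution asymptotic to the profile: uniqueness, existence, zero *)

Section singular_ode.
Context {R : realType}.
Implicit Types (N B T a t s u v k e q : R) (y p : R -> R).

Definition near_profile N (B T : R) y p : Prop := forall t, T <= t ->
  `|y t - profile N t| <= B / t ^+ 2 /\ `|p t - dprofile N t| <= B / t ^+ 2.

Lemma near_profileW N (B T B' T' : R) y p : B <= B' -> T <= T' ->
  near_profile N B T y p -> near_profile N B' T' y p.
Proof.
move=> BB TT H t Tt; have [h1 h2] := H t (le_trans TT Tt).
by split; [apply: le_trans h1 _|apply: le_trans h2 _];
  rewrite ler_wpM2r// invr_ge0 sqr_ge0.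
Qed.

Lemma le_small_eq0 (x C : R) : 0 <= x -> (forall k : R, 1 <= k -> x <= C / k) -> x = 0.
Proof.
move=> x0 H; apply/eqP; rewrite eq_le x0 andbT leNgt; apply/negP => xpos.
pose k := Num.max 1 (2 * C / x).
have k1 : 1 <= k by rewrite le_max lexx.
have k0 : 0 < k by lra.
have := H k k1; rewrite ler_pdivlMr// => xk.
have : 2 * C / x <= k by rewrite le_max lexx orbT.
rewrite ler_pdivrMr// => h.
have : 0 < x * k by rewrite mulr_gt0.
lra.
Qed.

Lemma lyap_near N B t (u1 q1 u2 q2 : R) : 1 <= N -> 1 <= t ->
  `|u1 - profile N t| <= B / t ^+ 2 -> `|q1 - dprofile N t| <= B / t ^+ 2 ->
  `|u2 - profile N t| <= B / t ^+ 2 -> `|q2 - dprofile N t| <= B / t ^+ 2 ->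
  lyap N (u1 - u2) (q1 - q2) <= 8 * (1 + N) ^+ 2 * B ^+ 2 / t ^+ 4.
Proof.
move=> N1 t1 h1 h2 h3 h4.
have b (x1 x2 z : R) : `|x1 - z| <= B / t ^+ 2 -> `|x2 - z| <= B / t ^+ 2 ->
    (x1 - x2) ^+ 2 <= (2 * (B / t ^+ 2)) ^+ 2.
  move=> k1 k2; rewrite -(real_normK (num_real (x1 - x2))) ler_sqr ?nnegrE//.
    by move: k1 k2; rewrite !ler_norml => /andP[? ?] /andP[? ?]; apply/andP; split; lra.
  by rewrite mulr_ge0// (le_trans _ k1).
apply: (le_trans (lyap_le N N1 _ _)).
have -> : 8 * (1 + N) ^+ 2 * B ^+ 2 / t ^+ 4 =
    (1 + N) ^+ 2 * ((2 * (B / t ^+ 2)) ^+ 2 + (2 * (B / t ^+ 2)) ^+ 2).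
  by field; rewrite gt_eqF//; lra.
rewrite ler_wpM2l ?sqr_ge0//; apply: lerD; first exact: b h1 h3.
exact: b h2 h4.
Qed.

(** The profile has slope at least [1 / (3 t)], which beats the error [B / t^2] once [t > 3 * B]. *)
Lemma near_profile_p_gt0 N B T y p t : 1 <= N -> near_profile N B T y p ->
  T0 N <= t -> T <= t -> 3 * B < t -> 0 < p t.
Proof.
move=> N1 H T0t Tt Bt; have [_] := H t Tt.
have [t20 _ _ _] := basic_bounds N t T0t.
have i0 := inner_gt0 N N1 t T0t; have /andP[_ i3] := inner_bounds N N1 t T0t.
have /andP[d1 _] := dinner_bounds N t T0t.
have t0 : 0 < t by lra.
have h : 1 / (3 * t) <= dprofile N t.
  rewrite /dprofile; apply: ler_pM => //; first by rewrite invr_ge0; lra.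
  by rewrite lef_pV2 ?posrE//; lra.
have h' : B / t ^+ 2 < 1 / (3 * t).
  rewrite ltr_pdivrMr ?exprn_gt0//.
  by have -> : 1 / (3 * t) * t ^+ 2 = t / 3 by [field; lra]; lra.
rewrite ler_norml => /andP[? ?]; lra.
Qed.

Lemma ode_p_pos N B T y p a : 1 <= N -> (forall t, a < t -> ode_at N y p t) ->
  near_profile N B T y p -> forall t, a < t -> 0 < p t.
Proof.
move=> N1 H nP t at_.
pose b := Num.max (Num.max t (T0 N)) (Num.max T (3 * B + 1)).
have tb : t <= b by rewrite !le_max lexx.
have T0b : T0 N <= b by rewrite !le_max lexx !orbT.
have Tb : T <= b by rewrite !le_max lexx !orbT.
have Bb : 3 * B < b by rewrite (@lt_le_trans _ _ (3 * B + 1)) ?ltrDl// !le_max lexx !orbT.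
apply: (ode_p_gt0 N y p t b tb); last exact: near_profile_p_gt0 nP T0b Tb Bb.
by move=> s /andP[ts _]; apply: H; exact: lt_le_trans ts.
Qed.

Lemma ode_y_mono N B T y p a : 1 <= N -> (forall t, a < t -> ode_at N y p t) ->
  near_profile N B T y p -> forall s t, a < s -> s < t -> y s < y t.
Proof.
move=> N1 H nP s t as_ st; apply: (is_der_gt0_lt y p _ _ st) => z /andP[sz _].
  by have [] := H z (lt_le_trans as_ sz).
exact: ode_p_pos N1 H nP z (lt_le_trans as_ sz).
Qed.

Lemma sqr_sum_eq0 (x z : R) : x ^+ 2 + z ^+ 2 <= 0 -> x = 0 /\ z = 0.
Proof.
move=> h; have hx := sqr_ge0 x; have hz := sqr_ge0 z.
by split; apply/eqP; rewrite -sqrf_eq0 eq_le; apply/andP; split => //; lra.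
Qed.

(** The Lyapunov function forces agreement only far to the right. From there [gronwall] carries it
    down to [a]; the upper bound it requires is the value at the right end, since both solutions
    increase. *)
Lemma ode_unique N B T y1 p1 y2 p2 a : 1 <= N -> 0 <= B ->
  (forall t, a < t -> ode_at N y1 p1 t) -> (forall t, a < t -> ode_at N y2 p2 t) ->
  near_profile N B T y1 p1 -> near_profile N B T y2 p2 ->
  forall t, a < t -> y1 t = y2 t.
Proof.
move=> N1 B0 H1 H2 P1 P2.
have [T1 T1T HT] := linearised_coefficient N N1 B B0.
pose S := Num.max (Num.max T T1) (a + 1).
have TS : T <= S by rewrite !le_max lexx.
have T1S : T1 <= S by rewrite !le_max lexx !orbT.
have aS : a < S by rewrite (@lt_le_trans _ _ (a + 1)) ?ltrDl// !le_max lexx !orbT.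
have S20 : 20 <= S by have [] := basic_bounds N S (le_trans T1T T1S).
have agree s : S <= s -> y1 s = y2 s /\ p1 s = p2 s.
  move=> Ss.
  have V0 : lyap N (y1 s - y2 s) (p1 s - p2 s) = 0.
    apply: (le_small_eq0 _ (8 * (1 + N) ^+ 2 * B ^+ 2)).
      by rewrite (le_trans (sqr_ge0 (y1 s - y2 s)))// lyap_ge_e.
    move=> k k1; pose b := Num.max s k.
    have sb : s <= b by rewrite le_max lexx.
    have kb : k <= b by rewrite le_max lexx orbT.
    have b1 : 1 <= b by exact: le_trans kb.
    have Tb : T <= b by rewrite (le_trans TS)// (le_trans Ss).
    have dom t : s <= t <= b -> a < t /\ T <= t.
      move=> /andP[st _]; split; last by rewrite (le_trans TS)// (le_trans Ss).
      by rewrite (lt_le_trans aS)// (le_trans Ss).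
    have Ts : T1 <= s by exact: le_trans Ss.
    have := lyap_diff_mono N N1 B T1 HT y1 p1 y2 p2 s b Ts sb.
    move=> /(_ (fun t h => H1 t (dom t h).1) (fun t h => H2 t (dom t h).1)
      (fun t h => (P1 t (dom t h).2).1) (fun t h => (P2 t (dom t h).2).1)).
    move=> /le_trans; apply.
    have [? ?] := P1 b Tb; have [? ?] := P2 b Tb.
    apply: le_trans (lyap_near N B b _ _ _ _ N1 b1 _ _ _ _) _ => //.
    have c8 : 0 <= 8 * (1 + N) ^+ 2 * B ^+ 2 by rewrite mulr_ge0 ?sqr_ge0// mulr_ge0 ?sqr_ge0.
    have b0 : 0 < b by lra.
    have k0 : 0 < k by lra.
    rewrite ler_wpM2l// lef_pV2 ?posrE ?exprn_gt0//.
    by rewrite (le_trans kb)// exprS ler_peMr ?exprn_ege1// ltW.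
  have h1 := lyap_ge_e N N1 (y1 s - y2 s) (p1 s - p2 s).
  have h2 := lyap_ge_q N N1 (y1 s - y2 s) (p1 s - p2 s).
  rewrite V0 mulr0 in h1 h2.
  have [e1 e2] := sqr_sum_eq0 (y1 s - y2 s) (p1 s - p2 s) ltac:(lra).
  by split; apply/eqP; rewrite -subr_eq0 ?e1 ?e2.
move=> t at_; have [St|/ltW tS] := leP S t; first by have [] := agree t St.
pose M := Num.max (y1 S) (y2 S).
have [yS pS] := agree S (lexx S).
have bd y p : (forall t, a < t -> ode_at N y p t) -> near_profile N B T y p ->
    forall s, t <= s <= S -> y s <= y S.
  move=> H P s /andP[ts]; rewrite le_eqVlt => /predU1P[->//|sS].
  by apply/ltW; apply: (ode_y_mono N B T y p a N1 H P) => //; exact: lt_le_trans ts.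
have dom s : t <= s <= S -> a < s by case/andP=> ts _; exact: lt_le_trans ts.
have N0 : 0 <= N by lra.
have := gronwall N y1 p1 y2 p2 t S (y1 S) N0 tS (fun s h => H1 s (dom s h))
  (fun s h => H2 s (dom s h)) (bd y1 p1 H1 P1).
have -> : y1 S = y2 S by [].
move=> /(_ (bd y2 p2 H2 P2)); rewrite pS !subrr expr0n /= addr0 mul0r.
by move=> /sqr_sum_eq0[/eqP]; rewrite subr_eq0 => /eqP.
Qed.

(** Since e^y >= 0, the nonlinearity is at least [exp (- 2 t)] whatever [y] is. Integrating this
    against the damping factor bounds the slope below by a constant left of [T - 1], so [y] falls at
    least linearly. *)
Lemma descent N y p a T : 1 <= N -> a <= T - 1 ->
  (forall t, a <= t <= T -> ode_at N y p t) -> 0 < p T ->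
  y a <= y (T - 1) - expR (- 2 * (T - 1)) / (2 * (N + 2)) * (T - 1 - a).
Proof.
move=> N1 aT H pT; set c := _ / _.
have N2 : 0 < N + 2 by lra.
have TT : T - 1 <= T by lra.
have pc t : a <= t <= T - 1 -> c <= p t.
  move=> /andP[at_ tT].
  have tT' : t <= T by lra.
  pose Q s := expR (- N * s) * p s - expR (- (N + 2) * s) / (N + 2).
  have : - Q t <= - Q T.
    apply: (is_der_ge0_le (fun s => - Q s) (fun s => expR (- N * s) * nonlin s (y s) -
      expR (- (N + 2) * s)) _ _ tT').
      move=> s /andP[ts sT]; have := H s; rewrite (le_trans at_ ts) sT => /(_ isT).
      move=> /damped_derivative D; rewrite /Q; der_eq; field; lra.
    move=> s /andP[ts sT]; rewrite subr_ge0.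
    have -> : - (N + 2) * s = - N * s + - 2 * s by ring.
    rewrite expRD ler_wpM2l ?expR_ge0// ler_expR.
    by have := expR_ge0 (y s); lra.
  rewrite lerN2 /Q => Qt.
  (* The unit gap between [t] and [T] makes the endpoint term at most half of the main one. *)
  have e2 : 2 * expR (- (N + 2) * T) <= expR (- (N + 2) * t).
    have -> : - (N + 2) * t = (N + 2) * (T - t) + - (N + 2) * T by ring.
    rewrite expRD ler_wpM2r ?expR_ge0//.
    have : 3 <= (N + 2) * (T - t).
      have : 0 <= (N + 2 - 3) * (T - t - 1) by rewrite mulr_ge0//; lra.
      lra.
    by have := @expR_ge1Dx R ((N + 2) * (T - t)); lra.
  have e3 : expR (- (N + 2) * t) / (2 * (N + 2)) <= expR (- N * t) * p t.
    have pT' : 0 < expR (- N * T) * p T by rewrite mulr_gt0 ?expR_gt0.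
    have -> : expR (- (N + 2) * t) / (2 * (N + 2)) =
      expR (- (N + 2) * t) / (N + 2) - expR (- (N + 2) * t) / 2 / (N + 2).
      by field; lra.
    have : expR (- (N + 2) * T) / (N + 2) <= expR (- (N + 2) * t) / 2 / (N + 2).
      by rewrite ler_wpM2r ?invr_ge0 ?(ltW N2)//; lra.
    lra.
  rewrite -(ler_pM2l (expR_gt0 (- N * t))) (le_trans _ e3)// /c mulrA.
  rewrite ler_wpM2r ?invr_ge0//; first by rewrite mulr_ge0// ltW.
  by rewrite -expRD ler_expR; lra.
have := is_der_ge0_le (fun t => y t - c * t) (fun t => p t - c) a (T - 1) aT.
have Hd t : a <= t <= T - 1 -> is_derive t 1 (fun t => y t - c * t) (p t - c).
  move=> /andP[at_ tT]; have := H t; rewrite at_ (le_trans tT TT) => /(_ isT)[? _].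
  by der_eq; ring.
by move=> /(_ Hd (fun t h => ltac:(rewrite subr_ge0; exact: pc))); lra.
Qed.

Lemma harmonic_small (C d : R) (J : nat) : 0 < d ->
  exists k : nat, C / (J + k).+1%:R < d.
Proof.
move=> d0; pose k := Num.bound (`|C| / d); exists k.
have k0 : 0 < ((J + k).+1%:R : R) by rewrite ltr0n.
rewrite ltr_pdivrMr// (le_lt_trans (ler_norm C))// mulrC -ltr_pdivrMr//.
have : `|C| / d < k%:R by apply: archi_boundP; rewrite divr_ge0// ltW.
by move=> /lt_le_trans; apply; rewrite ler_nat (leq_trans (leq_addl J k)).
Qed.

Lemma le_harmonic (x z C : R) (J : nat) :
  (forall k : nat, x <= z + C / (J + k).+1%:R) -> x <= z.
Proof.
move=> H; apply/ler_addgt0Pr => d d0; have [k kd] := harmonic_small C d J d0.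
by apply: le_trans (H k) _; rewrite lerD2l ltW.
Qed.

Lemma profile_ge N t : 1 <= N -> T0 N <= t -> 19 / 20 <= profile N t.
Proof.
move=> N1 Tt; have [t20 _ _ _] := basic_bounds N t Tt.
have i0 := inner_gt0 N N1 t Tt; have /andP[i1 _] := inner_bounds N N1 t Tt.
have := @le_ln1Dx R ((inner N t)^-1 - 1); rewrite [1 + _]addrC subrK => H.
have iv : 0 < (inner N t)^-1 by rewrite invr_gt0.
have := H ltac:(lra); rewrite lnV ?posrE// -/(profile N t).
have : (inner N t)^-1 <= 20^-1 by rewrite lef_pV2 ?posrE//; lra.
lra.
Qed.

(* The solutions matching the profile at the points [K j] are compared pairwise:
   they differ by at most [E / j.+1] below [K j], and the limit is the solution. *)
Lemma singular_solution_from N : 1 <= N -> exists B S : R, [/\ 0 <= B, T0 N <= S &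
  forall a0, exists y p, (forall t, a0 < t -> ode_at N y p t) /\ near_profile N B S y p].
Proof.
move=> N1; have [B [T [B1 TT HB]]] := stay_near_profile N N1.
have B0 : 0 <= B by lra.
have N0 : 0 <= N by lra.
have [T1 T1T HT] := linearised_coefficient N N1 B B0.
pose S := Num.max T T1.
have TS : T <= S by rewrite le_max lexx.
have T1S : T1 <= S by rewrite le_max lexx orbT.
have T0S : T0 N <= S by exact: le_trans TS.
have [S20 _ _ _] := basic_bounds N S T0S.
exists B, S; split => // a0.
pose a := Num.min a0 T.
have aa0 : a <= a0 by rewrite ge_min lexx.
have aT : a <= T by rewrite ge_min lexx orbT.
have aS : a <= S by exact: le_trans TS.
pose Y := profile N S + B.
pose K (j : nat) : R := S + 1 + j%:R.
have SK j : S <= K j by rewrite /K -addrA lerDl addr_ge0.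
have jK j : j.+1%:R <= K j by rewrite /K -[in leLHS]addn1 natrD; lra.
have KK j m : (j <= m)%N -> K j <= K m by move=> jm; rewrite /K lerD2l ler_nat.
have aSK j : a <= K j by have := SK j; lra.
have T0K j : T0 N <= K j by exact: le_trans (SK j).
have /choice[y_ yP] : forall j, exists z : (R -> R) * (R -> R),
    [/\ z.1 (K j) = profile N (K j), z.2 (K j) = dprofile N (K j) &
        forall t, a <= t <= K j -> ode_at N z.1 z.2 t].
  move=> j; have dp := dprofile_gt0 N N1 (K j) (T0K j).
  have [y [p H]] := terminal_value_problem N a (K j) (profile N (K j)) _ (aSK j) dp.
  by exists (y, p).
pose y j := (y_ j).1; pose p j := (y_ j).2.
have ode j t : a <= t <= K j -> ode_at N (y j) (p j) t by have [_ _] := yP j; apply.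
have near j t : S <= t <= K j -> `|y j t - profile N t| <= B / t ^+ 2 /\
    `|p j t - dprofile N t| <= B / t ^+ 2.
  move=> /andP[St tK]; have [h1 h2 h3] := yP j.
  apply: (HB (K j)) => //; first exact: le_trans (SK j).
    by move=> s /andP[Ts sK]; apply: h3; rewrite sK (le_trans aT Ts).
  by rewrite tK andbT (le_trans TS).
have ppos j t : a <= t <= K j -> 0 < p j t.
  move=> /andP[at_ tK]; apply: (ode_p_gt0 N (y j) (p j) t (K j) tK).
    by move=> s /andP[ts sK]; apply: ode; rewrite sK (le_trans at_).
  by have [_ h _] := yP j; rewrite /p h dprofile_gt0.
have mono j s t : a <= s -> s <= t -> t <= K j -> y j s <= y j t.
  move=> as_ st tK; have dom z : s <= z <= t -> a <= z <= K j.
    by move=> /andP[sz zt]; rewrite (le_trans as_ sz) (le_trans zt tK).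
  apply: (is_der_ge0_le (y j) (p j) _ _ st) => z /dom zd; last exact/ltW/ppos.
  by have [] := ode j z zd.
have invt t : S <= t -> B / t ^+ 2 <= B.
  by move=> St; rewrite ler_pdivrMr ?exprn_gt0 ?ler_peMr ?exprn_ege1//; lra.
have yY j t : a <= t <= S -> y j t <= Y.
  move=> /andP[at_ tS]; apply: (le_trans (mono j t S at_ tS (SK j))).
  have [] := near j S; first by rewrite lexx SK.
  by have := invt S (lexx S); rewrite ler_norml /Y => ? /andP[_ ?] _; lra.
(* [5 + N^2] adds the factors 1 and [4 + N^2] by which [lyap] controls the two squares; the other
   factor comes from [lyap_near]. *)
pose C1 := (5 + N ^+ 2) * (8 * (1 + N) ^+ 2 * B ^+ 2).
have N20 := sqr_ge0 N.
have C8 : 0 <= 8 * (1 + N) ^+ 2 * B ^+ 2 by rewrite mulr_ge0 ?sqr_ge0// mulr_ge0 ?sqr_ge0.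
have C10 : 0 <= C1 by rewrite mulr_ge0//; lra.
pose G := expR ((1 + expR Y * nonlin a Y) * (S - a)).
have L0 : 0 <= expR Y * nonlin a Y by rewrite mulr_ge0 ?expR_ge0.
have G1 : 1 <= G by rewrite -expR0 ler_expR mulr_ge0//; lra.
pose sq j m t := (y j t - y m t) ^+ 2 + (p j t - p m t) ^+ 2.
have sqS j m t : (j <= m)%N -> S <= t <= K j -> sq j m t <= C1 / K j ^+ 4.
  move=> jm /andP[St tK]; have Km := KK _ _ jm.
  have T1t : T1 <= t by exact: le_trans St.
  have at' : a <= t by lra.
  have dom s : t <= s <= K j -> [/\ a <= s <= K j, a <= s <= K m,
      S <= s <= K j & S <= s <= K m].
    move=> /andP[ts sK]; have as_ := le_trans at' ts; have Ss := le_trans St ts.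
    by split; apply/andP; split => //; exact: le_trans Km.
  have h := lyap_diff_mono N N1 B T1 HT (y j) (p j) (y m) (p m) t (K j) T1t tK.
  have {}h := h (fun s d => let: And4 h _ _ _ := dom s d in ode j s h)
    (fun s d => let: And4 _ h _ _ := dom s d in ode m s h)
    (fun s d => let: And4 _ _ h _ := dom s d in (near j s h).1)
    (fun s d => let: And4 _ _ _ h := dom s d in (near m s h).1).
  have [n1 n2] : `|y j (K j) - profile N (K j)| <= B / K j ^+ 2 /\
      `|p j (K j) - dprofile N (K j)| <= B / K j ^+ 2 by apply: near; rewrite SK lexx.
  have [n3 n4] : `|y m (K j) - profile N (K j)| <= B / K j ^+ 2 /\
      `|p m (K j) - dprofile N (K j)| <= B / K j ^+ 2 by apply: near; rewrite SK Km.
  have K1 : 1 <= K j by have := SK j; lra.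
  have := le_trans h (lyap_near N B (K j) _ _ _ _ N1 K1 n1 n2 n3 n4).
  set V := lyap _ _ _ => HV.
  have e1 := lyap_ge_e N N1 (y j t - y m t) (p j t - p m t).
  have e2 := lyap_ge_q N N1 (y j t - y m t) (p j t - p m t).
  rewrite -/V in e1 e2; rewrite /sq /C1 -mulrA.
  apply: (@le_trans _ _ ((5 + N ^+ 2) * V)); first by lra.
  by rewrite ler_wpM2l//; lra.
have sqA j m t : (j <= m)%N -> a <= t <= K j -> sq j m t <= C1 * G / K j ^+ 4.
  move=> jm /andP[at_ tK]; have Km := KK _ _ jm.
  have K4 : 0 <= C1 / K j ^+ 4 by rewrite divr_ge0 ?exprn_ge0//; have := SK j; lra.
  have -> : C1 * G / K j ^+ 4 = C1 / K j ^+ 4 * G by ring.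
  have [St|/ltW tS] := leP S t.
    by rewrite (le_trans (sqS j m t jm _)) ?St// ler_peMr.
  have dom (q : nat) s : (j <= q)%N -> t <= s <= S -> a <= s <= K q.
    move=> jq /andP[ts sS]; by rewrite (le_trans at_ ts) (le_trans sS).
  have domS s : t <= s <= S -> a <= s <= S.
    by move=> /andP[ts ->]; rewrite (le_trans at_ ts).
  have := gronwall N (y j) (p j) (y m) (p m) t S Y N0 tS
    (fun s h => ode j s (dom j s (leqnn j) h)) (fun s h => ode m s (dom m s jm h))
    (fun s h => yY j s (domS s h)) (fun s h => yY m s (domS s h)).
  rewrite -/(sq j m t) -/(sq j m S) => /le_trans; apply.
  apply: ler_pM.
  - by rewrite addr_ge0 ?sqr_ge0.
  - exact: expR_ge0.
  - by apply: sqS => //; rewrite lexx SK.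
  rewrite ler_expR; apply: ler_pM.
  - by rewrite addr_ge0// mulr_ge0 ?expR_ge0.
  - by rewrite subr_ge0.
  - by rewrite lerD2l ler_wpM2l ?expR_ge0// nonlin_le.
  - by rewrite lerD2l lerN2.
(* [E >= 1] gives [C1 * G <= E^2], so square roots of the energy estimates fit under [E]; [B] covers
   the distance to the profile beyond [K j]. *)
pose E := C1 * G + 1 + B.
have E0 : 0 <= C1 * G by rewrite mulr_ge0//; lra.
have jp (j : nat) : (0 : R) < j.+1%:R by rewrite ltr0n.
have small (x : R) j : x ^+ 2 <= C1 * G / K j ^+ 4 -> `|x| <= E / j.+1%:R.
  move=> xx; have Kj : 0 < K j by have := SK j; lra.
  rewrite -(@ler_pXn2r _ 2) ?nnegrE ?divr_ge0 ?(ltW (jp j))//; last by rewrite /E; lra.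
  rewrite real_normK ?num_real// (le_trans xx)// exprMn exprVn.
  apply: ler_pM => //; first by rewrite invr_ge0 exprn_ge0// ltW.
    apply: (@le_trans _ _ (E ^+ 1)); first by rewrite expr1 /E; lra.
    by rewrite ler_eXn2l//; rewrite /E; lra.
  rewrite lef_pV2 ?posrE ?exprn_gt0//.
  have K1 : 1 <= K j by have := SK j; lra.
  apply: (@le_trans _ _ (K j ^+ 2)).
    by rewrite ler_pXn2r ?nnegrE ?(ltW Kj)// jK.
  by rewrite ler_weXn2l.
have diff j m t : (j <= m)%N -> a <= t <= K j ->
    `|y j t - y m t| <= E / j.+1%:R /\ `|p j t - p m t| <= E / j.+1%:R.
  move=> jm tj; have := sqA j m t jm tj.
  have s1 := sqr_ge0 (y j t - y m t); have s2 := sqr_ge0 (p j t - p m t).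
  by rewrite /sq => h; split; apply: small; lra.
(* Solution [j] is controlled only up to [K j]. Continuing it by the profile gives functions that
   are Cauchy uniformly on the whole half-line and never leave the tube. *)
pose yt j t := if t <= K j then y j t else profile N t.
pose pt j t := if t <= K j then p j t else dprofile N t.
have far j t : K j < t -> B / t ^+ 2 <= E / j.+1%:R.
  move=> Kt; have Kj := jK j; have K1 := SK j.
  apply: ler_pM => //; first by rewrite invr_ge0 sqr_ge0.
    by rewrite /E; lra.
  rewrite lef_pV2 ?posrE ?exprn_gt0//; last by lra.
  by rewrite (le_trans Kj)// (le_trans (ltW Kt))// expr2 ler_peMr//; lra.
have Ej j : 0 <= E / j.+1%:R by rewrite divr_ge0// /E; lra.
have tildeC j m t : (j <= m)%N -> a <= t ->
    `|yt j t - yt m t| <= E / j.+1%:R /\ `|pt j t - pt m t| <= E / j.+1%:R.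
  move=> jm at_; rewrite /yt /pt; have [tK|Kt] := leP t (K j).
    by rewrite (le_trans tK (KK _ _ jm)); apply: diff => //; rewrite at_.
  have [tK|_] := leP t (K m); last by rewrite !subrr normr0.
  have St : S <= t by rewrite (le_trans (SK j))// ltW.
  have [h1 h2] := near m t ltac:(by rewrite St tK).
  by have h3 := far j t Kt; split; rewrite distrC (le_trans _ h3).
have lim (f : nat -> R -> R) :
    (forall j m t, (j <= m)%N -> a <= t -> `|f j t - f m t| <= E / j.+1%:R) ->
    exists l : R -> R, forall t j, a <= t -> `|l t - f j t| <= E / j.+1%:R.
  move=> H.
  have Q t : exists l : R, forall j, a <= t -> `|l - f j t| <= E / j.+1%:R.
    have [at_|at_] := leP a t; last by exists 0.
    have [l lP] := cauchy_limit (fun j => f j t) (fun j => E / j.+1%:R)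
      (fun j m jm => H j m t jm at_).
    by exists l.
  by have [l lP] := choice Q; exists l => t j; exact: lP.
have [yy yyP] := lim yt (fun j m t jm h => (tildeC j m t jm h).1).
have [pp ppP] := lim pt (fun j m t jm h => (tildeC j m t jm h).2).
have nearP : near_profile N B S yy pp.
  move=> t St; have at_ : a <= t by lra.
  have B2 : 0 <= B / t ^+ 2 by rewrite divr_ge0// sqr_ge0.
  have ytn j : `|yt j t - profile N t| <= B / t ^+ 2 /\ `|pt j t - dprofile N t| <= B / t ^+ 2.
    rewrite /yt /pt; have [tK|_] := leP t (K j); last by rewrite !subrr normr0.
    by apply: near; rewrite St.
  split; apply: (le_harmonic _ _ E 0) => k; rewrite add0n [leRHS]addrC.
    by rewrite (le_trans (ler_distD (yt k t) _ _))// lerD ?yyP// (ytn k).1.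
  by rewrite (le_trans (ler_distD (pt k t) _ _))// lerD ?ppP// (ytn k).2.
have odeP t : a < t -> ode_at N yy pp t.
  (* From index [J] on, the extended functions coincide near [t] with genuine solutions, so the
     limit of derivatives can be taken there. *)
  move=> at_; pose J := Num.bound (`|t| + 1).
  have tJ : t + 1 <= K J.
    have : `|t| + 1 < J%:R by apply: archi_boundP; rewrite addr_ge0.
    by have := ler_norm t; rewrite /K; lra.
  pose r := Num.min 1 (t - a).
  have r0 : 0 < r by rewrite lt_min ltr01 subr_gt0.
  have dom x : `|x - t| < r -> a <= x /\ x <= t + 1.
    rewrite lt_min => /andP[]; rewrite !ltr_norml ltrBDr => /andP[_ /ltW h1].
    rewrite ltrBDr opprB subrK => /andP[/ltW h2 _]; split => //.
    by rewrite -lerBlDl.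
  have domK (k : nat) x : `|x - t| < r -> a <= x <= K (J + k)%N.
    by move=> /dom[-> xt] /=; rewrite (le_trans xt)// (le_trans tJ)// KK// leq_addr.
  have ytE (k : nat) x : `|x - t| < r -> yt (J + k)%N x = y (J + k)%N x.
    by move=> /(domK k)/andP[_ xK]; rewrite /yt xK.
  have ptE (k : nat) x : `|x - t| < r -> pt (J + k)%N x = p (J + k)%N x.
    by move=> /(domK k)/andP[_ xK]; rewrite /pt xK.
  pose X : R := Num.max (t + 1) S; pose M : R := profile N X + B.
  have tX : t + 1 <= X by rewrite le_max lexx.
  have SX : S <= X by rewrite le_max lexx orbT.
  have yM (k : nat) x : `|x - t| < r -> y (J + k)%N x <= M.
    move=> /dom[ax xt]; have JK := KK J (J + k)%N (leq_addr _ _).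
    have XK : X <= K (J + k)%N by rewrite ge_max (le_trans tJ JK) SK.
    apply: (le_trans (mono _ _ _ ax (le_trans xt tX) XK)).
    have [] := near (J + k)%N X ltac:(by rewrite SX XK).
    by have := invt X SX; rewrite ler_norml /M => ? /andP[_ ?] _; lra.
  have yyM x : `|x - t| < r -> yy x <= M.
    move=> xt; apply: (le_harmonic _ _ E J) => k.
    have := yyP x (J + k)%N (dom x xt).1; rewrite ytE// ler_norml => /andP[_ h].
    by have := lerD (yM k x xt) h; rewrite addrC subrK.
  have LL : 0 <= expR M * nonlin a M by rewrite mulr_ge0 ?expR_ge0.
  pose L := N + expR M * nonlin a M.
  have L1 : 1 <= L by rewrite /L ler_wpDr.
  pose e (k : nat) := L * E / (J + k).+1%:R.
  have eE (k : nat) : E / (J + k).+1%:R <= e k by rewrite /e -mulrA ler_peMl.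
  split.
  - apply: (is_der_limit (fun k : nat => y (J + k)%N) (fun k : nat => p (J + k)%N) yy pp e t r r0).
    + by move=> d; exact: harmonic_small.
    + by move=> k x xt; have [] := ode (J + k)%N x (domK k x xt).
    + by move=> k x xt; rewrite (le_trans _ (eE k))// -ytE// yyP// (dom x xt).1.
    + by move=> k x xt; rewrite (le_trans _ (eE k))// -ptE// ppP// (dom x xt).1.
  - apply: (is_der_limit (fun k : nat => p (J + k)%N)
      (fun (k : nat) x => N * p (J + k)%N x - nonlin x (y (J + k)%N x)) pp
      (fun x => N * pp x - nonlin x (yy x)) e t r r0).
    + by move=> d; exact: harmonic_small.
    + by move=> k x xt; have [] := ode (J + k)%N x (domK k x xt).
    + by move=> k x xt; rewrite (le_trans _ (eE k))// -ptE// ppP// (dom x xt).1.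
    + move=> k x xt; have [ax _] := dom x xt.
      have h1 := ppP x (J + k)%N ax; have h2 := yyP x (J + k)%N ax.
      rewrite ytE// in h2; rewrite ptE// in h1.
      have h3 := nonlin_lipschitz a x M _ _ ax (yyM x xt) (yM k x xt).
      have -> : N * pp x - nonlin x (yy x) - (N * p (J + k)%N x - nonlin x (y (J + k)%N x))
        = N * (pp x - p (J + k)%N x) - (nonlin x (yy x) - nonlin x (y (J + k)%N x)) by ring.
      rewrite (le_trans (ler_normB _ _))// normrM (ger0_norm N0).
      rewrite /e /L -mulrA mulrDl lerD//; first by rewrite ler_wpM2l.
      by rewrite (le_trans h3)// ler_wpM2l.
exists yy, pp; split => // t /(le_lt_trans aa0); exact: odeP.
Qed.

(** How far left the solution must be followed depends on [B] and [S] through [descent]. This is why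
    [singular_solution_from] fixes them before the left end is chosen. *)
Lemma singular_solution N : 1 <= N -> exists a B T y p,
  [/\ 0 <= B, forall t, a < t -> ode_at N y p t, near_profile N B T y p &
      exists2 t, a < t & y t = 0].
Proof.
move=> N1; have [B [S [B0 T0S H]]] := singular_solution_from N N1.
have [S20 _ _ _] := basic_bounds N S T0S.
have invt t : S <= t -> B / t ^+ 2 <= B.
  by move=> St; rewrite ler_pdivrMr ?exprn_gt0 ?ler_peMr ?exprn_ege1//; lra.
pose Y := profile N S + B.
have Y0 : 0 <= Y by have := profile_ge N S N1 T0S; rewrite /Y; lra.
pose c := expR (- 2 * (S - 1)) / (2 * (N + 2)).
have c0 : 0 < c by rewrite divr_gt0 ?expR_gt0//; lra.
(* Over the length [(Y + 1) / c] the solution drops by at least [Y + 1], from a value at most [Y].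
   Taking [a] one unit further left keeps [a1] inside the domain. *)
pose a1 := S - 1 - (Y + 1) / c.
have a1S : a1 <= S - 1 by rewrite /a1 gerBl divr_ge0 ?(ltW c0)//; lra.
pose a := a1 - 1; have aa1 : a < a1 by rewrite ltrBlDr ltrDl.
have aS : a < S - 1 by exact: lt_le_trans a1S.
have [yy [pp [odeP nearP]]] := H a.
exists a, B, S, yy, pp; split => //.
have yymono := ode_y_mono N B S yy pp a N1 odeP nearP.
have [yS _] := nearP S (lexx S).
have d1 : yy a1 < 0.
  have := descent N yy pp a1 S N1 a1S.
  rewrite -/c => H1.
  have := H1 (fun t h => odeP t (lt_le_trans aa1 (proj1 (andP h))))
    (ode_p_pos N B S yy pp a N1 odeP nearP S ltac:(lra)).
  have -> : c * (S - 1 - a1) = Y + 1 by rewrite /a1; field; rewrite gt_eqF.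
  have := yymono (S - 1) S ltac:(lra) ltac:(lra).
  by have := invt S (lexx S); move: yS; rewrite ler_norml /Y => /andP[_ ?]; lra.
pose b := Num.max S (B + 1).
have Sb : S <= b by rewrite le_max lexx.
have Bb : B < b by rewrite (@lt_le_trans _ _ (B + 1)) ?ltrDl// le_max lexx orbT.
have d2 : 0 < yy b.
  have [+ _] := nearP b Sb.
  have := profile_ge N b N1 (le_trans T0S Sb).
  have : B / b ^+ 2 <= 1 / 20.
    rewrite ler_pdivrMr ?exprn_gt0//; last by lra.
    have : 0 <= (b - 20) * b by rewrite mulr_ge0//; lra.
    lra.
  by rewrite ler_norml => ? ? /andP[? ?]; lra.
have ab : a1 <= b by lra.
have [||t] := @IVT R yy a1 b 0 ab.
- apply: (is_der_continuous_within yy pp) => x /andP[ax _].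
  by have [] := odeP x (lt_le_trans aa1 ax).
- by rewrite ge_min le_max (ltW d1) (ltW d2) orbT.
by rewrite in_itv /= => /andP[t1 _] yt0; exists t => //; exact: lt_le_trans t1.
Qed.

End singular_ode.

(** * Euclidean inner product, norm and topology *)

Section euclidean_geometry.
Context {R : realType} {n : nat}.
Implicit Types (x y z v e : 'rV[R]_n) (f g : 'rV[R]_n -> R) (c r t : R).

Definition dot x y : R := \sum_(i < n) x 0 i * y 0 i.

Lemma dotC x y : dot x y = dot y x.
Proof. by apply: eq_bigr => i _; rewrite mulrC. Qed.

Lemma dotDl x y z : dot (x + y) z = dot x z + dot y z.
Proof. by rewrite -big_split; apply: eq_bigr => i _; rewrite mxE mulrDl. Qed.

Lemma dotZl c x z : dot (c *: x) z = c * dot x z.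
Proof. by rewrite big_distrr; apply: eq_bigr => i _; rewrite mxE -mulrA. Qed.

Lemma dotNl x z : dot (- x) z = - dot x z.
Proof. by rewrite -scaleN1r dotZl mulN1r. Qed.

Lemma dotDr x y z : dot x (y + z) = dot x y + dot x z.
Proof. by rewrite !(dotC x) dotDl. Qed.

Lemma dotZr c x z : dot x (c *: z) = c * dot x z.
Proof. by rewrite !(dotC x) dotZl. Qed.

Lemma dotNr x z : dot x (- z) = - dot x z.
Proof. by rewrite !(dotC x) dotNl. Qed.

Definition dotE := (dotDl, dotDr, dotZl, dotZr, dotNl, dotNr).

Lemma dot_delta x i : dot x (delta_mx 0 i) = x 0 i.
Proof.
rewrite /dot (bigD1 i)//= mxE !eqxx mulr1 big1 ?addr0// => j ji.
by rewrite mxE (negbTE ji) andbF mulr0.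
Qed.

Lemma dot_ge0 x : 0 <= dot x x.
Proof. by apply: sumr_ge0 => i _; rewrite -expr2 sqr_ge0. Qed.

Lemma enormE x : enorm x = Num.sqrt (dot x x).
Proof. by congr Num.sqrt; apply: eq_bigr => i _; rewrite expr2. Qed.

Lemma enorm2 x : enorm x ^+ 2 = dot x x.
Proof. by rewrite enormE sqr_sqrtr ?dot_ge0. Qed.

Lemma enorm_ge0 x : 0 <= enorm x. Proof. exact: sqrtr_ge0. Qed.

Lemma enorm_eq0 x : (enorm x == 0) = (x == 0).
Proof.
apply/eqP/eqP => [x0|->]; last first.
  by rewrite enormE -(scale0r (0 : 'rV[R]_n)) dotZl mul0r sqrtr0.
have : dot x x = 0 by rewrite -enorm2 x0 expr0n.
move=> /eqP; rewrite psumr_eq0 => [/allP H|i _]; last by rewrite -expr2 sqr_ge0.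
apply/rowP => i; have := H i (mem_index_enum i).
by rewrite mulf_eq0 orbb mxE => /eqP.
Qed.

Lemma enorm0 : enorm (0 : 'rV[R]_n) = 0.
Proof. by apply/eqP; rewrite enorm_eq0. Qed.

Lemma enorm_gt0 x : (0 < enorm x) = (x != 0).
Proof. by rewrite lt_neqAle enorm_ge0 andbT eq_sym enorm_eq0. Qed.

Lemma enormZ c x : enorm (c *: x) = `|c| * enorm x.
Proof.
rewrite !enormE dotZl dotZr mulrA -expr2 sqrtrM ?sqr_ge0//.
by rewrite sqrtr_sqr.
Qed.

Lemma enormN x : enorm (- x) = enorm x.
Proof. by rewrite -scaleN1r enormZ normrN normr1 mul1r. Qed.

Lemma enorm_distC x y : enorm (x - y) = enorm (y - x).
Proof. by rewrite -enormN opprB. Qed.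

Lemma cauchy_schwarz x y : `|dot x y| <= enorm x * enorm y.
Proof.
have [->|y0] := eqVneq y 0.
  by rewrite enorm0 mulr0 -(scale0r (0 : 'rV[R]_n)) dotZr mul0r normr0.
have e0 : 0 < enorm y by rewrite enorm_gt0.
have d0 : 0 < dot y y by rewrite -enorm2 exprn_gt0.
have h : 0 <= dot x x * dot y y - dot x y ^+ 2.
  have := dot_ge0 (dot y y *: x - dot x y *: y).
  rewrite !dotE (dotC y x) => h.
  have : 0 <= dot y y * (dot x x * dot y y - dot x y ^+ 2) by lra.
  by rewrite pmulr_rge0.
rewrite -ler_sqr ?nnegrE ?mulr_ge0 ?enorm_ge0//.
by rewrite real_normK ?num_real// exprMn !enorm2 -subr_ge0.
Qed.

Lemma enormD x y : enorm (x + y) <= enorm x + enorm y.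
Proof.
rewrite -ler_sqr ?nnegrE ?addr_ge0 ?enorm_ge0// sqrrD !enorm2 !dotE (dotC y x).
have := cauchy_schwarz x y; rewrite ler_norml => /andP[_ h]; lra.
Qed.

Lemma enorm_dist x y : `|enorm x - enorm y| <= enorm (x - y).
Proof.
have h1 := enormD (x - y) y; have h2 := enormD (y - x) x.
rewrite subrK in h1; rewrite subrK enorm_distC in h2.
by rewrite ler_norml; apply/andP; split; lra.
Qed.

Lemma coord_le_enorm x i : `|x 0 i| <= enorm x.
Proof.
rewrite -ler_sqr ?nnegrE ?enorm_ge0// real_normK ?num_real// enorm2 /dot.
rewrite (bigD1 i)//= -expr2 lerDl; apply: sumr_ge0 => j _.
by rewrite -expr2 sqr_ge0.
Qed.

Lemma norm_le_enorm x : `|x| <= enorm x.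
Proof.
rewrite -[leLHS]/(mx_norm x) mx_normrE; apply: bigmax_le; first exact: enorm_ge0.
by move=> [i j] _ /=; rewrite (ord1 i) coord_le_enorm.
Qed.

Lemma enorm_le_norm x : enorm x <= n%:R * `|x|.
Proof.
have [n0|n0] := posnP n.
  rewrite enormE /dot big1 ?sqrtr0 ?mulr_ge0// => i _.
  by have := ltn_ord i; rewrite [X in (_ < X)%N]n0.
have h i : `|x 0 i| <= `|x|.
  by rewrite -[leRHS]/(mx_norm x) mx_normrE; apply/bigmax_geP; right; exists (0, i).
rewrite -ler_sqr ?nnegrE ?enorm_ge0 ?mulr_ge0// enorm2 /dot.
apply: (@le_trans _ _ (\sum_(i < n) `|x| ^+ 2)).
  apply: ler_sum => i _; rewrite -expr2 -(real_normK (num_real (x 0 i))).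
  by rewrite ler_sqr ?nnegrE.
rewrite sumr_const card_ord -[leLHS]mulr_natl exprMn ler_wpM2r ?sqr_ge0//.
by rewrite expr2 ler_peMr// ler1n.
Qed.

Lemma nbhs_enormP x (A : set 'rV[R]_n) : nbhs x A <->
  exists2 r, 0 < r & forall z, enorm (z - x) < r -> A z.
Proof.
split=> [/nbhs_ballP[r /= r0 rA]|[r r0 rA]].
  exists r => // z zx; apply: rA; rewrite mx_norm_ball /ball_ /=.
  by rewrite distrC (le_lt_trans (norm_le_enorm _)).
have n0 : 0 < (n.+1%:R : R) by rewrite ltr0n.
apply/nbhs_ballP; exists (r / n.+1%:R) => /=; first by rewrite divr_gt0.
move=> z; rewrite mx_norm_ball /ball_ /= distrC ltr_pdivlMr// => zx.
apply: rA; apply: le_lt_trans zx; rewrite (le_trans (enorm_le_norm _))// mulrC.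
by rewrite ler_wpM2l// ler_nat.
Qed.

Lemma continuous_enormP f x : {for x, continuous f} <->
  forall c, 0 < c -> exists2 r, 0 < r & forall z, enorm (z - x) < r -> `|f z - f x| <= c.
Proof.
split=> [fc c c0|H].
  have /cvgrPdist_le /(_ c c0) /nbhs_enormP[r r0 rP] := fc.
  by exists r => // z /rP; rewrite distrC.
apply/(@cvgrPdist_le _ _ _ _ (nbhs_filter x)) => c c0; apply/nbhs_enormP; have [r r0 rP] := H c c0.
by exists r => // z /rP; rewrite distrC.
Qed.

Lemma continuous_enorm_sub y : continuous (fun x => enorm (x - y)).
Proof.
move=> x; apply/continuous_enormP => c c0; exists c => // z zx.
by rewrite (le_trans (enorm_dist _ _))// opprB addrA subrK ltW.
Qed.

Lemma continuous_enorm : continuous (@enorm R n).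
Proof.
move=> x; apply/continuous_enormP => c c0; exists c => // z zx.
by rewrite (le_trans (enorm_dist _ _))// ltW.
Qed.

Lemma continuous_dot e : continuous (fun x => dot x e).
Proof.
move=> x; apply/continuous_enormP => c c0.
have e0 : 0 < enorm e + 1 by rewrite ltr_wpDl// enorm_ge0.
exists (c / (enorm e + 1)); first by rewrite divr_gt0.
move=> z; rewrite ltr_pdivlMr// => zx; rewrite -dotNl -dotDl.
rewrite (le_trans (cauchy_schwarz _ _))// (le_trans _ (ltW zx))//.
by rewrite ler_wpM2l ?enorm_ge0// lerDl.
Qed.

Lemma continuous_addf f g : continuous f -> continuous g ->
  continuous (fun x => f x + g x).
Proof. by move=> cf cg x; exact: (cvgD (cf x) (cg x)). Qed.

Lemma continuous_mulf f g : continuous f -> continuous g ->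
  continuous (fun x => f x * g x).
Proof. by move=> cf cg x; exact: (cvgM (cf x) (cg x)). Qed.

Lemma continuous_cstf c : continuous (fun _ : 'rV[R]_n => c).
Proof. exact: cst_continuous. Qed.

Lemma continuous_compf (g : R -> R) f : continuous g -> continuous f ->
  continuous (fun x => g (f x)).
Proof. by move=> cg cf x; apply: (@continuous_comp _ _ _ f g); [exact: cf|exact: cg]. Qed.

Lemma closed_le_fun f c : continuous f -> closed [set x | f x <= c].
Proof.
move=> cf; apply: (@closed_comp _ _ f [set y | y <= c]); last exact: closed_le.
by move=> x _; exact: cf.
Qed.

Lemma closed_ge_fun f c : continuous f -> closed [set x | c <= f x].
Proof.
move=> cf; apply: (@closed_comp _ _ f [set y | c <= y]); last exact: closed_ge.
by move=> x _; exact: cf.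
Qed.

Lemma compact_enorm (A : set 'rV[R]_n) r : closed A ->
  (forall x, A x -> enorm x <= r) -> compact A.
Proof.
move=> cA Ar; apply: bounded_closed_compact => //.
exists r; split; first exact: num_real.
move=> c /ltW rc x Ax; apply: le_trans (norm_le_enorm x) _.
exact: le_trans (Ar _ Ax) rc.
Qed.

Lemma attains_min f (A : set 'rV[R]_n) : A !=set0 -> compact A -> continuous f ->
  exists2 x, A x & forall z, A z -> f x <= f z.
Proof.
move=> A0 cA cf.
have [x] := EVT_min_rV A0 cA (continuous_subspaceT cf).
by rewrite inE => Ax H; exists x => // z Az; apply: H; rewrite inE.
Qed.

End euclidean_geometry.

(** * Derivatives along lines and continuous partial derivatives *)

Section directional_derivatives.
Context {R : realType} {n : nat}.
Implicit Types (x y z v e : 'rV[R]_n) (u w : 'rV[R]_n -> R) (c r t d : R).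

Lemma is_derive_line u x v t d :
  is_derive (x + t *: v) v u d <-> is_derive t 1 (fun s : R => u (x + s *: v)) d.
Proof.
set g := fun s => _.
have E : (fun h : R => h^-1 *: ((g \o shift t) (h *: (1 : R)) - g t)) =
    (fun h : R => h^-1 *: ((u \o shift (x + t *: v)) (h *: v) - u (x + t *: v))).
  apply/funext => h; rewrite /g /= /shift /=; congr (_ *: (u _ - _)).
  by rewrite [h *: 1]mulr1 scalerDl addrCA addrA addrC addrA.
have E1 : derivable g t 1 = derivable u (x + t *: v) v by rewrite /derivable E.
have E2 : 'D_1 g t = 'D_v u (x + t *: v) by rewrite /derive E.
split=> -[D1 D2].
  by apply: (@DeriveDef _ _ _ _ _ g d); rewrite ?E1 ?E2.
by apply: (@DeriveDef _ _ _ _ _ u d); rewrite -?E1 -?E2.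
Qed.

Lemma is_derive_line0 u x v d :
  is_derive x v u d <-> is_derive (0 : R) 1 (fun s : R => u (x + s *: v)) d.
Proof. by rewrite -is_derive_line scale0r addr0. Qed.

Definition rowtrunc (m : nat) v : 'rV[R]_n := \row_i (if (i < m)%N then v 0 i else 0).

Lemma rowtrunc0 v : rowtrunc 0 v = 0.
Proof. by apply/rowP => i; rewrite !mxE ltn0. Qed.

Lemma rowtrunc_full v : rowtrunc n v = v.
Proof. by apply/rowP => i; rewrite !mxE ltn_ord. Qed.

Lemma rowtruncS (i : 'I_n) v :
  rowtrunc i.+1 v = rowtrunc i v + v 0 i *: delta_mx 0 i.
Proof.
apply/rowP => j; rewrite !mxE ltnS eqxx /= leq_eqVlt.
have [->|ji] := eqVneq j i; first by rewrite eqxx ltnn /= add0r mulr1.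
by rewrite (negbTE (ji : (j : nat) != i)) /= mulr0 addr0.
Qed.

Lemma enorm_rowtrunc m v : enorm (rowtrunc m v) <= enorm v.
Proof.
rewrite -ler_sqr ?nnegrE ?enorm_ge0// !enorm2; apply: ler_sum => i _.
by rewrite mxE; case: ifP => // _; rewrite mul0r -expr2 sqr_ge0.
Qed.

Lemma mvt_abs (f df : R -> R) b : (forall t, `|t| <= `|b| -> is_derive t 1 f (df t)) ->
  exists2 c, `|c| <= `|b| & f b - f 0 = df c * b.
Proof.
move=> H; have [b0|b0] := leP 0 b.
  have [|c /andP[c0 cb] E] := mvt f df 0 b b0.
    by move=> t /andP[t0 tb]; apply: H; rewrite !ger0_norm// (le_trans t0).
  by exists c; rewrite ?E ?subr0// !ger0_norm.
have [|c /andP[c0 cb] E] := mvt f df b 0 (ltW b0).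
  by move=> t /andP[t0 tb]; apply: H; rewrite !ler0_norm ?lerN2// ltW.
exists c; first by rewrite !ler0_norm ?lerN2// ltW.
by rewrite -opprB E; ring.
Qed.

(* Going from [x] to [x + h *: v] along the coordinate axes, one mean value
   theorem per axis. *)
Lemma C1_derive u x v :
  (\forall z \near x, forall i : 'I_n, derivable u z (delta_mx 0 i)) ->
  (forall i : 'I_n, {for x, continuous (partial i u)}) ->
  is_derive x v u (\sum_(i < n) v 0 i * partial i u x).
Proof.
move=> /nbhs_enormP[r0 r0_gt0 du] cu.
apply/is_derive_line0/is_der_epsP => e e0.
(* Each of the [n] axis steps may cost [|h| * V * e'], and the total must stay below [e * |h|]. The
   added ones keep the denominators positive for [v = 0] and [n = 0]. *)
pose V := enorm v + 1.
have V0 : 0 < V by rewrite ltr_wpDl// enorm_ge0.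
pose e' := e / ((n%:R + 1) * V).
have nV : 0 < (n%:R + 1) * V by rewrite mulr_gt0// ltr_wpDl.
have e'0 : 0 < e' by rewrite divr_gt0.
have [r [rpos rr0 rP]] : exists r, [/\ 0 < r, r <= r0 & forall i z,
    enorm (z - x) < r -> `|partial i u z - partial i u x| <= e'].
  have : \forall z \near x, forall i, `|partial i u z - partial i u x| <= e'.
    apply: (@filter_forall _ _ (fun i z => `|partial i u z - partial i u x| <= e')
      (nbhs x) (nbhs_filter x)) => i.
    by have /continuous_enormP /(_ e' e'0) [s s0 sP] := cu i;
      apply/nbhs_enormP; exists s.
  move=> /nbhs_enormP[s s0 sP]; exists (Num.min s r0); split.
  - by rewrite lt_min s0.
  - by rewrite ge_min lexx orbT.
  - by move=> i z; rewrite lt_min => /andP[/sP].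
exists (r / (2 * V)); first by rewrite divr_gt0// mulr_gt0.
move=> h; rewrite add0r ltr_pdivlMr ?mulr_gt0// => hr.
rewrite scale0r addr0.
have step (i : 'I_n) : `|u (x + h *: rowtrunc i.+1 v) - u (x + h *: rowtrunc i v)
    - h * (v 0 i * partial i u x)| <= `|h| * V * e'.
  rewrite rowtruncS scalerDr scalerA addrA; set z := x + h *: rowtrunc i v.
  pose b := h * v 0 i.
  have bV : `|b| <= `|h| * V.
    by rewrite normrM ler_wpM2l// (le_trans (coord_le_enorm _ _))// lerDl.
  have zt t : `|t| <= `|b| -> enorm (z + t *: delta_mx 0 i - x) < r.
    move=> tb; rewrite /z addrAC [x + h *: _]addrC addrK.
    apply: (le_lt_trans (enormD _ _)); rewrite !enormZ.
    have d1 : enorm (delta_mx 0 i : 'rV[R]_n) = 1.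
      by rewrite enormE dot_delta mxE !eqxx sqrtr1.
    rewrite d1 mulr1.
    have : `|h| * enorm (rowtrunc i v) <= `|h| * V.
      by rewrite ler_wpM2l// (le_trans (enorm_rowtrunc _ _))// lerDl.
    move: (le_trans tb bV) hr; lra.
  have [t /zt tr E] := mvt_abs (fun t => u (z + t *: delta_mx 0 i))
    (fun t => partial i u (z + t *: delta_mx 0 i)) b ltac:(
      move=> t /zt tr; apply/is_derive_line/derivableP; exact: du (lt_le_trans tr rr0) i).
  rewrite scale0r addr0 in E.
  rewrite E -/b mulrA -/b [b * _]mulrC -mulrBl normrM mulrC.
  by apply: ler_pM => //; exact: rP.
have : `|\sum_(i < n) (u (x + h *: rowtrunc i.+1 v) - u (x + h *: rowtrunc i v)
    - h * (v 0 i * partial i u x))| <= e * `|h|.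
  apply: (le_trans (ler_norm_sum _ _ _)).
  apply: (@le_trans _ _ (\sum_(i < n) `|h| * V * e')); first exact: ler_sum.
  rewrite sumr_const card_ord -mulr_natl.
  have -> : n%:R * (`|h| * V * e') = `|h| * e * (n%:R / (n%:R + 1)).
    by rewrite /e'; field; rewrite !gt_eqF// ltr_wpDl.
  rewrite [leRHS]mulrC ler_piMr ?mulr_ge0 ?(ltW e0)//.
  by rewrite ler_pdivrMr ?mul1r ?lerDl// ltr_wpDl.
congr (`|_| <= _); rewrite big_split /= sumrN -mulr_sumr; congr (_ - _).
rewrite -(big_mkord xpredT (fun i => u (x + h *: rowtrunc i.+1 v) - u (x + h *: rowtrunc i v))).
by rewrite telescope_sumr// rowtrunc_full rowtrunc0 scaler0 addr0.
Qed.

End directional_derivatives.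

(** * Second derivatives along lines, Hessians and reflections *)

Section second_derivatives.
Context {R : realType} {n : nat}.
Implicit Types (x y z v e : 'rV[R]_n) (u w : 'rV[R]_n -> R) (c r s t d : R).

(* Second derivative of [u] at [x] along the line in direction [v]; unlike
   iterated partial derivatives it is stable under affine changes of variable. *)
Definition second_der u x v d : Prop := exists p : R -> R,
  (exists2 r, 0 < r & forall t, `|t| < r ->
     is_derive t 1 (fun s : R => u (x + s *: v)) (p t)) /\
  is_derive (0 : R) 1 p d.

Lemma second_der_add u w x v d d' : second_der u x v d -> second_der w x v d' ->
  second_der (fun z => u z + w z) x v (d + d').
Proof.
move=> [p [[r r0 rP] dp]] [q [[s s0 sP] dq]].
exists (fun t => p t + q t); split; last by der.
exists (Num.min r s); first by rewrite lt_min r0.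
by move=> t; rewrite lt_min => /andP[/rP ? /sP ?]; der.
Qed.

Lemma second_der_scale u x v d c : second_der u x v d ->
  second_der (fun z => c * u z) x v (c * d).
Proof.
move=> [p [[r r0 rP] dp]]; exists (fun t => c * p t); split.
  by exists r => // t /rP ?; der_eq; rewrite mul0r add0r.
by der_eq; rewrite mul0r add0r.
Qed.

Lemma second_der_near u w x v d r : 0 < r ->
  (forall z, enorm (z - x) < r -> u z = w z) ->
  second_der u x v d -> second_der w x v d.
Proof.
move=> r0 uw [p [[s s0 sP] dp]]; exists p; split => //.
have v0 : 0 < enorm v + 1 by rewrite ltr_wpDl// enorm_ge0.
pose b := r / (enorm v + 1).
have b0 : 0 < b by rewrite divr_gt0.
exists (Num.min s b); first by rewrite lt_min s0.
move=> t; rewrite lt_min => /andP[ts tb].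
apply: near_eq_is_derive (sP t ts).
apply/nbhs_ballP; exists (b - `|t|) => /=; first by rewrite subr_gt0.
move=> t' tt'; apply: uw; rewrite addrC addKr enormZ.
have h : `|t'| < b.
  move: tt'; rewrite /ball /= distrC ltrBrDr; apply: le_lt_trans.
  by rewrite -[leLHS](congr1 Num.norm (subrK t t')) ler_normD.
move: h; rewrite ltr_pdivlMr//; apply: le_lt_trans.
by rewrite ler_wpM2l// lerDl.
Qed.

(** [p] is differentiable only at 0, so Taylor expansion is replaced by monotonicity: [p 0 = 0], and
    [d < 0] would make [p] negative to the right of 0. *)
Lemma second_der_min u x v d r : 0 < r ->
  (forall z, enorm (z - x) < r -> u x <= u z) -> second_der u x v d -> 0 <= d.
Proof.
move=> r0 umin [p [[s s0 sP] dp]].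
have v0 : 0 < enorm v + 1 by rewrite ltr_wpDl// enorm_ge0.
pose b := Num.min s (r / (enorm v + 1)).
have b0 : 0 < b by rewrite lt_min s0 divr_gt0.
have bs t : `|t| < b -> `|t| < s by rewrite lt_min => /andP[].
have um t : `|t| < b -> u x <= u (x + t *: v).
  rewrite lt_min => /andP[_]; rewrite ltr_pdivlMr// => h; apply: umin.
  rewrite addrC addKr enormZ; apply: le_lt_trans h.
  by rewrite ler_wpM2l// lerDl.
have p0 : p 0 = 0.
  have h0 : `|0 : R| < b by rewrite normr0.
  have D := sP 0 (bs 0 h0).
  have [||||] := @derive1_at_min R (fun t => u (x + t *: v)) (- b) b 0.
  - by rewrite ge0_cp// ltW.
  - move=> t; rewrite in_itv /= -ltr_norml => tb; have := sP t (bs t tb).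
    by case.
  - by rewrite in_itv /= b0 oppr_lt0 b0.
  - move=> t; rewrite in_itv /= -ltr_norml => tb.
    by rewrite scale0r addr0; exact: um.
  by move=> _ E0; case: D => _ E1; rewrite -E1 E0.
rewrite leNgt; apply/negP => d0.
have d2 : 0 < - d / 2 by rewrite divr_gt0// oppr_gt0.
have [q q0 qP] := (is_der_epsP p 0 d).1 dp _ d2.
pose t0 := Num.min (b / 2) (q / 2).
have t00 : 0 < t0 by rewrite lt_min !divr_gt0.
have t0b : t0 < b by rewrite (@le_lt_trans _ _ (b / 2)) ?ge_min ?lexx//; lra.
have t0q : t0 < q by rewrite (@le_lt_trans _ _ (q / 2)) ?ge_min ?lexx ?orbT//; lra.
have pneg t : 0 < t -> t <= t0 -> p t < 0.
  move=> tp tt; have := qP t; rewrite gtr0_norm// add0r p0 subr0.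
  move=> /(_ (le_lt_trans tt t0q)); rewrite ler_norml => /andP[_ h'].
  have : 0 < t * - d by rewrite mulr_gt0// oppr_gt0.
  lra.
(* The interval is split at [t0 / 2] because [p] vanishes at 0: the right half gives strict
   decrease, the left half only weak decrease. *)
have [|c1 /andP[c10 c1t] E1] := mvt (fun t => u (x + t *: v)) p (t0 / 2) t0 ltac:(lra).
  move=> t /andP[h1 h2]; apply: sP; apply: bs.
  by rewrite ger0_norm ?(le_lt_trans h2)//; lra.
have k1 : u (x + t0 *: v) < u (x + (t0 / 2) *: v).
  rewrite -subr_lt0 E1 nmulr_rlt0 ?pneg//; lra.
have [|c2 /andP[c20 c2t] E2] := mvt (fun t => u (x + t *: v)) p 0 (t0 / 2) ltac:(lra).
  move=> t /andP[h1 h2]; apply: sP; apply: bs.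
  by rewrite ger0_norm ?(le_lt_trans h2)//; lra.
have k2 : u (x + (t0 / 2) *: v) <= u x.
  rewrite scale0r addr0 in E2; rewrite -subr_le0 E2 subr0 mulr_le0_ge0//; last by lra.
  have [->|c2n] := eqVneq c2 0; first by rewrite p0.
  by apply/ltW/pneg; [rewrite lt_neqAle eq_sym c2n|lra].
have t0n : `|t0| < b by rewrite gtr0_norm.
have := um t0 t0n; rewrite leNgt => /negP; apply.
exact: lt_le_trans k1 k2.
Qed.

(** Having all directions at once lets the Laplacian be read in any orthonormal frame. The quadratic
    form sees only the symmetric part of [H], which carries the trace. *)
Definition has_hessian u x (H : 'M[R]_n) : Prop :=
  forall v, second_der u x v (\sum_i \sum_j v 0 i * v 0 j * H i j).

Lemma has_hessian_near u w x H r : 0 < r ->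
  (forall z, enorm (z - x) < r -> u z = w z) ->
  has_hessian u x H -> has_hessian w x H.
Proof. by move=> r0 uw Hu v; exact: (second_der_near _ _ _ _ _ _ r0 uw (Hu v)). Qed.

Lemma C2_has_hessian (A : set 'rV[R]_n) u x : nbhs x A -> C2_on A u ->
  has_hessian u x (\matrix_(i, j) partial j (partial i u) x).
Proof.
move=> nA [C1 C2] v; exists (fun t => \sum_i v 0 i * partial i u (x + t *: v)); split.
  have /nbhs_enormP[r r0 rP] : nbhs x (A^°) by exact: nbhs_interior.
  have v0 : 0 < enorm v + 1 by rewrite ltr_wpDl// enorm_ge0.
  exists (r / (enorm v + 1)); first by rewrite divr_gt0.
  move=> t; rewrite ltr_pdivlMr// => tr.
  have : A^° (x + t *: v).
    apply: rP; rewrite addrC addKr enormZ; apply: le_lt_trans tr.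
    by rewrite ler_wpM2l// lerDl.
  move=> At; apply/is_derive_line; apply: C1_derive.
    apply: (@filterS _ (nbhs (x + t *: v)) _ A) => // z /C1[_ D _]; exact: D.
  by move=> i; have [_ _ Ci] := C1 _ (nbhs_singleton At); exact: Ci.
have Ax := nbhs_singleton nA.
have dpi (i : 'I_n) : is_derive (0 : R) 1 (fun t => v 0 i * partial i u (x + t *: v))
    (v 0 i * \sum_j v 0 j * partial j (partial i u) x).
  have D : is_derive (0 : R) 1 (fun t : R => partial i u (x + t *: v))
      (\sum_j v 0 j * partial j (partial i u) x).
    apply/is_derive_line0; apply: C1_derive.
      apply: (@filterS _ (nbhs x) _ A) => // z /(C2 i)[_ D _]; exact: D.
    by move=> j; have [_ _ Cj] := C2 i x Ax; exact: Cj.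
  by der_eq; rewrite mul0r add0r.
have -> : \sum_i \sum_j v 0 i * v 0 j * (\matrix_(i, j) partial j (partial i u) x) i j =
    \sum_i v 0 i * \sum_j v 0 j * partial j (partial i u) x.
  by apply: eq_bigr => i _; rewrite mulr_sumr; apply: eq_bigr => j _; rewrite !mxE mulrA.
have -> : (fun t : R => \sum_i v 0 i * partial i u (x + t *: v)) =
    \sum_i (fun t : R => v 0 i * partial i u (x + t *: v)).
  by apply/funext => t; rewrite fct_sumE.
exact: is_derive_sum.
Qed.

Lemma trace_hessian u x :
  \tr (\matrix_(i, j) partial j (partial i u) x) = laplacian u x.
Proof. by apply: eq_bigr => i _; rewrite mxE. Qed.

(** For a unit vector [e], the reflection in the hyperplane [dot x e = mu]; [lrefl] is its linear
    part. *)
Definition refl e (mu : R) x : 'rV[R]_n := x - (2 * (dot x e - mu)) *: e.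

Definition lrefl e v : 'rV[R]_n := v - (2 * dot v e) *: e.

Lemma refl_line e mu x v t : refl e mu (x + t *: v) = refl e mu x + t *: lrefl e v.
Proof.
rewrite /refl /lrefl dotDl dotZl scalerBr scalerA.
have -> : 2 * (dot x e + t * dot v e - mu) = 2 * (dot x e - mu) + t * (2 * dot v e) by ring.
by rewrite scalerDl opprD !addrA; congr (_ - _); rewrite addrAC.
Qed.

Lemma lrefl_sym e i j : (lrefl e (delta_mx 0 i)) 0 j = (lrefl e (delta_mx 0 j)) 0 i.
Proof.
rewrite !mxE !eqxx /= !(dotC (delta_mx _ _)) !dot_delta (eq_sym j i).
by congr (_ - _); ring.
Qed.

Lemma dot_lrefl e v z : dot e e = 1 -> dot (lrefl e v) (lrefl e z) = dot v z.
Proof. by move=> e1; rewrite /lrefl !dotE e1 (dotC e z); ring. Qed.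

(** [lrefl e] is symmetric and orthogonal, so the reflected axes are again orthonormal, in rows as
    well as in columns: the trace does not depend on the frame. *)
Lemma trace_lrefl e (H : 'M[R]_n) : dot e e = 1 ->
  \sum_k \sum_i \sum_j (lrefl e (delta_mx 0 k)) 0 i * (lrefl e (delta_mx 0 k)) 0 j * H i j
  = \tr H.
Proof.
move=> e1; rewrite exchange_big; apply: eq_bigr => i _ /=.
have E j : \sum_k (lrefl e (delta_mx 0 k)) 0 i * (lrefl e (delta_mx 0 k)) 0 j * H i j =
    (delta_mx 0 i : 'rV[R]_n) 0 j * H i j.
  rewrite -mulr_suml -dot_delta -(dot_lrefl _ _ _ e1); congr (_ * _).
  by apply: eq_bigr => k _; rewrite !(lrefl_sym e k).
rewrite exchange_big /=; under eq_bigr do rewrite E.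
rewrite (bigD1 i)//= [X in _ + X]big1 ?addr0 ?mxE ?eqxx ?mul1r// => j ji.
by rewrite mxE (negbTE ji) andbF mul0r.
Qed.

Lemma trace_delta (H : 'M[R]_n) :
  \sum_k \sum_i \sum_j (delta_mx 0 k : 'rV[R]_n) 0 i * (delta_mx 0 k : 'rV[R]_n) 0 j * H i j
  = \tr H.
Proof.
apply: eq_bigr => k _; rewrite (bigD1 k)//= [X in _ + X]big1 ?addr0; last first.
  by move=> i ik; apply: big1 => j _; rewrite mxE (negbTE ik) andbF !mul0r.
rewrite (bigD1 k)//= [X in _ + X]big1 ?addr0; last first.
  by move=> i ik; rewrite [X in _ * X * _]mxE (negbTE ik) andbF mulr0 mul0r.
by rewrite mxE !eqxx !mul1r.
Qed.

Lemma second_der_refl u e mu x v d : second_der u (refl e mu x) (lrefl e v) d ->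
  second_der (fun z => u (refl e mu z)) x v d.
Proof.
move=> [p [[r r0 rP] dp]]; exists p; split => //; exists r => // t /rP.
by under [X in is_derive _ _ X _]eq_fun do rewrite -refl_line.
Qed.

(* [L] is the Laplacian in terms of second derivatives along the axes. *)
Definition axial_laplacian u x L : Prop := exists2 d : 'I_n -> R,
  forall k, second_der u x (delta_mx 0 k) (d k) & \sum_k d k = L.

Lemma axial_laplacian_hessian u x H : has_hessian u x H -> axial_laplacian u x (\tr H).
Proof.
move=> uH; exists (fun k => \sum_i \sum_j (delta_mx 0 k : 'rV[R]_n) 0 i *
  (delta_mx 0 k : 'rV[R]_n) 0 j * H i j); first by move=> k; exact: uH.
exact: trace_delta.
Qed.

Lemma axial_laplacian_refl u e mu x H : dot e e = 1 -> has_hessian u (refl e mu x) H ->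
  axial_laplacian (fun z => u (refl e mu z)) x (\tr H).
Proof.
move=> e1 uH; exists (fun k => \sum_i \sum_j (lrefl e (delta_mx 0 k)) 0 i *
  (lrefl e (delta_mx 0 k)) 0 j * H i j); last exact: trace_lrefl.
by move=> k; apply: second_der_refl; exact: uH.
Qed.

Lemma axial_laplacian_add u w x L L' : axial_laplacian u x L -> axial_laplacian w x L' ->
  axial_laplacian (fun z => u z + w z) x (L + L').
Proof.
move=> [d dP <-] [d' dP' <-]; exists (fun k => d k + d' k); last exact: big_split.
by move=> k; exact: second_der_add.
Qed.

Lemma axial_laplacian_scale u x L c : axial_laplacian u x L ->
  axial_laplacian (fun z => c * u z) x (c * L).
Proof.
move=> [d dP <-]; exists (fun k => c * d k); last by rewrite mulr_sumr.
by move=> k; exact: second_der_scale.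
Qed.

Lemma axial_laplacian_min u x L r : 0 < r ->
  (forall z, enorm (z - x) < r -> u x <= u z) -> axial_laplacian u x L -> 0 <= L.
Proof.
move=> r0 um [d dP <-]; apply: sumr_ge0 => k _; exact: second_der_min um (dP k).
Qed.

Lemma dot_delta_delta (k : 'I_n) :
  dot (delta_mx 0 k : 'rV[R]_n) (delta_mx 0 k) = 1.
Proof. by rewrite dot_delta mxE !eqxx. Qed.

Lemma axial_laplacian_slab e mu K x : dot e e = 1 ->
  axial_laplacian (fun z => 1 - K * (dot z e - mu) ^+ 2) x (- (2 * K)).
Proof.
move=> e1; exists (fun k => - (2 * K) * e 0 k ^+ 2); last first.
  rewrite -mulr_sumr (_ : \sum_i _ = 1) ?mulr1// -e1.
move=> k; exists (fun t => - (2 * K) * e 0 k * (dot x e + t * e 0 k - mu)); split.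
  exists 1; first exact: ltr01.
  move=> t _.
  have -> : (fun s : R => 1 - K * (dot (x + s *: delta_mx 0 k) e - mu) ^+ 2) =
      (fun s : R => 1 - K * (dot x e + s * e 0 k - mu) ^+ 2).
    by apply/funext => s; rewrite dotDl dotZl (dotC (delta_mx _ _)) dot_delta.
  by der_eq; ring.
by der_eq; ring.
Qed.

Lemma dot_line z v s : dot (z + s *: v) (z + s *: v) =
  dot z z + 2 * dot z v * s + dot v v * s ^+ 2.
Proof. by rewrite !dotE (dotC v z); ring. Qed.

Lemma axial_laplacian_gauss al y x :
  axial_laplacian (fun z => expR (- al * dot (z - y) (z - y))) x
    ((4 * al ^+ 2 * dot (x - y) (x - y) - 2 * al * n%:R) * expR (- al * dot (x - y) (x - y))).
Proof.
set s0 := dot (x - y) (x - y).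
exists (fun k => (4 * al ^+ 2 * (x - y) 0 k ^+ 2 - 2 * al) * expR (- al * s0)); last first.
  rewrite -mulr_suml big_split /= -mulr_sumr sumrN sumr_const card_ord.
  by rewrite -[2 * al *+ n]mulr_natr.
move=> k; set b := (x - y) 0 k.
exists (fun t => - al * (2 * b + 2 * t) * expR (- al * (s0 + 2 * b * t + t ^+ 2))); split.
  exists 1 => // t _.
  have -> : (fun s : R => expR (- al * dot (x + s *: delta_mx 0 k - y) (x + s *: delta_mx 0 k - y)))
      = (fun s : R => expR (- al * (s0 + 2 * b * s + s ^+ 2))).
    apply/funext => s; congr (expR (_ * _)).
    by rewrite addrAC dot_line dot_delta dot_delta_delta mul1r.
  by der_eq; ring.
by der_eq; rewrite !mulr0 !expr0n /= !addr0; ring.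
Qed.

End second_derivatives.

(** * Strong positivity for superharmonic functions *)

Section hopf.
Context {R : realType} {n : nat}.
Implicit Types (x y z v e : 'rV[R]_n) (u w : 'rV[R]_n -> R) (c r s t d : R).

(* Hopf's barrier: a nonnegative superharmonic function which is positive at
   [y] is positive on the ball around [y] of half the radius. *)
Lemma hopf_positive w x y s : 0 < s -> enorm (x - y) = s -> continuous w ->
  (forall z, enorm (z - y) <= 2 * s -> 0 <= w z) ->
  (forall z, enorm (z - y) < 2 * s -> exists2 L, axial_laplacian w z L & L <= 0) ->
  0 < w y -> (0 < n)%N -> 0 < w x.
Proof.
move=> s0 xy cw w0 Lw wy n0; rewrite lt_neqAle w0 ?andbT; last by rewrite xy; lra.
apply/eqP => wx.
have [q [q0 qs qP]] : exists q, [/\ 0 < q, q <= s & forall z, enorm (z - y) < q -> w y / 2 <= w z].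
  have /continuous_enormP /(_ (w y / 2) ltac:(lra)) [r r0 rP] := cw y.
  exists (Num.min r s); split; first by rewrite lt_min r0.
    by rewrite ge_min lexx orbT.
  move=> z; rewrite lt_min => /andP[/rP + _]; rewrite ler_norml => /andP[? _]; lra.
(* The Gaussian has Laplacian (4 al^2 |z - y|^2 - 2 al n) times itself; this [al] makes it positive
   wherever |z - y| >= q. *)
pose al := n%:R / (q / 2) ^+ 2.
have nR : 0 < (n%:R : R) by rewrite ltr0n.
have q2 : 0 < (q / 2) ^+ 2 by rewrite exprn_gt0//; lra.
have al0 : 0 < al by rewrite divr_gt0.
have alq : al * (q / 2) ^+ 2 = n%:R by rewrite /al divfK// gt_eqF.
(* The subtracted constant makes the barrier vanish on the sphere of radius [2 * s]. *)
pose bar z := expR (- al * dot (z - y) (z - y)) - expR (- al * (2 * s) ^+ 2).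
(* As [bar <= 1], [ep * bar] stays below [w] on the small ball around [y]. A negative minimum of
   [w - ep * bar] can then occur neither there nor on the outer sphere. *)
pose ep := w y / 2; have ep0 : 0 < ep by rewrite /ep; lra.
pose Phi z := w z + - ep * bar z.
have dE z : dot (z - y) (z - y) = enorm (z - y) ^+ 2 by rewrite enorm2.
have bar_dec z r : 0 <= r ->
    (enorm (z - y) < r -> expR (- al * r ^+ 2) < expR (- al * dot (z - y) (z - y))).
  move=> r0 zr; rewrite ltr_expR !mulNr ltrN2 ltr_pM2l// dE ltr_pXn2r ?nnegrE ?enorm_ge0//.
have cdot : continuous (fun z => dot (z - y) (z - y)).
  have -> : (fun z => dot (z - y) (z - y)) = (fun z => enorm (z - y) * enorm (z - y)).
    by apply/funext => z; rewrite dE expr2.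
  by move=> z; exact: (cvgM (continuous_enorm_sub y z) (continuous_enorm_sub y z)).
have cPhi : continuous Phi.
  apply: continuous_addf => //; apply: continuous_mulf; first exact: continuous_cstf.
  apply: continuous_addf; last exact: continuous_cstf.
  apply: continuous_compf; first exact: continuous_expR.
  by apply: continuous_mulf; [exact: continuous_cstf|exact: cdot].
pose D := [set z | enorm (z - y) <= 2 * s].
have Dx : D x by rewrite /D /= xy; lra.
have cD : compact D.
  apply: (compact_enorm D (enorm y + 2 * s)).
    exact: (closed_le_fun _ _ (continuous_enorm_sub y)).
  move=> z zD; rewrite -[z](subrK y) (le_trans (enormD _ _))// addrC lerD2l.
  exact: zD.
have [xm Dxm min] := attains_min Phi D (ex_intro _ x Dx) cD cPhi.
have Phix : Phi x < 0.
  rewrite /Phi -wx add0r mulNr oppr_lt0 mulr_gt0// /bar subr_gt0.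
  by apply: bar_dec; rewrite ?xy; lra.
have Pm : Phi xm < 0 by exact: le_lt_trans (min x Dx) Phix.
have far : q <= enorm (xm - y).
  rewrite leNgt; apply/negP => /qP h; move: Pm; rewrite /Phi ltNge => /negP; apply.
  have b1 : bar xm <= 1.
    have : expR (- al * dot (xm - y) (xm - y)) <= 1.
      by rewrite -expR0 ler_expR mulNr oppr_le0 mulr_ge0 ?dot_ge0// ltW.
    by have := expR_ge0 (- al * (2 * s) ^+ 2); rewrite /bar; lra.
  have : 0 <= ep * (1 - bar xm) by rewrite mulr_ge0 ?(ltW ep0)// subr_ge0.
  by rewrite /ep in h *; lra.
have inside : enorm (xm - y) < 2 * s.
  rewrite lt_neqAle (Dxm : enorm (xm - y) <= 2 * s) andbT; apply/eqP => h.
  move: Pm; rewrite /Phi /bar dE h subrr mulr0 addr0 ltNge w0//.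
have [L LP L0] := Lw xm inside.
have LG := axial_laplacian_gauss al y xm.
set G := (_ * _) in LG.
have G0 : 0 < G.
  rewrite /G mulr_gt0 ?expR_gt0// subr_gt0 dE.
  have : (q / 2) ^+ 2 < enorm (xm - y) ^+ 2.
    by rewrite ltr_pXn2r ?nnegrE ?enorm_ge0//; lra.
  move=> h; have P : 0 < 2 * (enorm (xm - y) ^+ 2 - (q / 2) ^+ 2) + (q / 2) ^+ 2 by lra.
  have two : 0 < (2 : R) by [].
  have := mulr_gt0 (mulr_gt0 two al0) (mulr_gt0 al0 P).
  rewrite -alq; lra.
have LPhi := axial_laplacian_add w (fun z => - ep * bar z) xm L (- ep * (G + 0)) LP.
have {}LPhi : axial_laplacian Phi xm (L - ep * G).
  have -> : L - ep * G = L + - ep * G by rewrite mulNr.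
  rewrite addr0 in LPhi; apply: LPhi; apply: axial_laplacian_scale.
  have [d dP <-] := LG; exists d => // k; have [p [[r r0 rP] dp]] := dP k.
  exists p; split; last exact: dp.
  exists r; first exact: r0.
  by move=> t /rP ?; rewrite /bar; der_eq; rewrite addr0.
have := axial_laplacian_min Phi xm _ (2 * s - enorm (xm - y)) ltac:(lra) _ LPhi.
have loc z : enorm (z - xm) < 2 * s - enorm (xm - y) -> Phi xm <= Phi z.
  move=> h; apply: min; rewrite /D /=.
  have -> : z - y = (z - xm) + (xm - y) by rewrite addrA subrK.
  by rewrite (le_trans (enormD _ _))//; lra.
move=> /(_ loc); have : 0 < ep * G by rewrite mulr_gt0.
lra.
Qed.

End hopf.

(** * Metric properties of reflections *)

Section reflections.
Context {R : realType} {n : nat}.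
Implicit Types (x y z v e : 'rV[R]_n) (c r s t d mu : R).

Lemma refl_enorm2 e mu x : dot e e = 1 ->
  enorm (refl e mu x) ^+ 2 = enorm x ^+ 2 - 4 * mu * (dot x e - mu).
Proof. by move=> e1; rewrite !enorm2 /refl !dotE e1 (dotC e x); ring. Qed.

Lemma refl_enorm_lt e mu x : dot e e = 1 -> 0 < mu -> mu < dot x e ->
  enorm (refl e mu x) < enorm x.
Proof.
move=> e1 mu0 h; rewrite -ltr_sqr ?nnegrE ?enorm_ge0// refl_enorm2//.
by rewrite ltrBlDr ltrDl !mulr_gt0// subr_gt0.
Qed.

Lemma enorm_unit e : dot e e = 1 -> enorm e = 1.
Proof. by move=> e1; rewrite enormE e1 sqrtr1. Qed.

Lemma dot_le_enorm e x : dot e e = 1 -> dot x e <= enorm x.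
Proof.
move=> e1; have := cauchy_schwarz x e; rewrite (enorm_unit _ e1) mulr1.
exact: le_trans (ler_norm _).
Qed.

Lemma refl_fixed e mu x : dot x e = mu -> refl e mu x = x.
Proof. by move=> <-; rewrite /refl subrr mulr0 scale0r subr0. Qed.

Lemma refl_dist e mu mu' x y : dot e e = 1 ->
  enorm (refl e mu x - refl e mu' y) <= 3 * enorm (x - y) + 2 * `|mu - mu'|.
Proof.
move=> e1.
have -> : refl e mu x - refl e mu' y =
    (x - y) + ((- 2 * dot (x - y) e) *: e + (2 * (mu - mu')) *: e).
  rewrite /refl dotDl dotNl -scalerDl opprD opprK addrACA; congr (_ + _).
  by rewrite -scaleNr -scalerDl; congr (_ *: _); ring.
have h := cauchy_schwarz (x - y) e; rewrite (enorm_unit _ e1) mulr1 in h.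
apply: le_trans (enormD _ _) _.
have := enormD ((- 2 * dot (x - y) e) *: e) ((2 * (mu - mu')) *: e).
rewrite !enormZ (enorm_unit _ e1) !mulr1 !normrM normrN normr_nat; lra.
Qed.

End reflections.

(** * The moving plane method for a function with a plateau *)

Section moving_plane.
Context {R : realType} {n : nat}.
Variables (h : 'rV[R]_n -> R) (F : R -> R) (K M a : R) (e : 'rV[R]_n).
Hypothesis n0 : (0 < n)%N.
Hypothesis e1 : dot e e = 1.
Hypothesis ch : continuous h.
Hypothesis hout : forall x, 1 <= enorm x -> h x = 0.
Hypothesis hin : forall x, enorm x < 1 -> 0 < h x.
Hypothesis a0 : 0 < a.
Hypothesis haM : forall x, a <= enorm x -> h x < M.
Hypothesis K0 : 0 < K.
Hypothesis Flip : forall u v, v <= u -> u <= M -> 0 <= F u - F v <= K * (u - v).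
Hypothesis hpde : forall x, enorm x < 1 -> h x < M ->
  exists2 H, has_hessian h x H & \tr H = - F (h x).
Implicit Types (x y z v : 'rV[R]_n) (c r s t d mu : R).

(** Written with [- 1 *] to match the sum and scaling rules for [axial_laplacian] literally. *)
Let w mu x := h (refl e mu x) + - 1 * h x.

Let bad mu x := mu < dot x e /\ w mu x < 0.

Let h_ge0 x : 0 <= h x.
Proof. by have [/hout->|/hin/ltW] := leP 1 (enorm x). Qed.

Let bad_in mu x : bad mu x -> enorm x < 1.
Proof.
move=> [_ wx]; rewrite ltNge; apply/negP => /hout hx.
by have := h_ge0 (refl e mu x); move: wx; rewrite /w hx mulr0 addr0; lra.
Qed.

Let right_lt mu x : a <= mu -> mu < dot x e -> h x < M.
Proof.
move=> amu mux; apply: haM; have := dot_le_enorm e x e1; lra.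
Qed.

Let cont_w_joint mu x c : 0 < c -> exists2 r, 0 < r &
  forall mu' z, `|mu' - mu| < r -> enorm (z - x) < r -> `|w mu' z - w mu x| <= c.
Proof.
move=> c0; have c2 : 0 < c / 2 by lra.
have /continuous_enormP /(_ _ c2) [r1 r10 P1] := ch x.
have /continuous_enormP /(_ _ c2) [r2 r20 P2] := ch (refl e mu x).
exists (Num.min r1 (r2 / 5)); first by rewrite lt_min r10 divr_gt0.
move=> mu' z; rewrite !lt_min => /andP[_ m2] /andP[/P1 z1 z2].
have := P2 (refl e mu' z).
have := refl_dist e mu' mu z x e1 => hd; move=> /(_ ltac:(lra)).
by move: z1; rewrite /w !ler_norml => /andP[? ?] /andP[? ?]; apply/andP; split; lra.
Qed.

Let cont_w mu : continuous (w mu).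
Proof.
move=> x; apply/continuous_enormP => c /(cont_w_joint mu x) [r r0 rP].
by exists r => // z; apply: rP; rewrite subrr normr0.
Qed.

(** Needs the equation at both points. Beyond the plane [a <= mu] keeps [h] below [M]; at the
    reflected point this is automatic wherever [w mu x <= 0]. Where [w] is nonnegative, monotonicity
    of [F] makes the value nonpositive. *)
Let superharmonic mu x : a <= mu -> mu < dot x e -> enorm x < 1 -> h (refl e mu x) < M ->
  axial_laplacian (w mu) x (- F (h (refl e mu x)) + - 1 * - F (h x)).
Proof.
move=> amu mux x1 hM.
have xr1 : enorm (refl e mu x) < 1.
  by apply: lt_trans (refl_enorm_lt e mu x e1 _ mux) x1; exact: lt_le_trans a0 amu.
have [H1 HH1 <-] := hpde x x1 (right_lt mu x amu mux).
have [H2 HH2 <-] := hpde _ xr1 hM.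
apply: axial_laplacian_add.
  exact: axial_laplacian_refl.
by apply: axial_laplacian_scale; exact: axial_laplacian_hessian.
Qed.

(* Above the critical position the reflected function strictly dominates off
   the plane. *)
Let strict mu : a <= mu -> (forall x, mu < dot x e -> 0 <= w mu x) ->
  forall x, mu < dot x e -> enorm x <= 1 -> 0 < w mu x.
Proof.
move=> amu wpos x mux x1; rewrite lt_neqAle wpos ?andbT//; apply/eqP => wx.
have mu0 : 0 < mu := lt_le_trans a0 amu.
(* The last zero [xs] of [w] on the ray from [x] in direction [e]: just beyond it [w] is positive,
   which gives Hopf's lemma a centre [y] to start from. *)
pose A := [set t : R | 0 <= t /\ enorm (x + t *: e) <= 1 /\ w mu (x + t *: e) = 0].
have A0 : A 0 by rewrite /A /= scale0r addr0; split.
have d_line t : dot (x + t *: e) e = dot x e + t by rewrite dotDl dotZl e1 mulr1.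
have Aub t : A t -> t <= 1.
  move=> [_ [t1 _]]; have := dot_le_enorm e (x + t *: e) e1; rewrite d_line; lra.
have hA : has_sup A by split; [exists 0|exists 1 => t /Aub].
pose T := sup A.
have T0 : 0 <= T by apply: sup_upper_bound.
pose xs := x + T *: e.
have near_T c : 0 < c -> exists2 t, A t & enorm (x + t *: e - xs) < c.
  move=> c0; have [t At Tt] : exists2 t, A t & T - c < t by exact: sup_adherent.
  exists t => //; have tT : t <= T by apply: sup_upper_bound.
  rewrite /xs opprD addrACA subrr add0r -scalerBl enormZ (enorm_unit _ e1) mulr1.
  by rewrite ler0_norm; lra.
have xs1 : enorm xs <= 1.
  apply/ler_addgt0Pr => c c0; have [t [_ [t1 _]] tc] := near_T c c0.
  have := enorm_dist xs (x + t *: e); rewrite enorm_distC ler_norml => /andP[_ ?]; lra.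
have wxs : w mu xs = 0.
  have muxs : mu < dot xs e by rewrite d_line; lra.
  apply/eqP; rewrite eq_le wpos// andbT; apply/ler_addgt0Pr => c c0.
  have [r r0 rP] := cont_w_joint mu xs c c0.
  have [t [_ [_ wt]] tr] := near_T r r0.
  have := rP mu (x + t *: e); rewrite subrr normr0 wt sub0r => /(_ r0 tr).
  by rewrite normrN ler_norml => /andP[_ ?]; lra.
have muxs : mu < dot xs e by rewrite d_line; lra.
have xs1' : enorm xs < 1.
  (* On the unit sphere [h] vanishes while the reflected point is strictly inside, so [w] cannot be
     zero there. *)
  rewrite lt_neqAle xs1 andbT; apply/eqP => E.
  have rlt := refl_enorm_lt e mu xs e1 mu0 muxs.
  have := hin (refl e mu xs) ltac:(lra).
  by move: wxs; rewrite /w (hout xs) ?E//; lra.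
have hxs := right_lt mu xs amu muxs.
have hrxs : h (refl e mu xs) < M by move: wxs; rewrite /w; lra.
have [r [r0 rP]] : exists r, 0 < r /\ forall z, enorm (z - xs) < r ->
    [/\ mu < dot z e, enorm z < 1 & h (refl e mu z) < M].
  have c1 : 0 < (M - h (refl e mu xs)) / 2 by lra.
  have [r1 r10 P1] := cont_w_joint mu xs _ c1.
  have /continuous_enormP /(_ _ c1) [r2 r20 P2] := ch (refl e mu xs).
  exists (Num.min (r2 / 3) (Num.min (dot xs e - mu) (1 - enorm xs))); split.
    by rewrite !lt_min divr_gt0//= !subr_gt0 muxs.
  move=> z; rewrite !lt_min => /and3P[z1 z2 z3]; split.
  - have := dot_le_enorm e (xs - z) e1; rewrite enorm_distC dotDl dotNl; lra.
  - have := enorm_dist z xs; rewrite ler_norml => /andP[_ ?]; lra.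
  - have hd := refl_dist e mu mu z xs e1; rewrite subrr normr0 mulr0 addr0 in hd.
    have := P2 (refl e mu z) ltac:(lra); rewrite ler_norml => /andP[_ ?]; lra.
(* The ball of radius [2 * s] around [y], which is at distance [s] from [xs], lies within distance 3
   r / 4 of [xs]. *)
pose s := r / 4; have s0 : 0 < s by rewrite /s; lra.
pose y := xs + s *: e.
have yx : enorm (y - xs) = s.
  by rewrite /y addrC addKr enormZ (enorm_unit _ e1) mulr1 gtr0_norm.
have inball z : enorm (z - y) <= 2 * s -> enorm (z - xs) < r.
  move=> zy; have -> : z - xs = (z - y) + (y - xs) by rewrite addrA subrK.
  by apply: le_lt_trans (enormD _ _) _; rewrite yx /s in zy *; lra.
have yP := rP y ltac:(rewrite yx /s; lra).
have wy : 0 < w mu y.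
  have [m1 m2 _] := yP; rewrite lt_neqAle wpos// andbT; apply/eqP => E.
  have : T + s <= T.
    apply: sup_upper_bound => //; split; first by lra.
    by rewrite scalerDl addrA -/xs -/y; split; [exact: ltW|].
  by lra.
suff : 0 < w mu xs by rewrite wxs ltxx.
apply: (hopf_positive (w mu) xs y s s0 _ (cont_w mu) _ _ wy n0).
- by rewrite enorm_distC.
- by move=> z /inball /rP[m1 _ _]; exact: wpos.
- move=> z /ltW /inball /rP[m1 m2 m3]; have L := superharmonic mu z amu m1 m2 m3.
  exists (- F (h (refl e mu z)) + - 1 * - F (h z)) => //.
  have wz := wpos z m1.
  have := Flip (h (refl e mu z)) (h z) ltac:(rewrite /w in wz; lra) (ltW m3).
  by move=> /andP[? _]; lra.
Qed.

(* Maximum principle in narrow slabs, with the barrier 1 - K (x.e - mu)^2. *)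
Let narrow mu d : a <= mu -> 0 < d -> K * d ^+ 2 <= 1 / 2 ->
  (forall x, bad mu x -> dot x e < mu + d) -> forall x, ~ bad mu x.
Proof.
have hK := K0; move=> amu d0 Kd badd x1 bx1.
have mu0 : 0 < mu := lt_le_trans a0 amu.
pose g x := 1 - K * (dot x e - mu) ^+ 2.
pose D := [set x | enorm x <= 1] `&` ([set x | mu <= dot x e] `&` [set x | dot x e <= mu + d]).
have gD x : D x -> 1 / 2 <= g x.
  move=> [_ [/= m1 m2]]; rewrite /g.
  have : (dot x e - mu) ^+ 2 <= d ^+ 2 by rewrite ler_pXn2r ?nnegrE//; lra.
  move=> /(ler_wpM2l (ltW K0)); lra.
have cg : continuous g.
  have -> : g = (fun x => 1 + - K * ((dot x e - mu) * (dot x e - mu))).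
    by apply/funext => z; rewrite /g expr2 mulNr.
  have cd : continuous (fun z => dot z e - mu).
    by apply: continuous_addf; [exact: continuous_dot|exact: continuous_cstf].
  apply: continuous_addf; first exact: continuous_cstf.
  by apply: continuous_mulf; [exact: continuous_cstf|exact: continuous_mulf].
have cD : compact D.
  apply: (compact_enorm D 1); last by move=> x [].
  apply: closedI; first exact: (closed_le_fun _ _ continuous_enorm).
  by apply: closedI; [exact: (closed_ge_fun _ _ (continuous_dot e))|
    exact: (closed_le_fun _ _ (continuous_dot e))].
have Dbad x : bad mu x -> D x.
  by move=> bx; have := bad_in mu x bx; have := badd x bx;
    case: bx; rewrite /D /=; split; [exact: ltW|split; exact: ltW].
(* Agrees with [g] on [D] and is positive everywhere, so the quotient is continuous on the whole
   space. *)
pose cl x := Num.max (g x) (1 / 2).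
have cl0 x : 0 < cl x by rewrite lt_max; apply/orP; right; lra.
have clD x : D x -> cl x = g x by move=> Dx; rewrite /cl; apply/max_idPl/gD.
have ccl : continuous cl by move=> x; apply: continuous_max; [exact: cg|exact: cst_continuous].
pose q x := w mu x / cl x.
have cq : continuous q.
  apply: continuous_mulf; first exact: cont_w.
  by move=> x; exact: (cvgV (lt0r_neq0 (cl0 x)) (ccl x)).
have [xm Dxm min] := attains_min q D (ex_intro _ x1 (Dbad x1 bx1)) cD cq.
set m := q xm in min.
have m0 : m < 0.
  apply: le_lt_trans (min x1 (Dbad x1 bx1)) _.
  by rewrite /q pmulr_llt0 ?invr_gt0//; case: bx1.
have wm : w mu xm = m * g xm by rewrite /m /q (clD _ Dxm) divfK// gt_eqF// -(clD _ Dxm).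
have gm := gD xm Dxm.
have wm0 : w mu xm < 0 by rewrite wm nmulr_rlt0//; lra.
have muxm : mu < dot xm e.
  have [_ [/= m1 _]] := Dxm; rewrite lt_neqAle m1 andbT; apply/eqP => E.
  by move: wm0; rewrite /w refl_fixed// mulN1r subrr ltxx.
have bxm : bad mu xm by [].
have xm1 := bad_in mu xm bxm; have xmd := badd xm bxm.
have hrM : h (refl e mu xm) < M.
  by have := right_lt mu xm amu muxm; move: wm0; rewrite /w; lra.
pose r := Num.min (dot xm e - mu) (Num.min (mu + d - dot xm e) (1 - enorm xm)).
have r0 : 0 < r by rewrite !lt_min !subr_gt0 muxm xmd.
have loc z : enorm (z - xm) < r -> w mu xm + - m * g xm <= w mu z + - m * g z.
  rewrite !lt_min => /and3P[z1 z2 z3].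
  have Dz : D z.
    have := dot_le_enorm e (xm - z) e1; have := dot_le_enorm e (z - xm) e1.
    rewrite (enorm_distC xm) !dotDl !dotNl => ? ?.
    have := enorm_dist z xm; rewrite ler_norml => /andP[_ ?].
    by split; [|split] => /=; lra.
  have := min z Dz; rewrite /q (clD _ Dz) ler_pdivlMr; last by have := gD z Dz; lra.
  by rewrite wm; lra.
have L1 := superharmonic mu xm amu muxm xm1 hrM.
have L2 := axial_laplacian_slab e mu K xm e1.
(* [w - m g] has a local minimum at [xm]. Its Laplacian there is at most K m (2 - g), which is
   negative since [m < 0] and [g <= 1]. *)
have L3 := axial_laplacian_add _ _ _ _ _ L1 (axial_laplacian_scale _ _ _ (- m) L2).
have := axial_laplacian_min _ _ _ r r0 loc L3.
have hle : h (refl e mu xm) <= h xm by move: wm0; rewrite /w; lra.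
have /andP[_ F2] := Flip (h xm) (h (refl e mu xm)) hle (ltW (right_lt mu xm amu muxm)).
have g1 : g xm <= 1 by rewrite /g gerBl mulr_ge0 ?sqr_ge0// ltW.
have E : K * (h xm - h (refl e mu xm)) = - (K * m * g xm).
  by rewrite -mulrA -wm /w; ring.
rewrite E in F2.
have : 0 < K * - m * (2 - g xm) by rewrite !mulr_gt0 ?oppr_gt0//; lra.
lra.
Qed.

(** At the supremum [m0] of the positions with a bad point, continuity excludes bad points and
    [strict] gives positivity. Compactness keeps this for slightly smaller positions away from the
    plane, and the narrow slab left over is handled by [narrow]. *)
Lemma moving_plane mu x : a <= mu -> mu < dot x e -> h x <= h (refl e mu x).
Proof.
have hK := K0; move=> amu mux; rewrite leNgt; apply/negP => hx.
have bx : bad mu x by split => //; rewrite /w; lra.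
pose S := [set m : R | a <= m /\ exists z, bad m z].
have Smu : S mu by split => //; exists x.
have Sub m : S m -> m <= 1.
  move=> [_ [z bz]]; have := bad_in m z bz; have := dot_le_enorm e z e1.
  by case: bz; lra.
have hS : has_sup S by split; [exists mu|exists 1 => m /Sub].
pose m0 := sup S.
have am0 : a <= m0 by apply: le_trans amu _; apply: sup_upper_bound.
have wpos z : m0 < dot z e -> 0 <= w m0 z.
  move=> mz; rewrite leNgt; apply/negP => wz.
  have [r r0 rP] := cont_w_joint m0 z (- w m0 z / 2) ltac:(lra).
  pose m1 := m0 + Num.min (r / 2) ((dot z e - m0) / 2).
  have q0 : 0 < Num.min (r / 2) ((dot z e - m0) / 2) by rewrite lt_min; apply/andP; split; lra.
  have q1 : Num.min (r / 2) ((dot z e - m0) / 2) <= r / 2 by rewrite ge_min lexx.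
  have q2 : Num.min (r / 2) ((dot z e - m0) / 2) <= (dot z e - m0) / 2.
    by rewrite ge_min lexx orbT.
  have : m1 <= m0.
    apply: sup_upper_bound => //; split; first by rewrite /m1; lra.
    exists z; split; first by rewrite /m1; lra.
    have := rP m1 z; rewrite subrr enorm0 /m1 [m0 + _]addrC addrK gtr0_norm//.
    by move=> /(_ ltac:(lra) r0); rewrite ler_norml => /andP[_ ?]; lra.
  by rewrite /m1; lra.
have wstrict := strict m0 am0 wpos.
pose d := 1 / (2 * K + 2).
have d0 : 0 < d by rewrite divr_gt0//; lra.
have Kd : K * d ^+ 2 <= 1 / 2.
  have d1 : d <= 1 by rewrite ler_pdivrMr; lra.
  have d2 : 2 * (K * d) <= 1.
    by rewrite /d mulrA mulrA mulr1 ler_pdivrMr; lra.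
  have : K * d * d <= K * d by rewrite ler_piMr// mulr_ge0// ltW.
  have -> : K * d ^+ 2 = K * d * d by rewrite expr2 [LHS]mulrA.
  move=> /le_trans; apply.
  by rewrite ler_pdivlMr// mulrC.
(* A position [m1] above [m0 - d / 2] has [m1 + d] above [m0 + d / 2], so its bad points outside the
   slab of width [d] would lie in [C]. *)
pose C := [set z | enorm z <= 1] `&` [set z | m0 + d / 2 <= dot z e].
have cC : compact C.
  apply: (compact_enorm C 1); last by move=> z [].
  apply: closedI; first exact: (closed_le_fun _ _ continuous_enorm).
  exact: (closed_ge_fun _ _ (continuous_dot e)).
have /nbhs_ballP[ep /= ep0 epP] : \forall m \near m0, C `<=` (fun z => 0 < w m z).
  have /compact_near_coveringP cov := cC.
  apply: (cov R (nbhs m0) (fun m z => 0 < w m z)) => z [/= z1 z2].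
  have wz : 0 < w m0 z by apply: wstrict => //; lra.
  have [r r0 rP] := cont_w_joint m0 z (w m0 z / 2) ltac:(lra).
  exists ([set z' | enorm (z' - z) < r], ball m0 r) => /=.
    split; last exact: nbhsx_ballx.
    by apply/nbhs_enormP; exists r.
  move=> [z' m'] [/= h1 h2].
  have := rP m' z'; rewrite distrC => /(_ h2 h1); rewrite ler_norml => /andP[? _]; lra.
have [m1 Sm1 m1m0] : exists2 m, S m & m0 - Num.min ep (d / 2) < m.
  by apply: sup_adherent => //; rewrite lt_min ep0; lra.
have m1le : m1 <= m0 by apply: sup_upper_bound.
have [am1 [z bz]] := Sm1.
have q1 : Num.min ep (d / 2) <= ep by rewrite ge_min lexx.
have q2 : Num.min ep (d / 2) <= d / 2 by rewrite ge_min lexx orbT.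
apply: (narrow m1 d am1 d0 Kd _ z bz) => y by_.
rewrite ltNge; apply/negP => dy.
have : C y by split => /=; [exact: ltW (bad_in m1 y by_)|lra].
have bm1 : ball m0 ep m1 by rewrite /ball /= ger0_norm; lra.
move=> /(epP m1 bm1); case: by_ => _; lra.
Qed.

End moving_plane.

(** * Radial symmetry of solutions that blow up at the origin *)

Section radial_symmetry.
Context {R : realType} {n : nat}.
Variables (lambda : R) (u : 'rV[R]_n -> R).
Hypothesis n0 : (0 < n)%N.
Hypothesis l0 : 0 < lambda.
Hypothesis su : is_solution lambda u.
Hypothesis blowup : forall C : R, exists2 r, 0 < r &
  forall x, x != 0 -> enorm x < r -> C < u x.
Implicit Types (x y z v e : 'rV[R]_n) (c r s t d mu a M : R).

Lemma nbhs_punctured_ball x : punctured_ball x -> nbhs x punctured_ball.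
Proof.
move=> [x1 /eqP x0]; apply/nbhs_enormP.
have xp : 0 < enorm x by rewrite enorm_gt0.
exists (Num.min (1 - enorm x) (enorm x)); first by rewrite lt_min subr_gt0 x1.
move=> z; rewrite lt_min => /andP[z1 z2].
have := enorm_dist z x; rewrite ler_norml => /andP[h1 h2]; split; first by lra.
by apply/eqP; rewrite -enorm_gt0; lra.
Qed.

Lemma solution_hessian x : punctured_ball x ->
  exists2 H, has_hessian u x H & \tr H = - (lambda * nonlin 0 (u x)).
Proof.
move=> xP; have [C2 _ E _] := su.
exists (\matrix_(i, j) partial j (partial i u) x).
  exact: C2_has_hessian (nbhs_punctured_ball x xP) C2.
by rewrite trace_hessian -[LHS]opprK E// /nonlin mulr0 subr0.
Qed.

Lemma solution_continuous x : punctured_ball x -> {for x, continuous u}.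
Proof. by have [[C1 _] _ _ _] := su; move=> /C1[]. Qed.

Lemma annulus_compact r : compact [set x : 'rV[R]_n | enorm x <= 1 /\ r <= enorm x].
Proof.
apply: (compact_enorm _ 1); last by move=> x [].
apply: (@closedI _ [set x | enorm x <= 1] [set x | r <= enorm x]).
  exact: (closed_le_fun _ _ continuous_enorm).
exact: (closed_ge_fun _ _ continuous_enorm).
Qed.

Lemma annulus_within r : 0 < r ->
  {within [set x : 'rV[R]_n | enorm x <= 1 /\ r <= enorm x], continuous u}.
Proof.
move=> r0; have [_ C _ _] := su; apply: continuous_subspaceW C => x [/= x1 xr].
by split => // x0; move: xr; rewrite x0 enorm0 leNgt r0.
Qed.

Lemma no_local_min x r : punctured_ball x -> 0 < r ->
  (forall z, enorm (z - x) < r -> u x <= u z) -> False.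
Proof.
move=> xP r0 um; have [H HH E] := solution_hessian x xP.
have := axial_laplacian_min u x _ r r0 um (axial_laplacian_hessian u x H HH).
by rewrite E oppr_ge0 leNgt mulr_gt0 ?nonlin_gt0.
Qed.

(** A solution of this equation is strictly superharmonic and has no interior local minimum. Blow-up
    keeps values positive near 0, so a nonpositive minimum over an annulus would be one. *)
Lemma solution_gt0 x : punctured_ball x -> 0 < u x.
Proof.
move=> xP; rewrite ltNge; apply/negP => ux.
have [r r0 rP] := blowup 0.
have xr : r <= enorm x.
  rewrite leNgt; apply/negP => xr; have [_ /eqP xn] := xP.
  by have := rP x xn xr; rewrite ltNge ux.
pose A := [set x : 'rV[R]_n | enorm x <= 1 /\ r <= enorm x].
have Ax : A x by split; [exact: ltW (proj1 xP)|].
have [xm] := EVT_min_rV (ex_intro _ x Ax) (annulus_compact r) (annulus_within r r0).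
rewrite inE => -[xm1 xmr] min.
have {}min z : A z -> u xm <= u z by move=> Az; apply: min; rewrite inE.
have umx : u xm <= u x by exact: min.
(* a global minimiser over the closed annulus inside the open ball *)
have [y [yP yr uy ymin]] : exists y, [/\ punctured_ball y, r <= enorm y,
    u y <= 0 & forall z, A z -> u y <= u z].
  have := xm1; rewrite le_eqVlt => /predU1P[E|xm1'].
    have u0 : u xm = 0 by have [_ _ _ ->] := su.
    have ux0 : u x = 0 by apply/eqP; rewrite eq_le ux -u0 umx.
    by exists x; split => // z /min; rewrite u0 ux0.
  exists xm; split => //; last exact: le_trans ux.
  by split => //; apply/eqP; rewrite -enorm_gt0 (lt_le_trans r0).
have [y1 /eqP yn] := yP.
have y0 : 0 < enorm y by rewrite enorm_gt0.
apply: (no_local_min y (Num.min (1 - enorm y) (enorm y)) yP).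
  by rewrite lt_min subr_gt0 y1.
move=> z; rewrite lt_min => /andP[z1 z2].
have := enorm_dist z y; rewrite ler_norml => /andP[h1 h2].
have [rz|zr] := leP r (enorm z); first by apply: ymin; split => //; lra.
have zn : z != 0 by rewrite -enorm_gt0; lra.
by rewrite (le_trans uy)// ltW// rP.
Qed.

Lemma solution_bounded a : 0 < a -> exists2 M, 0 < M &
  forall x, a <= enorm x -> enorm x <= 1 -> u x < M.
Proof.
move=> a0; pose A := [set x : 'rV[R]_n | enorm x <= 1 /\ a <= enorm x].
have [A0|nA] := pselect (A !=set0); last first.
  by exists 1 => // x ax x1; exfalso; apply: nA; exists x.
have [xm _ max] := EVT_max_rV A0 (annulus_compact a) (annulus_within a a0).
exists (Num.max 0 (u xm) + 1); first by rewrite ltr_wpDl// le_max lexx.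
move=> x ax x1; apply: (@le_lt_trans _ _ (u xm)).
  by apply: max; rewrite inE.
by rewrite (@le_lt_trans _ _ (Num.max 0 (u xm))) ?ltrDl// le_max lexx orbT.
Qed.

(** The value [M] at 0 continues the plateau produced by blow-up, and 0 outside the ball continues
    the boundary value: for [M > 0] the result is continuous on the whole space. *)
Definition truncation M x : R :=
  if enorm x < 1 then (if x == 0 then M else Num.min (u x) M) else 0.

Lemma truncation_in M x : punctured_ball x -> truncation M x = Num.min (u x) M.
Proof. by move=> [x1 /eqP/negbTE x0]; rewrite /truncation x1 x0. Qed.

Lemma truncation_continuous M : 0 < M -> continuous (truncation M).
Proof.
move=> M0 x; apply/continuous_enormP => c c0.
have [x1|x1] := ltP (enorm x) 1.
  have [->|xn] := eqVneq x 0.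
    have [r r0 rP] := blowup M; exists (Num.min r 1); first by rewrite lt_min r0 ltr01.
    move=> z; rewrite subr0 lt_min => /andP[zr z1].
    rewrite /truncation enorm0 ltr01 eqxx z1; case: eqVneq => [_|zn].
      by rewrite subrr normr0 ltW.
    by rewrite (min_idPr (ltW (rP z zn zr))) subrr normr0 ltW.
  have xP : punctured_ball x by split => //; apply/eqP.
  have /continuous_enormP /(_ c c0) [r r0 rP] := solution_continuous x xP.
  have /nbhs_enormP[r1 r10 r1P] := nbhs_punctured_ball x xP.
  exists (Num.min r r1); first by rewrite lt_min r0.
  move=> z; rewrite lt_min => /andP[/rP zr /r1P zP].
  rewrite !truncation_in//; move: zr; rewrite !ler_norml => /andP[h1 h2].
  by rewrite /Num.min; do 2!case: ltP => ?; apply/andP; split; lra.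
have tx : truncation M x = 0 by rewrite /truncation ltNge x1.
have [x1'|x1'] := ltP 1 (enorm x).
  exists (enorm x - 1); first by rewrite subr_gt0.
  move=> z zx; have := enorm_dist z x; rewrite ler_norml => /andP[h1 h2].
  by rewrite tx /truncation ltNge (_ : 1 <= enorm z) ?subrr ?normr0 ?ltW//=; lra.
have E : enorm x = 1 by apply/eqP; rewrite eq_le x1'.
have [_ C _ bd] := su.
have xC : punctured_closed_ball x.
  by split; [rewrite E|apply/eqP; rewrite -enorm_gt0 E].
have Cx := C x.
have : \forall z \near within punctured_closed_ball (nbhs x), `|u x - u z| <= c.
  have := Cx; rewrite /continuous_at; move=> Cx'.
  have /cvgrPdist_le /(_ c c0) := Cx'.
  by rewrite near_simpl /nbhs /= (nbhs_subspace_in xC).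
rewrite near_withinE => /nbhs_enormP[r r0 rP].
exists (Num.min r 1); first by rewrite lt_min r0 ltr01.
move=> z; rewrite lt_min => /andP[zr z1]; rewrite tx subr0 /truncation.
case: (ltP (enorm z) 1) => zl; last by rewrite normr0 ltW.
have zn : z != 0.
  by apply/eqP => z0; move: z1; rewrite z0 sub0r enormN E ltxx.
rewrite (negbTE zn).
have zP : punctured_ball z by split => //; apply/eqP.
have := rP z zr (conj (ltW zl) (proj2 zP)); rewrite (bd x E) sub0r normrN => uz.
rewrite ger0_norm; last by rewrite le_min (ltW M0) ltW// solution_gt0.
by rewrite ge_min (le_trans (ler_norm _) uz).
Qed.

(** [M] lies above [u] on the region |x| >= mu, so truncation is inactive at [x]; at the reflected
    point it can only lower the value, which is the harmless direction. *)
Lemma reflection_le_pos e mu x : dot e e = 1 -> 0 < mu -> mu < dot x e ->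
  punctured_ball x -> refl e mu x != 0 -> u x <= u (refl e mu x).
Proof.
move=> e1 mu0 mux xP rn; have [x1 /eqP xn] := xP.
have [M M0 MP] := solution_bounded mu mu0.
pose K := lambda * (expR M * nonlin 0 M).
have K0 : 0 < K by rewrite !mulr_gt0 ?expR_gt0.
have hM z : mu <= enorm z -> truncation M z < M.
  move=> mz; rewrite /truncation; case: (ltP (enorm z) 1) => [z1|//].
  have zn : z != 0 by rewrite -enorm_gt0; lra.
  by rewrite (negbTE zn) gt_min MP// ltW.
have hpos z : enorm z < 1 -> 0 < truncation M z.
  move=> z1; rewrite /truncation z1; case: eqVneq => // zn.
  by rewrite lt_min M0 andbT solution_gt0//; split => //; apply/eqP.
have hout z : 1 <= enorm z -> truncation M z = 0.
  by move=> z1; rewrite /truncation ltNge z1.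
have hpde z : enorm z < 1 -> truncation M z < M ->
    exists2 H, has_hessian (truncation M) z H & \tr H = - (lambda * nonlin 0 (truncation M z)).
  move=> z1 zM; have zn : z != 0.
    by apply/eqP => z0; move: zM; rewrite /truncation z1 z0 eqxx ltxx.
  have zP : punctured_ball z by split => //; apply/eqP.
  have uM : u z < M by move: zM; rewrite truncation_in// gt_min ltxx orbF.
  have -> : truncation M z = u z by rewrite truncation_in//; apply/min_idPl/ltW.
  have [H HH E] := solution_hessian z zP; exists H => //.
  have /nbhs_enormP[r1 r10 r1P] := nbhs_punctured_ball z zP.
  have Mu : 0 < (M - u z) / 2 by rewrite divr_gt0// subr_gt0.
  have /continuous_enormP /(_ _ Mu) [r r0 rP] := solution_continuous z zP.
  apply: (has_hessian_near u (truncation M) z H (Num.min r1 r)) => //.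
    by rewrite lt_min r10.
  move=> w; rewrite lt_min => /andP[/r1P wP /rP].
  rewrite ler_norml => /andP[_ h]; rewrite truncation_in//.
  by apply/esym/min_idPl; lra.
have Flip a b : b <= a -> a <= M -> 0 <= lambda * nonlin 0 a - lambda * nonlin 0 b <= K * (a - b).
  move=> ba aM; rewrite -mulrBr /K -mulrA; apply/andP; split.
    by rewrite mulr_ge0 ?(ltW l0)// subr_ge0 nonlin_le.
  rewrite ler_wpM2l ?(ltW l0)//.
  have := nonlin_lipschitz 0 0 M a b (lexx 0) aM (le_trans ba aM).
  by rewrite (ger0_norm (_ : 0 <= a - b)) ?subr_ge0//; apply: le_trans (ler_norm _).
have := moving_plane (truncation M) (fun v : R => lambda * nonlin 0 v) K M mu e n0 e1
  (truncation_continuous M M0) hout hpos mu0 hM K0 Flip hpde mu x (lexx mu) mux.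
have mx : mu <= enorm x by rewrite ltW// (lt_le_trans mux)// dot_le_enorm.
have rP : punctured_ball (refl e mu x).
  by split; [exact: lt_trans (refl_enorm_lt e mu x e1 mu0 mux) x1|apply/eqP].
rewrite !truncation_in// (min_idPl (ltW (MP x mx (ltW x1)))).
by move=> /le_trans; apply; rewrite ge_min lexx.
Qed.

Lemma refl0_enorm e x : dot e e = 1 -> enorm (refl e 0 x) = enorm x.
Proof.
move=> e1; apply/eqP; rewrite -(@eqrXn2 _ 2) ?enorm_ge0//; apply/eqP.
by rewrite refl_enorm2// mulr0 mul0r subr0.
Qed.

Lemma refl0_punctured e x : dot e e = 1 -> punctured_ball x -> punctured_ball (refl e 0 x).
Proof.
move=> e1 [x1 /eqP xn]; split; first by rewrite refl0_enorm.
by apply/eqP; rewrite -enorm_gt0 refl0_enorm// enorm_gt0.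
Qed.

(** The limit of [reflection_le_pos] as [mu] tends to 0. The choice of [mu] keeps the reflected
    point away from the origin, within the reach of continuity. *)
Lemma reflection_le e x : dot e e = 1 -> 0 < dot x e -> punctured_ball x ->
  u x <= u (refl e 0 x).
Proof.
move=> e1 xe xP; have rP := refl0_punctured e x e1 xP.
have [_ /eqP rn] := rP.
have r0 : 0 < enorm (refl e 0 x) by rewrite enorm_gt0.
apply/ler_addgt0Pr => c c0.
have /continuous_enormP /(_ c c0) [r rpos rr] := solution_continuous _ rP.
pose mu := Num.min (dot x e / 2) (Num.min (r / 4) (enorm (refl e 0 x) / 4)).
have mu0 : 0 < mu by rewrite !lt_min !divr_gt0.
have m1 : mu <= dot x e / 2 by rewrite ge_min lexx.
have m2 : mu <= r / 4 by rewrite ge_min ge_min lexx orbT.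
have m3 : mu <= enorm (refl e 0 x) / 4 by rewrite !ge_min lexx !orbT.
have hd := refl_dist e mu 0 x x e1; rewrite subrr enorm0 mulr0 add0r subr0 in hd.
rewrite (gtr0_norm mu0) in hd.
have h1 := reflection_le_pos e mu x e1 mu0 ltac:(lra) xP.
have rmn : refl e mu x != 0.
  have := enorm_dist (refl e mu x) (refl e 0 x); rewrite ler_norml => /andP[? _].
  by rewrite -enorm_gt0; lra.
have := rr (refl e mu x) ltac:(lra); rewrite ler_norml => /andP[_ ?].
by have := h1 rmn; lra.
Qed.

Lemma reflN e x : refl (- e) 0 x = refl e 0 x.
Proof. by rewrite /refl !subr0 dotNr mulrN scaleNr scalerN opprK. Qed.

Lemma refl_invol e x : dot e e = 1 -> refl e 0 (refl e 0 x) = x.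
Proof.
move=> e1; rewrite /refl !subr0 !dotE e1 mulr1.
have -> : 2 * (dot x e - 2 * dot x e) = - (2 * dot x e) by ring.
by rewrite scaleNr opprK subrK.
Qed.

(** Replacing [e] by [- e] covers both sides of the plane, and since the reflection is an involution
    the inequality holds in both directions. *)
Lemma reflection_eq e x : dot e e = 1 -> punctured_ball x -> u (refl e 0 x) = u x.
Proof.
have le e' y : dot e' e' = 1 -> punctured_ball y -> u y <= u (refl e' 0 y).
  move=> e1 yP; have [ye|ye|ye] := ltgtP 0 (dot y e').
  - exact: reflection_le.
  - rewrite -reflN; apply: reflection_le => //; first by rewrite dotNl dotNr opprK.
    by rewrite dotNr oppr_gt0.
  - by rewrite refl_fixed.
move=> e1 xP; apply/eqP; rewrite eq_le le// andbT -{2}(refl_invol e x e1).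
exact: le (refl0_punctured e x e1 xP).
Qed.

(** Two distinct points of equal norm are exchanged by the reflection in their bisecting hyperplane,
    which passes through the origin. *)
Lemma solution_radial x y : punctured_ball x -> enorm y = enorm x -> u x = u y.
Proof.
move=> xP xy; have [->//|xn] := eqVneq x y.
have d0 : 0 < enorm (x - y) by rewrite enorm_gt0 subr_eq0.
pose e := (enorm (x - y))^-1 *: (x - y).
have e1 : dot e e = 1.
  by rewrite /e dotZl dotZr -enorm2 expr2 mulKf ?mulVf// gt_eqF.
have <- : refl e 0 x = y; last by rewrite reflection_eq.
rewrite /refl subr0 /e dotZr scalerA.
have -> : 2 * ((enorm (x - y))^-1 * dot x (x - y)) * (enorm (x - y))^-1 = 1; last first.
  by rewrite scale1r opprB addrC subrK.
have E : 2 * dot x (x - y) = enorm (x - y) ^+ 2.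
  rewrite enorm2 !dotE (dotC y x) -(enorm2 x) -(enorm2 y) xy; ring.
have -> : 2 * ((enorm (x - y))^-1 * dot x (x - y)) / enorm (x - y) =
  (enorm (x - y))^-2 * (2 * dot x (x - y)) by rewrite expr2 invfM; ring.
by rewrite E mulVf// expf_neq0// gt_eqF.
Qed.

End radial_symmetry.

Lemma bigO_near0P {R : realType} {n : nat} (f g h : 'rV[R]_n -> R) :
  f = g +O_ ((0 : 'rV[R]_n)^') h <->
  exists2 C, 0 <= C & exists2 r, 0 < r & forall x : 'rV[R]_n, x != 0 -> enorm x < r ->
    `|f x - g x| <= C * `|h x|.
Proof.
split=> [/eqaddOP[C [_ CP]]|[C C0 [r r0 rP]]].
  pose C' := Num.max C 0 + 1.
  have CC : C < C' by rewrite (@le_lt_trans _ _ (Num.max C 0)) ?ltrDl// le_max lexx.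
  exists C'; first by rewrite addr_ge0// le_max lexx orbT.
  have := CP C' CC; rewrite near_withinE => /nbhs_enormP[r r0 rP].
  exists r => // x x0 xr; have := rP x; rewrite subr0 => /(_ xr x0).
  by [].
apply/eqaddOP; exists C; split; first exact: num_real.
move=> k Ck; rewrite near_withinE; apply/nbhs_enormP; exists r => // x.
rewrite subr0 => xr x0; apply: (le_trans (rP x x0 xr)).
by rewrite ler_wpM2r// ltW.
Qed.

(** * From a radial solution to the equation in logarithmic time *)

Section radial_ode.
Context {R : realType} {n : nat}.
Variables (lambda : R) (u : 'rV[R]_n -> R) (i0 : 'I_n).
Hypothesis l0 : 0 < lambda.
Hypothesis su : is_solution lambda u.
Hypothesis blowup : forall C : R, exists2 r, 0 < r &
  forall x, x != 0 -> enorm x < r -> C < u x.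
Implicit Types (x y z v e : 'rV[R]_n) (c r s t d mu a M : R) (i j : 'I_n).

Let n0 : (0 < n)%N. Proof. exact: leq_ltn_trans (leq0n i0) (ltn_ord i0). Qed.

Definition axis : 'rV[R]_n := delta_mx 0 i0.

Lemma dot_axis : dot axis axis = 1. Proof. exact: dot_delta_delta. Qed.

Lemma enorm_ray r : 0 <= r -> enorm (r *: axis) = r.
Proof. by move=> r0; rewrite enormZ (enorm_unit _ dot_axis) mulr1 ger0_norm. Qed.

Lemma ray_punctured r : 0 < r -> r < 1 -> punctured_ball (r *: axis).
Proof.
move=> r0 r1; split; first by rewrite enorm_ray// ltW.
by apply/eqP; rewrite -enorm_gt0 enorm_ray// ltW.
Qed.

Let rad r := u (r *: axis).
Let D r := partial i0 u (r *: axis).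
Let DD r := partial i0 (partial i0 u) (r *: axis).

Lemma is_derive_ray (w : 'rV[R]_n -> R) v t d :
  is_derive (t *: v) v w d -> is_derive t 1 (fun s : R => w (s *: v)) d.
Proof.
move=> H; have := (is_derive_line w 0 v t d).1; rewrite add0r => /(_ H).
by under [X in is_derive _ _ X _ -> _]eq_fun do rewrite add0r.
Qed.

Lemma rad_derive r : 0 < r -> r < 1 -> is_derive r 1 rad (D r).
Proof.
move=> r0 r1; apply: is_derive_ray; apply: derivableP.
by have [[C1 _] _ _ _] := su; have [_ dv _] := C1 _ (ray_punctured r r0 r1); exact: dv.
Qed.

Lemma D_derive r : 0 < r -> r < 1 -> is_derive r 1 D (DD r).
Proof.
move=> r0 r1; apply: is_derive_ray; apply: derivableP.
have [[_ C2] _ _ _] := su; have [_ dv _] := C2 i0 _ (ray_punctured r r0 r1); exact: dv.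
Qed.

(** The hypotenuse sqrt(r^2 + s^2), written with [expR] and [ln] so that the derivative rules
    apply. *)
Let hyp r s := expR (ln (r ^+ 2 + s ^+ 2) / 2).

Lemma hypE r s i : 0 < r -> i != i0 -> enorm (r *: axis + s *: delta_mx 0 i) = hyp r s.
Proof.
move=> r0 ii; have rs : 0 < r ^+ 2 + s ^+ 2 by rewrite ltr_wpDr ?sqr_ge0// exprn_gt0.
apply/eqP; rewrite -(@eqrXn2 _ 2) ?enorm_ge0 ?expR_ge0//; apply/eqP.
rewrite enorm2 dot_line !dotZl !dotZr dot_axis dot_delta_delta dot_delta.
rewrite mxE (negbTE ii) andbF !mulr0 mul0r addr0 mulr1 mul1r -expr2.
by rewrite [RHS]expr2 /hyp -expRD -splitr lnK// posrE.
Qed.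

Lemma hyp0 r : 0 < r -> hyp r 0 = r.
Proof.
move=> r0; rewrite /hyp expr0n addr0 lnXn// -[_ *+ 2]mulr_natr mulfK ?pnatr_eq0//.
by rewrite lnK ?posrE.
Qed.

Lemma hyp_derive r s : 0 < r -> is_derive s 1 (hyp r) (s / hyp r s).
Proof.
move=> r0; have rs : 0 < r ^+ 2 + s ^+ 2 by rewrite ltr_wpDr ?sqr_ge0// exprn_gt0.
have h0 : 0 < hyp r s by exact: expR_gt0.
have h2 : r ^+ 2 + s ^+ 2 = hyp r s * hyp r s by rewrite -expRD -splitr lnK.
rewrite /hyp; der_eq; rewrite -/(hyp r s) h2.
by field; rewrite gt_eqF.
Qed.

Lemma second_der_unique w x v d d' : second_der w x v d -> second_der w x v d' -> d = d'.
Proof.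
move=> [p [[r r0 rP] dp]] [q [[s s0 sP] dq]].
have pq : \forall t \near (0 : R), p t = q t.
  apply/nbhs_ballP; exists (Num.min r s) => /=; first by rewrite lt_min r0.
  move=> t; rewrite /ball /= sub0r normrN lt_min => /andP[tr ts].
  by have [_ <-] := rP t tr; have [_ <-] := sP t ts.
have [_ <-] := near_eq_is_derive pq dp; by have [_ <-] := dq.
Qed.

(** Along a line orthogonal to the axis, radial symmetry gives [u = rad (hyp r s)], whose second
    derivative at [s = 0] is [D r / r]. This is the origin of the term (n - 1) u' / r. *)
Lemma transverse_partials r i : 0 < r -> r < 1 -> i != i0 ->
  partial i u (r *: axis) = 0 /\ partial i (partial i u) (r *: axis) = D r / r.
Proof.
move=> r0 r1 ii; have rP := ray_punctured r r0 r1.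
have hr : hyp r 0 < 1 by rewrite hyp0.
have /continuous_epsP /(_ ((1 - r) / 2) ltac:(lra)) [q q0 qP] :=
  is_der_continuous _ _ _ (hyp_derive r 0 r0).
have small s : `|s| < q -> hyp r s < 1.
  by move=> /qP; rewrite add0r hyp0// ler_norml => /andP[_ ?]; lra.
have hpos s : 0 < hyp r s by exact: expR_gt0.
have line s : `|s| < q -> is_derive s 1 (fun s : R => u (r *: axis + s *: delta_mx 0 i))
    (D (hyp r s) * (s / hyp r s)).
  move=> sq; have h1 := small s sq.
  have dr := rad_derive (hyp r s) (hpos s) h1.
  have dh := hyp_derive r s r0.
  have dc := is_der_comp (hyp r) rad s _ _ dh dr.
  apply: near_eq_is_derive dc.
  apply/nbhs_ballP; exists (q - `|s|) => /=; first by rewrite subr_gt0.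
  move=> t st; have tq : `|t| < q.
    move: st; rewrite /ball /= distrC ltrBrDr; apply: le_lt_trans.
    by rewrite -[leLHS](congr1 Num.norm (subrK s t)) ler_normD.
  rewrite /rad; apply: (solution_radial lambda u n0 l0 su blowup).
    exact: ray_punctured (hpos t) (small t tq).
  by rewrite hypE// enorm_ray// ltW.
have sd : second_der u (r *: axis) (delta_mx 0 i) (D r / r).
  exists (fun s => D (hyp r s) * (s / hyp r s)); split; first by exists q.
  have dh := hyp_derive r 0 r0.
  have dc := is_der_comp (hyp r) D 0 _ _ dh (D_derive _ (hpos 0) hr).
  have h0 : hyp r 0 != 0 by rewrite gt_eqF.
  have di : is_derive (0 : R) 1 (fun s : R => s / hyp r s) r^-1.
    have := is_der_mul _ _ _ _ _ (is_der_id 0) (is_der_inv _ _ _ h0 dh).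
    by rewrite !mul0r addr0 mul1r hyp0.
  have := is_der_mul _ _ _ _ _ dc di.
  by rewrite !mul0r mulr0 add0r hyp0.
split.
  have := line 0; rewrite normr0 mul0r mulr0 => /(_ q0) H.
  by have [_] := (is_derive_line0 u (r *: axis) (delta_mx 0 i) 0).2 H.
have [C2 _ _ _] := su.
have := C2_has_hessian _ u _ (nbhs_punctured_ball _ rP) C2 (delta_mx 0 i).
rewrite (bigD1 i)//= (bigD1 i)//= !big1 ?addr0 ?mxE ?eqxx ?mul1r.
- move=> H; exact: second_der_unique H sd.
- by move=> j ji; apply: big1 => k _; rewrite !mxE eqxx (negbTE ji) !mul0r.
- by move=> j ji; rewrite !mxE eqxx (negbTE ji) mulr0 mul0r.
Qed.

Lemma radial_equation r : 0 < r -> r < 1 ->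
  - (DD r + (n%:R - 1) * (D r / r)) = lambda * nonlin 0 (rad r).
Proof.
move=> r0 r1; have [_ _ E _] := su.
have := E _ (ray_punctured r r0 r1); rewrite /nonlin mulr0 subr0 => <-.
congr (- _); rewrite /laplacian (bigD1 i0)//=; congr (_ + _).
have -> : \sum_(i < n | i != i0) partial i (partial i u) (r *: axis) =
    \sum_(i < n | i != i0) D r / r.
  by apply: eq_bigr => i /(transverse_partials r i r0 r1)[].
have : \sum_(i < n) D r / r = D r / r + \sum_(i < n | i != i0) D r / r.
  by rewrite (bigD1 i0).
by rewrite sumr_const card_ord -[X in X = _]mulr_natl => h; rewrite mulrBl mul1r h addrC addKr.
Qed.

Lemma gradient_ray r : 0 < r -> r < 1 -> enorm (gradient u (r *: axis)) = `|D r|.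
Proof.
move=> r0 r1; have -> : gradient u (r *: axis) = D r *: axis.
  apply/rowP => i; rewrite !mxE eqxx /=; have [->|ii] := eqVneq i i0.
    by rewrite mulr1.
  by rewrite mulr0; have [] := transverse_partials r i r0 r1 ii.
by rewrite enormZ (enorm_unit _ dot_axis) mulr1.
Qed.

(** The time ln (1 / sqrt lambda), at which the rescaled radius corresponds to the unit sphere. *)
Definition log_radius : R := - ln lambda / 2.

Let t1 := log_radius.
Let rho t := expR (t1 - t).

Definition log_profile t : R := rad (rho t).
Definition log_slope t : R := - (rho t * D (rho t)).

Lemma rho_lt1 t : t1 < t -> 0 < rho t /\ rho t < 1.
Proof. by move=> tt; split; rewrite ?expR_gt0// -expR0 ltr_expR subr_lt0. Qed.

Lemma rho_derive t : is_derive t 1 rho (- rho t).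
Proof. by rewrite /rho; der_eq; ring. Qed.

Lemma lambda_rho t : lambda * rho t ^+ 2 = expR (- (2 * t)).
Proof.
rewrite -[lambda in LHS]lnK ?posrE// /rho expr2 -!expRD /t1 /log_radius.
by congr expR; field.
Qed.

Lemma log_profile_ode t : t1 < t -> ode_at (n%:R - 2) log_profile log_slope t.
Proof.
move=> tt; have [r0 r1] := rho_lt1 t tt.
have dr := rho_derive t.
have d1 := is_der_comp rho rad t _ _ dr (rad_derive (rho t) r0 r1).
have d2 := is_der_comp rho D t _ _ dr (D_derive (rho t) r0 r1).
split.
  by move: d1; rewrite /log_slope mulrC mulNr.
rewrite /log_slope; der_eq.
have E := radial_equation (rho t) r0 r1.
have -> : nonlin t (log_profile t) = lambda * rho t ^+ 2 * nonlin 0 (rad (rho t)).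
  by rewrite lambda_rho /nonlin -expRD /log_profile; congr expR; ring.
have -> : lambda * rho t ^+ 2 * nonlin 0 (rad (rho t)) =
  rho t ^+ 2 * (lambda * nonlin 0 (rad (rho t))) by ring.
by rewrite -E; field; rewrite gt_eqF.
Qed.

Lemma log_profile_gt0 t : t1 < t -> 0 < log_profile t.
Proof.
move=> tt; have [r0 r1] := rho_lt1 t tt.
exact: solution_gt0 l0 su blowup _ (ray_punctured _ r0 r1).
Qed.

Lemma log_profile_unbounded (C s : R) : exists2 t, s < t & C < log_profile t.
Proof.
have [r r0 rP] := blowup C.
pose t := Num.max s (t1 - ln r) + 1.
have st : s < t by rewrite /t (@le_lt_trans _ _ (Num.max s (t1 - ln r))) ?ltrDl// le_max lexx.
have tt : t1 - ln r < t.
  by rewrite /t (@le_lt_trans _ _ (Num.max s (t1 - ln r))) ?ltrDl// le_max lexx orbT.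
have rt : 0 < rho t by exact: expR_gt0.
exists t => //; apply: rP; first by rewrite -enorm_gt0 enorm_ray// ltW.
by rewrite enorm_ray ?(ltW rt)// /rho -[ltRHS]lnK ?posrE// ltr_expR; lra.
Qed.

(** A nonpositive slope would stay nonpositive to the right and keep the profile bounded, against
    blow-up. The gradient asymptotics control only the absolute value of the slope; this supplies
    the sign. *)
Lemma log_slope_gt0 t : t1 < t -> 0 < log_slope t.
Proof.
move=> tt; rewrite ltNge; apply/negP => pt.
set N : R := n%:R - 2.
have ode s : t1 < s -> ode_at N log_profile log_slope s by exact: log_profile_ode.
have neg s : t <= s -> log_slope s <= 0.
  move=> ts; rewrite leNgt; apply/negP => ps.
  have : 0 < log_slope t; last by rewrite ltNge pt.
  apply: (ode_p_gt0 N log_profile log_slope t s ts _ ps) => z /andP[tz _].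
  by apply: ode; exact: lt_le_trans tz.
have [s ts] := log_profile_unbounded (log_profile t) t.
rewrite ltNge => /negP; apply; rewrite -lerN2.
apply: (is_der_ge0_le (fun z : R => - log_profile z) (fun z : R => - log_slope z) _ _ (ltW ts)).
  move=> z /andP[tz _]; have [? _] := ode z (lt_le_trans tt tz).
  by der.
by move=> z /andP[tz _]; rewrite oppr_ge0 neg.
Qed.

Lemma log_profile_boundary c : 0 < c -> exists2 d, 0 < d &
  forall t, t1 < t -> t < t1 + d -> log_profile t < c.
Proof.
(* Continuity at the sphere is taken from the truncation at level 1; a truncated value below
   [Num.min c 1] is below the cap, hence equal to [u]. *)
move=> c0; pose c' := Num.min c 1 / 2.
have m0 : 0 < Num.min c 1 by rewrite lt_min c0 ltr01.
have c'0 : 0 < c' by rewrite divr_gt0.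
have /continuous_enormP /(_ c' c'0) [r r0 rP] :=
  truncation_continuous lambda u l0 su blowup 1 ltr01 axis.
exists r => // t tt tr; have [q0 q1] := rho_lt1 t tt.
have dist : enorm (rho t *: axis - axis) < r.
  rewrite -{2}[axis]scale1r -scalerBl enormZ (enorm_unit _ dot_axis) mulr1.
  rewrite ler0_norm ?subr_le0 ?(ltW q1)//.
  by have := @expR_ge1Dx R (t1 - t); rewrite /rho; lra.
have := rP _ dist; rewrite (truncation_in _ _ _ (ray_punctured _ q0 q1)).
rewrite /truncation (enorm_unit _ dot_axis) ltxx subr0 ler_norml => /andP[_ h].
have : Num.min (u (rho t *: axis)) 1 < Num.min c 1 by rewrite /c' in h; lra.
rewrite lt_min !gt_min ltxx orbF => /andP[/orP[//|c1] u1].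
by rewrite /log_profile /rad; exact: lt_trans u1 c1.
Qed.

End radial_ode.

(** * The prescribed asymptotics as bounds in logarithmic time *)

Section log_inv.
Context {R : realType} {n : nat}.
Implicit Types (x : 'rV[R]_n) (f g h : 'rV[R]_n -> R).

Lemma log_invE x : x != 0 -> log_inv x = - ln (enorm x).
Proof. by move=> x0; rewrite /log_inv div1r lnV// posrE enorm_gt0. Qed.

Lemma expR_log_inv x : x != 0 -> expR (- log_inv x) = enorm x.
Proof. by move=> x0; rewrite log_invE// opprK lnK// posrE enorm_gt0. Qed.

Lemma log_inv_gtE x (t : R) : x != 0 -> (t < log_inv x) = (enorm x < expR (- t)).
Proof. by move=> x0; rewrite -[in RHS]expR_log_inv// ltr_expR ltrN2. Qed.

Lemma bigO_log_invP f g h : f = g +O_ ((0 : 'rV[R]_n)^') h <->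
  exists2 C, 0 <= C & exists T : R, forall x, x != 0 -> T < log_inv x ->
    `|f x - g x| <= C * `|h x|.
Proof.
split=> [/bigO_near0P[C C0 [r r0 rP]]|[C C0 [T TP]]].
  exists C => //; exists (- ln r) => x x0; rewrite log_inv_gtE// opprK lnK ?posrE//.
  exact: rP.
apply/bigO_near0P; exists C => //; exists (expR (- T)); first exact: expR_gt0.
by move=> x x0; rewrite -log_inv_gtE//; exact: TP.
Qed.

Lemma bigO_profileP (N : R) f :
  f = (fun x => profile N (log_inv x)) +O_ ((0 : 'rV[R]_n)^') (fun x => log_inv x ^- 2) <->
  exists2 C, 0 <= C & exists T : R, forall x, x != 0 -> T < log_inv x ->
    `|f x - profile N (log_inv x)| <= C / log_inv x ^+ 2.
Proof.
have E x : `|log_inv x ^- 2| = (log_inv x ^+ 2)^-1 by rewrite ger0_norm ?invr_ge0 ?sqr_ge0.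
split=> [/bigO_log_invP|] [C C0 [T TP]].
  by exists C => //; exists T => x x0 Tx; rewrite -E; exact: TP.
by apply/bigO_log_invP; exists C => //; exists T => x x0 Tx; rewrite E; exact: TP.
Qed.

Lemma bigO_slopeP f :
  f = (fun x => 1 / (enorm x * log_inv x) + ln (log_inv x) / (2 * enorm x * log_inv x ^+ 2))
    +O_ ((0 : 'rV[R]_n)^') (fun x => 1 / (enorm x * log_inv x ^+ 2)) <->
  exists2 C, 0 <= C & exists T : R, forall x, x != 0 -> T < log_inv x ->
    `|enorm x * f x - slope (log_inv x)| <= C / log_inv x ^+ 2.
Proof.
have E x C : x != 0 -> 0 < log_inv x ->
    (`|f x - (1 / (enorm x * log_inv x) + ln (log_inv x) / (2 * enorm x * log_inv x ^+ 2))|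
      <= C * `|1 / (enorm x * log_inv x ^+ 2)|) =
    (`|enorm x * f x - slope (log_inv x)| <= C / log_inv x ^+ 2).
  rewrite -enorm_gt0 => x0; move: (log_inv x) => t t0.
  have t2 : 0 < t ^+ 2 by rewrite exprn_gt0.
  have h : 0 <= 1 / (enorm x * t ^+ 2) by rewrite divr_ge0// mulr_ge0 ?(ltW x0) ?(ltW t2).
  rewrite (ger0_norm h) -(ler_pM2l x0) -{1}(gtr0_norm x0) -normrM /slope.
  congr (`|_| <= _); first by field; rewrite !gt_eqF.
  by field; rewrite !gt_eqF.
split=> [/bigO_log_invP|] [C C0 [T TP]].
  exists C => //; exists (Num.max T 0) => x x0; rewrite gt_max => /andP[Tx t0].
  by rewrite -E//; exact: TP.
apply/bigO_log_invP; exists C => //; exists (Num.max T 0) => x x0.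
by rewrite gt_max => /andP[Tx t0]; rewrite E//; exact: TP.
Qed.

End log_inv.

(** * Uniform blow-up from the asymptotics *)

Section asymptotics.
Context {R : realType} {n : nat}.
Variables (lambda N : R) (u : 'rV[R]_n -> R).
Hypotheses (l0 : 0 < lambda) (N1 : 1 <= N).

Let mu := Num.sqrt lambda.

Lemma mu_gt0 : 0 < mu. Proof. by rewrite sqrtr_gt0. Qed.

Lemma log_radiusE : expR (log_radius lambda) = mu^-1.
Proof.
have m0 := mu_gt0.
have -> : lambda = mu ^+ 2 by rewrite sqr_sqrtr// ltW.
rewrite /log_radius lnXn// -[_ *+ 2]mulr_natr -mulNr mulfK ?pnatr_eq0//.
by rewrite expRN lnK// posrE.
Qed.

Lemma profile_ge_ln t : T0 N <= t -> ln t <= profile N t.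
Proof.
move=> Tt; have [t20 _ _ _] := basic_bounds _ _ Tt.
have /andP[h _] := inner_bounds N N1 t Tt.
by rewrite /profile ler_ln ?posrE//; lra.
Qed.

(** The profile is at least [ln t] and the error stays bounded. Divergence along every approach to 0
    is stronger than unboundedness, and it is what creates the plateau of the truncation. *)
Lemma profile_blowup : (fun x => u (mu^-1 *: x)) =
    (fun x => profile N (log_inv x)) +O_ ((0 : 'rV[R]_n)^') (fun x => log_inv x ^- 2) ->
  forall C : R, exists2 r, 0 < r & forall x, x != 0 -> enorm x < r -> C < u x.
Proof.
have m0 := mu_gt0.
move=> /bigO_profileP[C C0 [T TP]] M.
pose S := Num.max (Num.max T (T0 N)) (expR (M + C + 1)).
exists (expR (- S) / mu); first by rewrite divr_gt0// expR_gt0.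
move=> x x0 xr; have z0 : mu *: x != 0 by rewrite scaler_eq0 negb_or x0 gt_eqF.
have : S < log_inv (mu *: x).
  by rewrite log_inv_gtE// enormZ gtr0_norm// mulrC -ltr_pdivlMr.
rewrite /S !gt_max -andbA => /and3P[h1 h2 h3].
have := TP _ z0 h1; rewrite scalerA mulVf ?gt_eqF// scale1r.
have := profile_ge_ln _ (ltW h2).
have [t20 _ _ _] := basic_bounds _ _ (ltW h2).
move: (log_inv (mu *: x)) t20 h3 => t t20 h3.
have : M + C + 1 < ln t by rewrite -ltr_expR lnK// posrE; lra.
have : C / t ^+ 2 <= C.
  by rewrite ler_pdivrMr ?exprn_gt0//; [rewrite ler_peMr// expr2; nra|lra].
by rewrite ler_norml => ? ? ? /andP[? _]; lra.
Qed.

End asymptotics.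

(** * Uniqueness of the parameter *)

Section uniqueness.
Context {R : realType} {n : nat}.
Variables (N : R) (i0 : 'I_n).
Hypothesis N1 : 1 <= N.

Lemma log_inv_ray t : expR (- t) *: axis i0 != 0 :> 'rV[R]_n /\
  log_inv (expR (- t) *: axis i0 : 'rV[R]_n) = t.
Proof.
have e0 : enorm (expR (- t) *: axis i0 : 'rV[R]_n) = expR (- t).
  by rewrite enorm_ray// expR_ge0.
have x0 : expR (- t) *: axis i0 != 0 :> 'rV[R]_n by rewrite -enorm_gt0 e0 expR_gt0.
by split => //; rewrite log_invE// e0 expRK opprK.
Qed.

Lemma solution_near_profile (lambda : R) (u : 'rV[R]_n -> R) : 0 < lambda -> is_solution lambda u ->
  (fun x => u ((Num.sqrt lambda)^-1 *: x)) =
    (fun x => profile N (log_inv x)) +O_ ((0 : 'rV[R]_n)^') (fun x => log_inv x ^- 2) ->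
  (fun x => (Num.sqrt lambda)^-1 * enorm (gradient u ((Num.sqrt lambda)^-1 *: x))) =
    (fun x => 1 / (enorm x * log_inv x) + ln (log_inv x) / (2 * enorm x * log_inv x ^+ 2))
    +O_ ((0 : 'rV[R]_n)^') (fun x => 1 / (enorm x * log_inv x ^+ 2)) ->
  exists2 B, 0 <= B & exists T : R,
    near_profile N B T (log_profile lambda u i0) (log_slope lambda u i0).
Proof.
move=> l0 su as1 as2; have bl := profile_blowup lambda N u l0 N1 as1.
move/bigO_profileP : as1 => [C1 C10 [T1 H1]].
move/bigO_slopeP : as2 => [C2 C20 [T2 H2]].
exists (C1 + (C2 + (5 + 2 * c0 N))).
  have := c01 N; lra.
exists (Num.max (Num.max (T1 + 1) (T2 + 1)) (Num.max (T0 N) (log_radius lambda + 1))) => t.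
rewrite !ge_max => /andP[/andP[t1 t2] /andP[t3 t4]].
have [x0 xt] := log_inv_ray t.
have tr : log_radius lambda < t by lra.
have rhoE : (Num.sqrt lambda)^-1 *: (expR (- t) *: axis i0) =
    expR (log_radius lambda - t) *: axis i0 :> 'rV[R]_n.
  by rewrite scalerA expRD log_radiusE.
have [q0 q1] := rho_lt1 _ _ tr.
have := H1 _ x0; rewrite xt => /(_ ltac:(lra)); rewrite rhoE -/(log_profile lambda u i0 t) => h1.
have := H2 _ x0; rewrite xt => /(_ ltac:(lra)); rewrite rhoE.
rewrite (gradient_ray lambda u i0 l0 su bl _ q0 q1) enorm_ray ?expR_ge0//.
have -> : expR (- t) * ((Num.sqrt lambda)^-1 *
    `|partial i0 u (expR (log_radius lambda - t) *: axis i0)|) = log_slope lambda u i0 t.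
  rewrite -[RHS]gtr0_norm; last exact: log_slope_gt0.
  rewrite /log_slope normrN normrM [in RHS]gtr0_norm// expRD log_radiusE//; ring.
move=> h2; have h3 := dprofile_slope N N1 t t3.
have [t20 _ _ _] := basic_bounds _ _ t3.
have it : 0 <= (t ^+ 2)^-1 by rewrite invr_ge0 sqr_ge0.
have C0 : 0 <= 5 + 2 * c0 N by have := c01 N; lra.
split.
  by apply: (le_trans h1); rewrite ler_wpM2r//; lra.
apply: (@le_trans _ _ (C2 / t ^+ 2 + (5 + 2 * c0 N) / t ^+ 2)).
  apply: le_trans (lerD h2 h3); rewrite [X in _ <= _ + X]distrC.
  by apply: le_trans (ler_normD _ _); rewrite addrA subrK.
by rewrite -mulrDl ler_wpM2r//; lra.
Qed.

(** The larger parameter has the smaller [log_radius]. By [ode_unique] both profiles agree to the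
    right of [log_radius l1], where the first tends to 0 while the second is already positive and
    increasing. *)
Lemma lambda_not_lt (l1 l2 : R) (u1 u2 : 'rV[R]_n -> R) : N = n%:R - 2 ->
  l1 < l2 -> 0 < l1 -> is_solution l1 u1 -> is_solution l2 u2 ->
  (fun x => u1 ((Num.sqrt l1)^-1 *: x)) =
    (fun x => profile N (log_inv x)) +O_ ((0 : 'rV[R]_n)^') (fun x => log_inv x ^- 2) ->
  (fun x => (Num.sqrt l1)^-1 * enorm (gradient u1 ((Num.sqrt l1)^-1 *: x))) =
    (fun x => 1 / (enorm x * log_inv x) + ln (log_inv x) / (2 * enorm x * log_inv x ^+ 2))
    +O_ ((0 : 'rV[R]_n)^') (fun x => 1 / (enorm x * log_inv x ^+ 2)) ->
  (fun x => u2 ((Num.sqrt l2)^-1 *: x)) =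
    (fun x => profile N (log_inv x)) +O_ ((0 : 'rV[R]_n)^') (fun x => log_inv x ^- 2) ->
  (fun x => (Num.sqrt l2)^-1 * enorm (gradient u2 ((Num.sqrt l2)^-1 *: x))) =
    (fun x => 1 / (enorm x * log_inv x) + ln (log_inv x) / (2 * enorm x * log_inv x ^+ 2))
    +O_ ((0 : 'rV[R]_n)^') (fun x => 1 / (enorm x * log_inv x ^+ 2)) ->
  False.
Proof.
move=> NE l12 l10 s1 s2 a1 b1 a2 b2; have l20 := lt_trans l10 l12.
have bl1 := profile_blowup l1 N u1 l10 N1 a1.
have bl2 := profile_blowup l2 N u2 l20 N1 a2.
have [B1 B10 [S1 n1]] := solution_near_profile l1 u1 l10 s1 a1 b1.
have [B2 B20 [S2 n2]] := solution_near_profile l2 u2 l20 s2 a2 b2.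
have r12 : log_radius l2 < log_radius l1.
  by rewrite /log_radius ltr_pM2r ?invr_gt0// ltrN2 ltr_ln ?posrE.
pose B := Num.max B1 B2; pose S := Num.max S1 S2.
have BB1 : B1 <= B by rewrite le_max lexx.
have BB2 : B2 <= B by rewrite le_max lexx orbT.
have SS1 : S1 <= S by rewrite le_max lexx.
have SS2 : S2 <= S by rewrite le_max lexx orbT.
have o1 t : log_radius l1 < t -> ode_at N (log_profile l1 u1 i0) (log_slope l1 u1 i0) t.
  by rewrite NE; exact: log_profile_ode.
have o2 t : log_radius l2 < t -> ode_at N (log_profile l2 u2 i0) (log_slope l2 u2 i0) t.
  by rewrite NE; exact: log_profile_ode.
have B0 : 0 <= B := le_trans B10 BB1.
have m1 := near_profileW _ _ _ _ _ _ _ BB1 SS1 n1.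
have m2 := near_profileW _ _ _ _ _ _ _ BB2 SS2 n2.
have E := ode_unique N B S _ _ _ _ (log_radius l1) N1 B0 o1
  (fun t h => o2 t (lt_trans r12 h)) m1 m2.
have g0 := log_profile_gt0 l2 u2 i0 l20 s2 bl2 (log_radius l1) r12.
have [d d0 dP] := log_profile_boundary l1 u1 i0 l10 s1 bl1 _ g0.
pose t := log_radius l1 + d / 2.
have t1 : log_radius l1 < t by rewrite /t; lra.
have := dP t t1 ltac:(rewrite /t; lra).
rewrite E// ltNge => /negP; apply.
exact/ltW/(ode_y_mono _ _ _ _ _ _ N1 o2 m2).
Qed.

End uniqueness.

(** * Derivatives of radial functions *)

Section radial_functions.
Context {R : realType} {n : nat}.
Implicit Types (x z v : 'rV[R]_n) (f g : 'rV[R]_n -> R) (i j : 'I_n) (F : R -> R).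

Lemma continuous_dot2 : continuous (fun x : 'rV[R]_n => dot x x).
Proof.
rewrite (_ : (fun x => _) = (fun x => enorm x * enorm x)).
  by apply: continuous_mulf; exact: continuous_enorm.
by apply/funext => x; rewrite -enorm2 expr2.
Qed.

Lemma near_continuous f g x : (\forall z \near x, f z = g z) ->
  {for x, continuous f} -> {for x, continuous g}.
Proof.
move=> /nbhs_enormP[r0 r00 E] /continuous_enormP H; apply/continuous_enormP => c c0.
have [r r_0 rP] := H c c0; exists (Num.min r r0); first by rewrite lt_min r_0.
move=> z; rewrite lt_min => /andP[zr z0]; rewrite -!E ?rP//.
by rewrite subrr enorm0.
Qed.

(** Radial functions are taken as functions of |x|^2, a polynomial, so that no square root is
    differentiated. *)
Lemma radial_is_derive F d x i : is_derive (dot x x) 1 F d ->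
  is_derive x (delta_mx 0 i) (fun z => F (dot z z)) (d * (2 * x 0 i)).
Proof.
move=> dF; apply/is_derive_line0.
have E : dot x x = dot (x + 0 *: delta_mx 0 i) (x + 0 *: delta_mx 0 i) by rewrite scale0r addr0.
rewrite E in dF; apply: (is_der_comp (fun s : R => dot (x + s *: delta_mx 0 i)
  (x + s *: delta_mx 0 i)) F 0 _ _ _ dF).
under [X in is_derive _ _ X _]eq_fun do rewrite dot_line dot_delta dot_delta_delta.
by der_eq; ring.
Qed.

Lemma coord_is_derive x i j : is_derive x (delta_mx 0 j) (fun z : 'rV[R]_n => z 0 i) (i == j)%:R.
Proof.
apply/is_derive_line0; under [X in is_derive _ _ X _]eq_fun do rewrite !mxE eqxx /=.
by der_eq; ring.
Qed.

Lemma continuous_coord i : continuous (fun z : 'rV[R]_n => z 0 i).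
Proof.
by under eq_fun do rewrite -dot_delta; exact: continuous_dot.
Qed.

Variables (F F1 F2 : R -> R) (b : R).
Hypothesis dF : forall s, 0 < s < b -> is_derive s 1 F (F1 s).
Hypothesis dF1 : forall s, 0 < s < b -> is_derive s 1 F1 (F2 s).
Hypothesis cF2 : forall s, 0 < s < b -> {for s, continuous F2}.

Let A : set 'rV[R]_n := [set x | 0 < dot x x < b].
Let u x := F (dot x x).

Lemma shell_nbhs x : A x -> nbhs x A.
Proof.
move=> /andP[s0 sb]; have m0 : 0 < Num.min (dot x x) (b - dot x x).
  by rewrite lt_min s0 subr_gt0.
have /continuous_enormP /(_ (Num.min (dot x x) (b - dot x x) / 2)) [|r r0 rP] :=
  continuous_dot2 x; first by rewrite divr_gt0.
apply/nbhs_enormP; exists r => // z /rP; move: m0.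
rewrite ler_pdivlMr// le_min lt_min => /andP[h1 h2] /andP[].
have := ler_norm (dot z z - dot x x); have := ler_norm (- (dot z z - dot x x)).
rewrite normrN => h3 h4 h5 h6; apply/andP; split; lra.
Qed.

Lemma radial_partial x i : A x -> is_derive x (delta_mx 0 i) u (F1 (dot x x) * (2 * x 0 i)).
Proof. by move=> Ax; apply: radial_is_derive; exact: dF. Qed.

Let near_partial x i : A x ->
  \forall z \near x, F1 (dot z z) * (2 * z 0 i) = partial i u z.
Proof.
by move=> /shell_nbhs; apply: filterS => z /(radial_partial z i)[_ <-].
Qed.

Let second x i j := F2 (dot x x) * (2 * x 0 j) * (2 * x 0 i) + F1 (dot x x) * (2 * (i == j)%:R).

Lemma radial_second_partial x i j : A x ->
  is_derive x (delta_mx 0 j) (partial i u) (second x i j).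
Proof.
move=> Ax; apply: (near_eq_is_derive (near_partial x i Ax)).
have d1 := radial_is_derive F1 _ x j (dF1 _ Ax).
have d2 := coord_is_derive x i j.
apply/is_derive_line0; move/is_derive_line0 : d1 => d1; move/is_derive_line0 : d2 => d2.
have := is_der_mul _ _ _ _ _ d1 (is_der_mul _ _ _ _ _ (is_der_cst 0 2) d2).
by rewrite mul0r add0r scale0r addr0.
Qed.

Let continuous_radial (G : R -> R) x : {for dot x x, continuous G} ->
  {for x, continuous (fun z => G (dot z z))}.
Proof.
move=> cG.
exact: (@continuous_comp _ _ _ (fun z : 'rV[R]_n => dot z z) G x (continuous_dot2 x) cG).
Qed.

Let continuous_mul_at f g x : {for x, continuous f} -> {for x, continuous g} ->
  {for x, continuous (fun z => f z * g z)}.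
Proof. by move=> cf cg; exact: (cvgM cf cg). Qed.

Let continuous_add_at f g x : {for x, continuous f} -> {for x, continuous g} ->
  {for x, continuous (fun z => f z + g z)}.
Proof. by move=> cf cg; exact: (cvgD cf cg). Qed.

Let continuous_2coord i : continuous (fun z : 'rV[R]_n => 2 * z 0 i).
Proof. by apply: continuous_mulf; [exact: continuous_cstf|exact: continuous_coord]. Qed.

Lemma radial_C2 : C2_on A u.
Proof.
have c1 x i : A x -> {for x, continuous (partial i u)}.
  move=> Ax; apply: (near_continuous _ _ _ (near_partial x i Ax)).
  apply: continuous_mul_at; last exact: continuous_2coord.
  by apply: continuous_radial; exact: is_der_continuous (dF1 _ Ax).
split=> [x Ax|i x Ax]; split.
- by apply: (continuous_radial F); exact: is_der_continuous (dF _ Ax).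
- by move=> i; have [] := radial_partial x i Ax.
- by move=> i; exact: c1.
- exact: c1.
- by move=> j; have [] := radial_second_partial x i j Ax.
move=> j; apply: (@near_continuous (fun z => second z i j)).
  by move/shell_nbhs : Ax; apply: filterS => z /(radial_second_partial z i j)[_ <-].
apply: continuous_add_at.
  apply: continuous_mul_at; last exact: continuous_2coord.
  apply: continuous_mul_at; last exact: continuous_2coord.
  by apply: continuous_radial; exact: cF2.
apply: continuous_mul_at; last exact: continuous_cstf.
by apply: continuous_radial; exact: is_der_continuous (dF1 _ Ax).
Qed.

Lemma radial_gradient x : A x -> gradient u x = (2 * F1 (dot x x)) *: x.
Proof.
move=> Ax; apply/rowP => i; rewrite !mxE /partial.
by have [_ ->] := radial_partial x i Ax; ring.
Qed.

Lemma radial_laplacian x : A x ->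
  laplacian u x = 4 * dot x x * F2 (dot x x) + 2 * n%:R * F1 (dot x x).
Proof.
move=> Ax; rewrite /laplacian (eq_bigr (fun i => 4 * F2 (dot x x) * (x 0 i * x 0 i)
    + 2 * F1 (dot x x))); last first.
  move=> i _; rewrite /partial; have [_ ->] := radial_second_partial x i i Ax.
  by rewrite /second eqxx mulr1; ring.
by rewrite big_split -mulr_sumr sumr_const card_ord -mulr_natl /= /dot; ring.
Qed.

End radial_functions.

(** * The singular solution on the ball *)

Section existence.
Context {R : realType} {n : nat}.
Variables (N a B T ts : R) (y p : R -> R).
Hypotheses (N1 : 1 <= N) (NE : N = n%:R - 2).
Hypothesis ode : forall t, a < t -> ode_at N y p t.
Hypothesis nearP : near_profile N B T y p.
Hypotheses (B0 : 0 <= B) (ats : a < ts) (yts : y ts = 0).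
Implicit Types (s t : R) (x : 'rV[R]_n).

(** The zero [ts] of [y] must land on the unit sphere, which fixes [lambda]. [tau] is logarithmic
    time as a function of s = |x|^2, and [b] is the [s] at which it reaches [a]; as [a < ts],
    [b > 1] and the solution is smooth across the sphere. *)
Let lambda := expR (- (2 * ts)).
Let tau s := ts - ln s / 2.
Let b := expR (2 * (ts - a)).
Let F s := y (tau s).
Let F1 s := - p (tau s) / (2 * s).
Let F2 s := ((N * p (tau s) - nonlin (tau s) (y (tau s))) / 4 + p (tau s) / 2) / s ^+ 2.

Definition radial_solution (x : 'rV[R]_n) := F (dot x x).

Let tau_gt s : 0 < s < b -> a < tau s.
Proof.
by move=> /andP[s0]; rewrite /b /tau -[s in s < _]lnK ?posrE// ltr_expR => h; lra.
Qed.

Let tau_derive s : 0 < s -> is_derive s 1 tau (- (2 * s)^-1).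
Proof.
move=> s0; rewrite /tau; der_eq; field; rewrite gt_eqF//.
Qed.

Let y_tau_derive s : 0 < s < b -> is_derive s 1 (fun s => y (tau s)) (F1 s).
Proof.
move=> sb; have /andP[s0 _] := sb; have [dy _] := ode _ (tau_gt s sb).
have := is_der_comp tau y s _ _ (tau_derive s s0) dy.
by rewrite /F1 mulrN mulNr.
Qed.

Let p_tau_derive s : 0 < s < b -> is_derive s 1 (fun s => p (tau s))
  (- (N * p (tau s) - nonlin (tau s) (y (tau s))) / (2 * s)).
Proof.
move=> sb; have /andP[s0 _] := sb; have [_ dp] := ode _ (tau_gt s sb).
have := is_der_comp tau p s _ _ (tau_derive s s0) dp.
by rewrite mulrN mulNr.
Qed.

Let F1_derive s : 0 < s < b -> is_derive s 1 F1 (F2 s).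
Proof.
move=> sb; have /andP[s0 _] := sb; have dp := p_tau_derive s sb.
have s2 : 2 * s != 0 by rewrite mulf_neq0// gt_eqF.
by rewrite /F1; der_eq; rewrite /F2; field; rewrite gt_eqF.
Qed.

Let F2_continuous s : 0 < s < b -> {for s, continuous F2}.
Proof.
move=> sb; have /andP[s0 _] := sb; have dp := p_tau_derive s sb.
have dy := y_tau_derive s sb; have dt := tau_derive s s0.
have s2 : s ^+ 2 != 0 by rewrite expf_neq0// gt_eqF.
(* Continuity follows from differentiability; the derivative itself is left to be inferred. *)
eapply is_der_continuous; rewrite /F2 /nonlin; der.
Qed.

Let u := radial_solution.
Let shell : set 'rV[R]_n := [set x | 0 < dot x x < b].

Let b1 : 1 < b. Proof. by rewrite /b -expR0 ltr_expR mulr_gt0// subr_gt0. Qed.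

Let closed_ball_shell x : punctured_closed_ball x -> shell x.
Proof.
move=> [x1 /eqP x0]; rewrite /shell /= -!enorm2 exprn_gt0 ?enorm_gt0//=.
by apply: le_lt_trans b1; rewrite expr_le1// enorm_ge0.
Qed.

Let ball_shell x : punctured_ball x -> shell x.
Proof. by move=> [x1 x0]; apply: closed_ball_shell; split => //; exact: ltW. Qed.

Let uC2 : C2_on shell u := radial_C2 F F1 F2 b y_tau_derive F1_derive F2_continuous.

Lemma radial_solution_is_solution : is_solution lambda u.
Proof.
have [C1 C2] := uC2; split.
- split=> [x /ball_shell|i x /ball_shell]; [exact: C1|exact: C2].
- apply: continuous_in_subspaceT => x; rewrite inE => /closed_ball_shell /C1[//].
- move=> x /ball_shell xs; have /andP[s0 _] := xs.
  rewrite (radial_laplacian F F1 F2 b y_tau_derive F1_derive x xs) /F1 /F2 /u /radial_solution /F.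
  have -> : expR (expR (y (tau (dot x x)))) =
      nonlin (tau (dot x x)) (y (tau (dot x x))) * expR (2 * tau (dot x x)).
    by rewrite /nonlin -expRD subrK.
  have E : lambda * expR (2 * tau (dot x x)) = (dot x x)^-1.
    rewrite /lambda -expRD -[in RHS](lnK (_ : dot x x \is Num.pos)) ?posrE// -expRN.
    by congr expR; rewrite /tau; field.
  by rewrite [RHS]mulrCA E NE; field; rewrite gt_eqF.
move=> x x1; rewrite /u /radial_solution /F -enorm2 x1 expr1n /tau ln1 mul0r subr0.
exact: yts.
Qed.

Let sqrt_lambda : Num.sqrt lambda = expR (- ts).
Proof.
rewrite /lambda (_ : - (2 * ts) = - ts + - ts); last by ring.
by rewrite expRD -expr2 sqrtr_sqr ger0_norm// expR_ge0.
Qed.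

Lemma dot_scaled x : x != 0 ->
  dot ((Num.sqrt lambda)^-1 *: x) ((Num.sqrt lambda)^-1 *: x) = expR (2 * (ts - log_inv x)).
Proof.
move=> x0; rewrite -enorm2 enormZ -expR_log_inv// sqrt_lambda -expRN opprK.
by rewrite ger0_norm ?expR_ge0// -expRD expr2 -expRD; congr expR; ring.
Qed.

Let tau_scaled t : tau (expR (2 * (ts - t))) = t.
Proof. by rewrite /tau expRK; field. Qed.

Lemma radial_solution_asymptotics :
  (fun x => u ((Num.sqrt lambda)^-1 *: x)) =
    (fun x => profile N (log_inv x)) +O_ ((0 : 'rV[R]_n)^') (fun x => log_inv x ^- 2).
Proof.
apply/bigO_profileP; exists B => //; exists T => x x0 Tx.
rewrite /u /radial_solution /F dot_scaled// tau_scaled.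
by have [] := nearP _ (ltW Tx).
Qed.

Lemma radial_solution_gradient :
  (fun x => (Num.sqrt lambda)^-1 * enorm (gradient u ((Num.sqrt lambda)^-1 *: x))) =
    (fun x => 1 / (enorm x * log_inv x) + ln (log_inv x) / (2 * enorm x * log_inv x ^+ 2))
    +O_ ((0 : 'rV[R]_n)^') (fun x => 1 / (enorm x * log_inv x ^+ 2)).
Proof.
have C0 : 0 <= 5 + 2 * c0 N by have := c01 N; lra.
apply/bigO_slopeP; exists (B + (5 + 2 * c0 N)); first exact: addr_ge0.
exists (Num.max (Num.max T (T0 N)) a) => x x0.
rewrite !gt_max => /andP[/andP[/ltW Tx /ltW Tx0] ax].
have e0 : enorm x != 0 by rewrite gt_eqF// enorm_gt0.
set z := (Num.sqrt lambda)^-1 *: x.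
have zE : dot z z = expR (2 * (ts - log_inv x)) by exact: dot_scaled.
have zs : shell z by rewrite /shell /= zE expR_gt0 /b ltr_expR; lra.
have p0 := ode_p_pos N B T y p a N1 ode nearP _ ax.
rewrite (radial_gradient F F1 b y_tau_derive z zs) /F1 zE tau_scaled.
have zE' : enorm z = expR (ts - log_inv x).
  by rewrite /z enormZ sqrt_lambda -expRN opprK -expR_log_inv// ger0_norm ?expR_ge0// expRD.
rewrite enormZ zE' sqrt_lambda.
have -> : enorm x * ((expR (- ts))^-1 *
    (`|2 * (- p (log_inv x) / (2 * expR (2 * (ts - log_inv x))))| * expR (ts - log_inv x))) =
    p (log_inv x).
  have -> : 2 * (- p (log_inv x) / (2 * expR (2 * (ts - log_inv x)))) =
      - (p (log_inv x) / expR (ts - log_inv x) ^+ 2).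
    rewrite expr2 -expRD (_ : ts - log_inv x + _ = 2 * (ts - log_inv x)); last by ring.
    by field; rewrite gt_eqF// expR_gt0.
  rewrite normrN gtr0_norm; last by rewrite divr_gt0// exprn_gt0// expR_gt0.
  rewrite -expR_log_inv// -expRN opprK expRD; field.
  by rewrite !gt_eqF ?expR_gt0.
have [_ h2] := nearP _ Tx; have h3 := dprofile_slope N N1 _ Tx0.
rewrite mulrDl; apply: le_trans (lerD h2 h3).
by apply: le_trans (ler_normD _ _); rewrite addrA subrK.
Qed.

Lemma radial_solution_singular (i0 : 'I_n) : singular u.
Proof.
move=> [M [_ /(_ (M + 1) ltac:(lra))]] /nbhs_enormP[r r0 rP].
have l0 : 0 < lambda by exact: expR_gt0.
have [r1 r10 r1P] := profile_blowup lambda N u l0 N1 radial_solution_asymptotics (M + 1).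
pose d := Num.min r r1 / 2.
have m0 : 0 < Num.min r r1 by rewrite lt_min r0.
have d0 : 0 < d by rewrite divr_gt0.
have : d < Num.min r r1 by rewrite /d; lra.
rewrite lt_min => /andP[dr dr1].
have e : enorm (d *: axis i0 : 'rV[R]_n) = d by rewrite enorm_ray// ltW.
have x0 : d *: axis i0 != 0 :> 'rV[R]_n by rewrite -enorm_gt0 e.
have := rP (d *: axis i0); rewrite subr0 e => /(_ dr x0) /= h1.
have := r1P _ x0; rewrite e => /(_ dr1); rewrite ltNge (le_trans (ler_norm _) h1)//.
Qed.

End existence.

Theorem theorem1p1 (R : realType) (n : nat) (hn : (3 <= n)%N) :
  exists! lambda : R, 0 < lambda /\
    exists u : 'rV[R]_n -> R,
      [/\ is_solution lambda u,
          singular u,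
          (fun x => u ((Num.sqrt lambda)^-1 *: x)) =
            (fun x => ln (2 * log_inv x + ln ((n%:R - 2) / log_inv x)
                          + ln (1 + ln (log_inv x) / (2 * log_inv x))))
            +O_ ((0 : 'rV[R]_n)^') (fun x => log_inv x ^- 2)
        & (fun x => (Num.sqrt lambda)^-1
                    * enorm (gradient u ((Num.sqrt lambda)^-1 *: x))) =
            (fun x => 1 / (enorm x * log_inv x)
                      + ln (log_inv x) / (2 * enorm x * log_inv x ^+ 2))
            +O_ ((0 : 'rV[R]_n)^') (fun x => 1 / (enorm x * log_inv x ^+ 2))].
Proof.
have i0 : 'I_n := Ordinal (leq_ltn_trans (leq0n 2) hn).
pose N : R := n%:R - 2.
have N1 : 1 <= N by rewrite /N lerBrDr (_ : 1 + 2 = 3%:R) ?ler_nat//; ring.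
have [a [B [T [y [p [B0 ode nP [ts ats yts]]]]]]] := singular_solution N N1.
have sol := radial_solution_is_solution N a ts y p erefl ode ats yts.
have as1 := @radial_solution_asymptotics R n N B T ts y p nP B0.
have as2 := @radial_solution_gradient R n N a B T ts y p N1 ode nP B0.
have sing := radial_solution_singular N B T ts y p N1 nP B0 i0.
exists (expR (- (2 * ts))); split.
  split; first exact: expR_gt0.
  by exists (radial_solution ts y); split; [exact: sol|exact: sing|exact: as1|exact: as2].
move=> l [l0 [v [vs _ v1 v2]]].
have L0 := expR_gt0 (- (2 * ts)).
apply/eqP; rewrite eq_le !leNgt; apply/andP; split; apply/negP => lt.
  exact: (lambda_not_lt N i0 N1 _ _ _ _ erefl lt l0 vs sol v1 v2 as1 as2).
exact: (lambda_not_lt N i0 N1 _ _ _ _ erefl lt L0 sol vs as1 as2 v1 v2).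
Qed.
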